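(* Let $d\ge1$ be an integer and let $p,q\in(0,1)$ satisfy $\beta:=-\log_2(2^dpq)>0$, $p>2^{-d}$ and $q>2^{-d}$. Let $Q_d$ and $\widehat Q_d$ denote independent fractal percolations. There are constants $0<c\le C<\infty$ depending only on $d,p,q$ such that: (1) for every $n\ge1$ and every $A\subset[-2^{n-1},2^{n-1})^d\cap\mathbb Z^d$, $$c\,\mathbb P\big(Q_d(2^dpq;n)\cap A\neq\emptyset\big)\le\mathbb P\big((Q_d(p;n)+\widehat Q_d(q;n))\cap A\neq\emptyset\big)\le C\,\mathbb P\big(Q_d(2^dpq;n)\cap A\neq\emptyset\big);$$ (2) for every closed set $\Lambda\subset[-\frac12,\frac12]^d$, $$c\,\mathrm{Cap}_\beta(\Lambda)\le\mathbb P\big((Q_d(p)+\widehat Q_d(q))\cap\Lambda\neq\emptyset\big)\le C\,\mathrm{Cap}_\beta(\Lambda)$$ and $$c\,\mathrm{Cap}_\beta(\Lambda)\le\mathbb P\big(Q_d(2^dpq)\cap\Lambda\neq\emptyset\big)\le C\,\mathrm{Cap}_\beta(\Lambda).$$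
   Context: Fractal percolation: fix $d\ge1$ and $p\in[0,1]$. Tile $[-\frac12,\frac12)^d$ naturally by $2^d$ half-open cubes that are translates of $[0,\frac12)^d$; keep each independently with probability $p$, and let $Z_1$ be the collection of kept cubes. Iteratively, divide each cube of $Z_k$ into $2^d$ half-open cubes that are translates of $[0,2^{-k-1})^d$ and keep each independently with probability $p$ to obtain $Z_{k+1}$. The discrete fractal percolation is $Q_d(p;k):=\big(\bigcup_{Q\in Z_k}2^kQ\big)\cap\mathbb Z^d$, and the continuous fractal percolation is $Q_d(p):=\bigcap_{n\ge1}\bigcup_{Q\in Z_n}\overline Q\subset\mathbb R^d$. For a compact set $\Lambda\subset\mathbb R^d$ and $0<\beta<d$, $$\mathrm{Cap}_\beta(\Lambda):=\Big(\inf_\mu\int_{\Lambda\times\Lambda}|x-y|^{-\beta}\,\mu(\mathrm dx)\mu(\mathrm dy)\Big)^{-1},$$ the infimum over Borel probability measures $\mu$ on $\Lambda$ (with $|x-y|^{-\beta}=+\infty$ if $x=y$, $\mathrm{Cap}_\beta(\Lambda)=0$ if the infimum is $+\infty$, and $\mathrm{Cap}_\beta(\emptyset)=0$); $|\cdot|$ is the Euclidean norm. $A+B=\{a+b:a\in A,b\in B\}$ (empty if $A$ or $B$ is empty). *)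

(* Defs.v *)
From HB Require Import structures.
From mathcomp Require Import all_boot all_order all_algebra.
From mathcomp Require Import all_classical all_reals all_analysis.
Set Implicit Arguments.
Unset Strict Implicit.
Unset Printing Implicit Defensive.
Import Order.TTheory GRing.Theory Num.Theory.
Import numFieldNormedType.Exports.
Local Open Scope classical_set_scope.
Local Open Scope ring_scope.

Definition mutually_independent (disp : measure_display)
    (T : measurableType disp) (R : realType) (P : probability T R)
    (I : choiceType) (E : I -> set T) : Prop :=
  forall s : seq I, uniq s ->
    P (\bigcap_(i in [set` s]) E i) = (\prod_(i <- s) P (E i))%E.

Definition independent_families (disp : measure_display)
    (T : measurableType disp) (R : realType) (P : probability T R)
    (I J : Type) (E : I -> set T) (F : J -> set T) : Prop :=
  forall A B : set T, <<s range E >> A -> <<s range F >> B ->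
    P (A `&` B) = (P A * P B)%E.

(** [keep X (k, z)] is the event that the dyadic cube 2^-k (z + [0,1)^d) is
    kept when it is examined.  Marks are attached to all dyadic cubes; those of
    cubes outside [-1/2,1/2)^d or whose parent was discarded are never read. *)
Record percolation (disp : measure_display) (T : measurableType disp)
    (R : realType) (P : probability T R) (d : nat) (p : R) := Percolation {
  keep : nat * 'rV[int]_d -> set T ;
  keep_measurable : forall c, measurable (keep c) ;
  keep_prob : forall c, P (keep c) = p%:E ;
  keep_independent : mutually_independent P keep }.

Definition dyadic_cube (R : realType) (d k : nat) (z : 'rV[int]_d) :
    set 'rV[R]_d :=
  [set x : 'rV[R]_d | forall i, (z ord0 i)%:~R / 2 ^+ k <= x ord0 i
                                < (z ord0 i + 1)%:~R / 2 ^+ k].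

Definition unit_box (R : realType) (d : nat) : set 'rV[R]_d :=
  [set x : 'rV[R]_d | forall i, - 2^-1 <= x ord0 i < 2^-1].
Arguments unit_box {R d}.

Section FractalPercolation.
Context (disp : measure_display) (T : measurableType disp) (R : realType)
  (P : probability T R) (d : nat) (p : R) (X : percolation P d p).

(** The random collection Z_k.  [unit_box] is not itself a dyadic cube of level
    0, but the level-1 dyadic cubes it contains are the 2^d cubes tiling it. *)
Fixpoint kept_cubes (k : nat) (w : T) : set (set 'rV[R]_d) :=
  if k is k'.+1 then
    [set Q | exists z : 'rV[int]_d,
       [/\ Q = dyadic_cube k z,
           exists2 Q', kept_cubes k' w Q' & Q `<=` Q'
         & keep X (k, z) w]]
  else [set unit_box].

Definition discrete_percolation (k : nat) (w : T) : set 'rV[int]_d :=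
  [set x | (\bigcup_(Q in kept_cubes k w) [set 2 ^+ k *: y | y in Q])
             (map_mx intr x)].

Definition continuous_percolation (w : T) : set 'rV[R]_d :=
  \bigcap_(n in [set n | (1 <= n)%N])
    \bigcup_(Q in kept_cubes n w) closure Q.

End FractalPercolation.

Definition sumset (V : zmodType) (A B : set V) : set V :=
  [set a + b | a in A & b in B].

Definition euclid_norm (R : realType) (d : nat) (x : 'rV[R]_d) : R :=
  Num.sqrt (\sum_(i < d) x ord0 i ^+ 2).

Definition borel_space (R : realType) (d : nat) :=
  g_sigma_algebraType [set U : set 'rV[R]_d | open U].

Definition riesz_kernel (R : realType) (d : nat) (beta : R)
    (z : 'rV[R]_d * 'rV[R]_d) : \bar R :=
  if z.1 == z.2 then +oo%E else (euclid_norm (z.1 - z.2) `^ (- beta))%:E.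

(** A Borel probability measure on the closed set L is a Borel probability
    measure on R^d giving mass 1 to L.  In [\bar R], [+oo^-1 = 0] and the
    infimum of the empty set is [+oo], so the capacity is 0 when no measure has
    finite energy and when L is empty. *)
Definition capacity (R : realType) (d : nat) (beta : R) (L : set 'rV[R]_d) :
    \bar R :=
  ((ereal_inf [set (\int[(mu \x mu)%E]_(z in L `*` L) riesz_kernel beta z)%E
     | mu in [set mu : probability (borel_space R d) R | mu L = 1%E]])^-1)%E.

(* Main.v *)
Require Import Defs.
From HB Require Import structures.
From mathcomp Require Import all_boot all_order all_algebra.
From mathcomp Require Import all_classical all_reals all_analysis.
From mathcomp Require Import measurable_realfun.
From mathcomp Require Import ring lra zify.
Import Order.TTheory GRing.Theory Num.Theory.
Import numFieldNormedType.Exports.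
Local Open Scope classical_set_scope.
Local Open Scope ring_scope.
Set Implicit Arguments.
Unset Strict Implicit.
Unset Printing Implicit Defensive.

(** Write [r = 2^d p q = 2^-beta].  Every probability in the statement is shown
    to be comparable to the reciprocal of the least energy of a charge on the
    target, for the kernel [r^-k] on points that share a dyadic cube of level [k]
    but none of level [k + 1].

    The sum meets a set [A] when the random product set of the two percolations
    meets the pairs [(x, y)] with [x + y] in [A].  For independent percolations on
    two trees, hitting such a set is governed by the product kernel
    [K = p^-k q^-l], with [k] and [l] the numbers of levels shared in the two
    coordinates.

    Lower bounds are second moments: a charge [m] on pairs gives the random mass
    of its surviving part, rescaled to have mean [m], whose second moment is the
    [K]-energy of [m] ([second_moment]).

    Upper bounds are a capacity argument for two-parameter processes.  Let [m] be
    the law of a randomly chosen surviving pair.  The trees are ordered so that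
    dyadic cubes are intervals; conditionally on the marks met up to a surviving
    pair [s], the mass still to come has expectation equal to the potential of
    [m] at [s], restricted to one quadrant ([quadrant_energy]).  Summing over [s]
    bounds the energy of [m] by the correlation of its surviving mass with a sum
    of conditional expectations of indicators, and that sum is controlled in L^2
    by the dual form of Doob's inequality, applied once in each coordinate
    ([dual_doob], [dual_cairoli]).  Hence the energy of [m] is at most 256 times
    its mass ([energy_le_mass]).

    Two applications of Cauchy-Schwarz relate [K] to [r].  A cube of level [k]
    is met by the sums of about [2^(dk)] pairs of cubes of level [k], so the
    [r]-energy of the law of [x + y] is at most a constant times the [K]-energy of
    the law of [(x, y)] ([near_sum_sqr]).  Conversely a charge on the target is
    spread uniformly over the pairs with a given sum; since [p] and [q] exceed
    [2^-d], the contributions of pairs of different levels form geometric series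
    and the [K]-energy is at most a constant times the [r]-energy
    ([lift_sum_energy]).

    A single percolation is treated as a sum whose second term keeps every cube,
    with only the pairs whose second coordinate is the origin as target.  So the
    same two bounds, with the same [r], hold for both discrete
    hitting probabilities.

    In the continuum, the limit set meets [L] if and only if all levels do, and a surviving
    branch can be selected measurably ([measurable_branch]).  The law of the point
    of intersection so obtained is a measure on [L] whose Riesz energy is bounded
    by its dyadic energies ([hitting_law], [riesz_energy_le]); in the other
    direction, a measure of finite energy on [L] is discretized at every level
    ([cell_law_energy]). *)

(** * Conditional expectation on a finite product of coins *)

Section FiniteProductSpace.
Context {R : realFieldType} {I : finType} (pi : I -> R).
Hypothesis pi01 : forall i, 0 <= pi i <= 1.
Implicit Types (c e : {ffun I -> bool}) (S : {set I})
  (f g h : {ffun I -> bool} -> R).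

Definition weight c : R := \prod_i (if c i then pi i else 1 - pi i).

Definition expect f : R := \sum_c weight c * f c.

Definition splice S c e : {ffun I -> bool} :=
  [ffun i => if i \in S then c i else e i].

(** Conditional expectation given the coins in [S]: the others are tossed
    again. *)
Definition cexpect S f c : R := expect (fun e => f (splice S c e)).

Lemma weight_ge0 c : 0 <= weight c.
Proof.
apply: prodr_ge0 => i _; case/andP: (pi01 i) => h0 h1.
by case: (c i); rewrite // subr_ge0.
Qed.

(** Independence of the coins is distributivity of products over sums. *)
Lemma expect_prod (F : I -> bool -> R) :
  expect (fun c => \prod_i F i (c i)) =
  \prod_i (pi i * F i true + (1 - pi i) * F i false).
Proof.
rewrite /expect (eq_bigr (fun c : {ffun I -> bool} =>
   \prod_i (fun i (b : bool) => (if b then pi i else 1 - pi i) * F i b) i (c i))); last first.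
  by move=> c _; rewrite -big_split.
rewrite -(bigA_distr_bigA (fun i (b : bool) =>
  (if b then pi i else 1 - pi i) * F i b)).
by apply: eq_bigr => i _; rewrite big_bool /=.
Qed.

Lemma expect1 : expect (fun=> 1) = 1.
Proof.
transitivity (expect (fun c => \prod_(i : I) (fun=> 1) (c i))).
  by apply: eq_bigr => c _; rewrite big1.
by rewrite (expect_prod (fun _ _ => 1)) big1 // => i _; rewrite !mulr1 addrC subrK.
Qed.

Lemma expect_ge0 f : (forall c, 0 <= f c) -> 0 <= expect f.
Proof. by move=> f0; apply: sumr_ge0 => c _; rewrite mulr_ge0 ?weight_ge0. Qed.

Lemma ler_expect f g : (forall c, f c <= g c) -> expect f <= expect g.
Proof.
by move=> fg; apply: ler_sum => c _; rewrite ler_wpM2l ?weight_ge0.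
Qed.

Lemma eq_expect f g : f =1 g -> expect f = expect g.
Proof. by move=> fg; apply: eq_bigr => c _; rewrite fg. Qed.

Lemma expectD f g : expect (fun c => f c + g c) = expect f + expect g.
Proof. by rewrite -big_split; apply: eq_bigr => c _; rewrite mulrDr. Qed.

Lemma expectZ a f : expect (fun c => a * f c) = a * expect f.
Proof. by rewrite mulr_sumr; apply: eq_bigr => c _; rewrite mulrCA. Qed.

Lemma expect_sum (J : finType) (Q : pred J) (F : J -> {ffun I -> bool} -> R) :
  expect (fun c => \sum_(j | Q j) F j c) = \sum_(j | Q j) expect (F j).
Proof.
rewrite /expect exchange_big; apply: eq_bigr => c _ /=.
by rewrite mulr_sumr.
Qed.

(** Exchanging the coins outside [S] between two independent copies preserves
    their joint law; adjointness and composition of conditional expectations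
    both come from this involution. *)
Lemma expect_splice S (F : {ffun I -> bool} -> {ffun I -> bool} -> R) :
  expect (fun c => expect (fun e => F (splice S c e) (splice S e c))) =
  expect (fun c => expect (fun e => F c e)).
Proof.
rewrite /expect.
rewrite (eq_bigr (fun c => \sum_e weight c * weight e *
    F (splice S c e) (splice S e c))); last first.
  by move=> c _; rewrite mulr_sumr; apply: eq_bigr => e _; rewrite mulrA.
rewrite [RHS](eq_bigr (fun c => \sum_e weight c * weight e * F c e)); last first.
  by move=> c _; rewrite mulr_sumr; apply: eq_bigr => e _; rewrite mulrA.
rewrite !pair_big /=.
pose sw (u : {ffun I -> bool} * {ffun I -> bool}) :=
  (splice S u.1 u.2, splice S u.2 u.1).
have swK : involutive sw.
  case=> c e; rewrite /sw /=; congr pair; apply/ffunP => i; rewrite !ffunE;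
  by case: (i \in S).
rewrite [RHS](reindex_inj (inv_inj swK)) /=.
apply: eq_bigr => -[c e] _ /=; congr (_ * _).
rewrite /weight -!big_split; apply: eq_bigr => i _ /=; rewrite !ffunE.
by case: (i \in S) => //; rewrite mulrC.
Qed.

Lemma cexpect_adj S f g :
  expect (fun c => f c * cexpect S g c) = expect (fun c => cexpect S f c * g c).
Proof.
have -> : expect (fun c => f c * cexpect S g c) =
    expect (fun c => expect (fun e => f c * g (splice S c e))).
  by apply: eq_expect => c; rewrite expectZ.
rewrite -(expect_splice S) [RHS](_ : _ =
    expect (fun c => expect (fun e => f (splice S c e) * g c))).
  apply: eq_expect => c; apply: eq_expect => e; congr (_ * g _).
  by apply/ffunP => i; rewrite !ffunE; case: (i \in S).
apply: eq_expect => c; rewrite mulrC -expectZ.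
by apply: eq_expect => e; rewrite mulrC.
Qed.

Lemma cexpect_cexpect S S' f :
  cexpect S (cexpect S' f) =1 cexpect (S :&: S') f.
Proof.
move=> c; rewrite /cexpect.
pose F e e' := f (splice (S :&: S') c e) : R.
transitivity (expect (fun e => expect (fun e' => F (splice S' e e') (splice S' e' e)))).
  apply: eq_expect => e; apply: eq_expect => e'; congr f; apply/ffunP => i.
  by rewrite !ffunE inE; case: (i \in S) (i \in S') => [] [].
rewrite expect_splice; apply: eq_expect => e; rewrite /F.
by have := expectZ (f (splice (S :&: S') c e)) (fun=> 1); rewrite expect1 !mulr1.
Qed.

Lemma cexpect_ge0 S f : (forall c, 0 <= f c) -> forall c, 0 <= cexpect S f c.
Proof. by move=> f0 c; apply: expect_ge0. Qed.

Lemma cexpect_sum S (J : finType) (Q : pred J) (F : J -> {ffun I -> bool} -> R) c :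
  cexpect S (fun c => \sum_(j | Q j) F j c) c = \sum_(j | Q j) cexpect S (F j) c.
Proof. by rewrite /cexpect expect_sum. Qed.

Lemma cexpect_tower S S' f g : S \subset S' ->
  expect (fun c => cexpect S' f c * cexpect S g c) =
  expect (fun c => f c * cexpect S g c).
Proof.
move=> sS; rewrite -cexpect_adj; apply: eq_expect => c.
by rewrite cexpect_cexpect (finset.setIidPr sS).
Qed.

(** Dual form of Doob's L^2 inequality.  The square of the sum of the
    conditional expectations is at most twice its part below the diagonal; there
    the later conditional expectation can be dropped, because the earlier one is
    measurable with respect to the larger set of marks. *)
Lemma dual_doob (X : finType) (rk : X -> nat) (S : X -> {set I})
    (h : X -> {ffun I -> bool} -> R) :
  (forall x y, (rk x <= rk y)%N -> S x \subset S y) ->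
  (forall x c, 0 <= h x c) ->
  expect (fun c => (\sum_x cexpect (S x) (h x) c) ^+ 2) <=
  4 * expect (fun c => (\sum_x h x c) ^+ 2).
Proof.
move=> Smono h0; set G := fun c => \sum_x cexpect (S x) (h x) c.
set H := fun c => \sum_x h x c.
have g0 x c : 0 <= cexpect (S x) (h x) c by apply: cexpect_ge0.
pose D x y := expect (fun c => cexpect (S x) (h x) c * cexpect (S y) (h y) c).
have D0 x y : 0 <= D x y by apply: expect_ge0 => c; rewrite mulr_ge0.
have key : expect (fun c => G c ^+ 2) <= 2 * expect (fun c => H c * G c).
  have -> : expect (fun c => G c ^+ 2) = \sum_x \sum_y D x y.
    rewrite -[RHS](_ : \sum_x expect (fun c => cexpect (S x) (h x) c * G c) = _).
      by rewrite -expect_sum; apply: eq_expect => c; rewrite expr2 -mulr_suml.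
    apply: eq_bigr => x _; rewrite -expect_sum; apply: eq_expect => c.
    by rewrite mulr_sumr.
  have tw : \sum_x \sum_(y | (rk y <= rk x)%N) D x y <= expect (fun c => H c * G c).
    apply: (@le_trans _ _ (\sum_x \sum_(y | (rk y <= rk x)%N)
        expect (fun c => h x c * cexpect (S y) (h y) c))).
      by apply: ler_sum => x _; apply: ler_sum => y yx; rewrite /D cexpect_tower ?Smono.
    rewrite /H [leRHS](_ : _ = \sum_x expect (fun c => h x c * G c)); last first.
      by rewrite -expect_sum; apply: eq_expect => c; rewrite mulr_suml.
    apply: ler_sum => x _; rewrite -expect_sum; apply: ler_expect => c.
    rewrite -mulr_sumr ler_wpM2l // /G [leRHS](bigID (fun y => (rk y <= rk x)%N)) /=.
    by rewrite lerDl sumr_ge0.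
  rewrite mulr2n mulrDl mul1r.
  apply: le_trans (lerD tw tw).
  have sw : \sum_x \sum_(y | (rk y <= rk x)%N) D x y =
            \sum_x \sum_(y | (rk x <= rk y)%N) D x y.
    rewrite (exchange_big_dep predT) //=; apply: eq_bigr => y _.
    by apply: eq_bigr => x _; apply: eq_expect => c; rewrite mulrC.
  rewrite {2}sw -big_split ler_sum // => x _ /=.
  rewrite (bigID (fun y => (rk y <= rk x)%N)) /=.
  rewrite lerD2l [leLHS]big_mkcond [leRHS]big_mkcond; apply: ler_sum => y _.
  by case: leqP => //= [_|yx]; [case: ifP | rewrite ltnW].
have amgm : 2 * expect (fun c => H c * G c) <=
    2 * expect (fun c => H c ^+ 2) + 2^-1 * expect (fun c => G c ^+ 2).
  rewrite -!expectZ -expectD; apply: ler_expect => c.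
  rewrite -subr_ge0 (_ : _ - _ = 2 * (H c - G c / 2) ^+ 2); last by field.
  by rewrite mulr_ge0 // sqr_ge0.
lra.
Qed.

(** Two commuting filtrations: the dual inequality for the second is applied to
    the sums over the first variable. *)
Lemma dual_cairoli (X Y : finType) (rX : X -> nat) (rY : Y -> nat)
    (SX : X -> {set I}) (SY : Y -> {set I})
    (h : X -> Y -> {ffun I -> bool} -> R) :
  (forall x y, (rX x <= rX y)%N -> SX x \subset SX y) ->
  (forall x y, (rY x <= rY y)%N -> SY x \subset SY y) ->
  (forall x y c, 0 <= h x y c) ->
  expect (fun c => (\sum_x \sum_y cexpect (SX x :&: SY y) (h x y) c) ^+ 2) <=
  16 * expect (fun c => (\sum_x \sum_y h x y c) ^+ 2).
Proof.
move=> SXm SYm h0.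
pose k y c := \sum_x cexpect (SX x) (h x y) c.
have k0 y c : 0 <= k y c by apply: sumr_ge0 => x _; apply: cexpect_ge0.
have := dual_doob SYm k0.
rewrite (eq_expect (g := fun c =>
   (\sum_x \sum_y cexpect (SX x :&: SY y) (h x y) c) ^+ 2)); last first.
  move=> c; congr (_ ^+ 2); rewrite [RHS]exchange_big /=; apply: eq_bigr => y _.
  rewrite /k cexpect_sum; apply: eq_bigr => x _.
  by rewrite cexpect_cexpect finset.setIC.
move=> /le_trans; apply.
have -> : (16 : R) = 4 * 4 by ring.
rewrite -mulrA ler_wpM2l //.
pose l x c := \sum_y h x y c.
have l0 x c : 0 <= l x c by apply: sumr_ge0 => y _.
have := dual_doob SXm l0; rewrite (eq_expect (g := fun c => (\sum_y k y c) ^+ 2)) //; last first.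
move=> c; congr (_ ^+ 2); rewrite [RHS]exchange_big /=; apply: eq_bigr => x _.
by rewrite /l cexpect_sum.
Qed.

End FiniteProductSpace.

(** * Energies on a product of two trees *)

Section ProductTreeEnergy.
Context {R : realFieldType} {I X Y : finType} (pi : I -> R).
Hypothesis pi01 : forall i, 0 < pi i <= 1.
Context (pX : X -> {set I}) (pY : Y -> {set I}) (U : {set I}).
Hypothesis pXU : forall x, pX x \subset U.
Hypothesis pYU : forall y, pY y \subset ~: U.
Implicit Types (s t : X * Y) (c : {ffun I -> bool}).

Let pi0 i : pi i != 0. Proof. by case/andP: (pi01 i) => /lt0r_neq0. Qed.
Let pi01' i : 0 <= pi i <= 1.
Proof. by case/andP: (pi01 i) => h0 h1; rewrite ltW. Qed.

Definition pair_path s : {set I} := pX s.1 :|: pY s.2.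

Definition survives s c : bool := [forall i in pair_path s, c i].

Definition tree_kernel s t : R := \prod_(i in pair_path s :&: pair_path t) (pi i)^-1.

Definition tree_energy (m : X * Y -> R) : R :=
  \sum_s \sum_t m s * m t * tree_kernel s t.

(** The density of the law of the coins conditioned to be kept on [T]. *)
Definition density (T : {set I}) c : R := \prod_(i in T) ((c i)%:R / pi i).

Lemma density_ge0 T c : 0 <= density T c.
Proof.
apply: prodr_ge0 => i _; rewrite divr_ge0 //.
by case/andP: (pi01' i).
Qed.

Lemma tree_kernel_ge0 s t : 0 <= tree_kernel s t.
Proof.
by apply: prodr_ge0 => i _; rewrite invr_ge0; case/andP: (pi01' i).
Qed.

Lemma cexpect_density S T c :
  cexpect pi S (density T) c = density (T :&: S) c.
Proof.
pose F i (b : bool) : R :=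
  if i \in T then ((if i \in S then c i else b)%:R / pi i) else 1.
rewrite /cexpect (@eq_expect _ _ _ _ (fun e => \prod_i F i (e i))); last first.
  move=> e; rewrite /density [LHS]big_mkcond; apply: eq_bigr => i _.
  by rewrite /F !ffunE.
rewrite expect_prod /density [RHS]big_mkcond; apply: eq_bigr => i _.
rewrite /F inE; have := pi0 i.
case: (i \in T); case: (i \in S) => //= pin0; last 2 first.
- by rewrite !mulr1 addrC subrK.
- by rewrite !mulr1 addrC subrK.
- by rewrite -mulrDl addrC subrK mul1r.
- by rewrite mul0r mulr0 addr0 mul1r divff.
Qed.

Lemma expect_density T : expect pi (density T) = 1.
Proof.
transitivity (cexpect pi finset.set0 (density T) [ffun=> false]).
  apply: eq_expect => c; congr (density T _).
  by apply/ffunP => i; rewrite !ffunE inE.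
by rewrite cexpect_density finset.setI0 /density big_set0.
Qed.

Lemma expect_densityM S T :
  expect pi (fun c => density S c * density T c) =
  \prod_(i in S :&: T) (pi i)^-1.
Proof.
pose F i (b : bool) : R :=
  (if i \in S then b%:R / pi i else 1) * (if i \in T then b%:R / pi i else 1).
rewrite (@eq_expect _ _ _ _ (fun e => \prod_i F i (e i))); last first.
  by move=> e; rewrite /density [X in X * _]big_mkcond
    [X in _ * X]big_mkcond -big_split; apply: eq_bigr.
rewrite expect_prod [RHS]big_mkcond; apply: eq_bigr => i _.
have := pi0 i; rewrite /F inE.
by case: (i \in S); case: (i \in T) => /= p0; field.
Qed.

(** The natural random charge of mean [m] carried by the surviving pairs. *)
Definition surviving_mass (m : X * Y -> R) c : R :=
  \sum_s m s * density (pair_path s) c.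

Lemma expect_surviving_mass m : expect pi (surviving_mass m) = \sum_s m s.
Proof.
rewrite expect_sum; apply: eq_bigr => s _.
by rewrite expectZ expect_density mulr1.
Qed.

Lemma expect_surviving_mass_sqr m :
  expect pi (fun c => surviving_mass m c ^+ 2) = tree_energy m.
Proof.
rewrite /tree_energy /tree_kernel.
rewrite (@eq_expect _ _ _ _ (fun c => \sum_s \sum_t m s * m t *
   (density (pair_path s) c * density (pair_path t) c))); last first.
  move=> c; rewrite expr2 /surviving_mass mulr_suml; apply: eq_bigr => s _.
  rewrite mulr_sumr; apply: eq_bigr => t _; ring.
rewrite expect_sum; apply: eq_bigr => s _; rewrite expect_sum.
by apply: eq_bigr => t _; rewrite expectZ expect_densityM.
Qed.

Lemma survives_density s (T : {set I}) c : survives s c -> T \subset pair_path s ->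
  density T c = \prod_(i in T) (pi i)^-1.
Proof.
move=> /forall_inP sc /fintype.subsetP Ts; apply: eq_bigr => i iT.
by rewrite sc ?Ts // mul1r.
Qed.

Lemma density_neq0 s c : density (pair_path s) c != 0 -> survives s c.
Proof.
move=> h; apply/forall_inP => i is_; apply: contraNT h => nc.
by rewrite /density (bigD1 i) //= (negbTE nc) mul0r mul0r.
Qed.

(** Paley-Zygmund: the surviving mass lives on the event that a charged pair
    survives. *)
Lemma second_moment m : (forall s, 0 <= m s) ->
  (\sum_s m s) ^+ 2 <= tree_energy m *
    expect pi (fun c => [exists s, (m s != 0) && survives s c]%:R).
Proof.
move=> m0; pose B c := [exists s, (m s != 0) && survives s c].
set Z := surviving_mass m; set M := \sum_s m s.
have M0 : 0 <= M by apply: sumr_ge0.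
rewrite -[expect pi _]/(expect pi (fun c => (B c)%:R)).
have Q0 : 0 <= tree_energy m.
  by rewrite -expect_surviving_mass_sqr; apply: (expect_ge0 pi01') => c; rewrite sqr_ge0.
have b0 : 0 <= expect pi (fun c => (B c)%:R) by apply: (expect_ge0 pi01').
(* nonnegativity of the expectation of the square of [a * Z - 1] on [B] *)
have quad a : 0 <= a ^+ 2 * tree_energy m - 2 * a * M + expect pi (fun c => (B c)%:R).
  have -> : a ^+ 2 * tree_energy m - 2 * a * M + expect pi (fun c => (B c)%:R) =
     expect pi (fun c => a ^+ 2 * Z c ^+ 2 + (- (2 * a)) * Z c + (B c)%:R).
    by rewrite !expectD !expectZ expect_surviving_mass_sqr expect_surviving_mass mulNr.
  apply: (expect_ge0 pi01') => c.
  have [Bc|nBc] := boolP (B c).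
    rewrite (_ : _ + _ = (a * Z c - 1) ^+ 2); first exact: sqr_ge0.
    by rewrite (_ : true%:R = 1 :> R) //; ring.
  have -> : Z c = 0.
    rewrite /Z /surviving_mass big1 // => s _; apply/eqP; rewrite mulf_eq0.
    apply: contraNT nBc; rewrite negb_or => /andP[ms ds].
    by apply/existsP; exists s; rewrite ms density_neq0.
  by rewrite expr0n /= !mulr0 !addr0.
have [Q00|Qn0] := eqVneq (tree_energy m) 0.
  suff -> : M = 0 by rewrite expr0n /= mulr_ge0.
  apply/eqP; rewrite eq_le M0 andbT leNgt; apply/negP => Mp.
  have := quad ((expect pi (fun c => (B c)%:R) + 1) / (2 * M)).
  rewrite Q00 mulr0 add0r.
  rewrite (_ : 2 * _ * M = expect pi (fun c => (B c)%:R) + 1); last by field; lra.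
  lra.
have Qp : 0 < tree_energy m by rewrite lt_neqAle eq_sym Qn0.
have := quad (M / tree_energy m).
rewrite (_ : _ + _ = (tree_energy m * expect pi (fun c => (B c)%:R) - M ^+ 2)
    / tree_energy m); last by field.
by rewrite pmulr_lge0 ?invr_gt0 // subr_ge0.
Qed.

Section Quadrant.
Context (rX : X -> nat) (rY : Y -> nat).
Hypothesis convX : forall x x' x'' i, (rX x <= rX x')%N -> (rX x' <= rX x'')%N ->
  i \in pX x -> i \in pX x'' -> i \in pX x'.
Hypothesis convY : forall x x' x'' i, (rY x <= rY x')%N -> (rY x' <= rY x'')%N ->
  i \in pY x -> i \in pY x'' -> i \in pY x'.
Context (h : X * Y -> {ffun I -> bool} -> R).
Hypothesis h_ge0 : forall s c, 0 <= h s c.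
Hypothesis h_le1 : forall c, \sum_s h s c <= 1.
Hypothesis h_survives : forall s c, h s c != 0 -> survives s c.

Let m s := expect pi (h s).

Let SX x := (\bigcup_(x' | (rX x' <= rX x)%N) pX x') :|: ~: U.
Let SY y := (\bigcup_(y' | (rY y' <= rY y)%N) pY y') :|: U.

Let m_ge0 s : 0 <= m s. Proof. exact: (expect_ge0 pi01'). Qed.

(** By convexity of the order, the marks of a later pair that were already met
    are exactly those it shares with the present one. *)
Lemma future_path s t : (rX s.1 <= rX t.1)%N -> (rY s.2 <= rY t.2)%N ->
  pair_path t :&: (SX s.1 :&: SY s.2) = pair_path s :&: pair_path t.
Proof.
move=> st1 st2; apply/setP => i; rewrite !inE.
have hX x : i \in pX x -> i \in U by exact/fintype.subsetP/pXU.
have hY y : i \in pY y -> i \notin U.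
  by move=> iy; have := fintype.subsetP (pYU y) _ iy; rewrite inE.
apply/idP/idP.
- case/andP=> it /andP[/orP sX /orP sY].
  case: sX => [/finset.bigcupP[x xs ix]|nU]; case: sY => [/finset.bigcupP[y ys iy]|iU].
  + by have := hY _ iy; rewrite (hX _ ix).
  + case/orP: it => it; last by rewrite (negbTE (hY _ it)) in iU.
    by rewrite it (convX xs st1 ix it).
  + case/orP: it => it; first by rewrite (hX _ it) in nU.
    by rewrite it (convY ys st2 iy it) !orbT.
  + by rewrite iU in nU.
- case/andP=> iS iT; rewrite iT /=; case/orP: iS => iS.
    rewrite (hX _ iS) orbT andbT; apply/orP; left.
    by apply/finset.bigcupP; exists s.1.
  rewrite (hY _ iS) orbT /=; apply/orP; left.
  by apply/finset.bigcupP; exists s.2.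
Qed.

(** On the survival of [s], the conditional expectation of the surviving mass
    given the marks met before [s] dominates the potential at [s] of the part
    of [m] that comes after [s]. *)
Lemma quadrant_energy :
  \sum_s \sum_(t | (rX s.1 <= rX t.1)%N && (rY s.2 <= rY t.2)%N)
     m s * m t * tree_kernel s t <= tree_energy m / 8 + 32 * \sum_s m s.
Proof.
set Z := surviving_mass m.
pose G c := \sum_x \sum_y cexpect pi (SX x :&: SY y) (h (x, y)) c.
have step1 : \sum_s \sum_(t | (rX s.1 <= rX t.1)%N && (rY s.2 <= rY t.2)%N)
     m s * m t * tree_kernel s t <= expect pi (fun c => Z c * G c).
  rewrite (@eq_expect _ _ _ _ (fun c => \sum_s
     Z c * cexpect pi (SX s.1 :&: SY s.2) (h s) c)); last first.
    by move=> c; rewrite /G pair_big /= -mulr_sumr; congr (_ * _);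
       apply: eq_bigr => -[].
  rewrite expect_sum; apply: ler_sum => s _.
  rewrite cexpect_adj /m.
  rewrite (eq_bigr (fun t => (\prod_(i in pair_path s :&: pair_path t) (pi i)^-1
      * m t) * expect pi (h s))); last first.
    by move=> t _; rewrite /tree_kernel -/(m t); ring.
  rewrite -mulr_suml -expectZ; apply: (ler_expect pi01') => c.
  have [->|hn0] := eqVneq (h s c) 0; first by rewrite !mulr0.
  rewrite ler_wpM2r // /Z /surviving_mass cexpect_sum [leRHS](bigID
    (fun t => (rX s.1 <= rX t.1)%N && (rY s.2 <= rY t.2)%N)) /=.
  rewrite -[leLHS]addr0; apply: lerD; last first.
    apply: sumr_ge0 => t _; apply: (cexpect_ge0 pi01') => c'.
    by rewrite mulr_ge0 ?density_ge0.
  apply: ler_sum => t /andP[st1 st2].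
  rewrite /cexpect expectZ -/(cexpect pi _ (density (pair_path t)) c).
  rewrite cexpect_density future_path //.
  rewrite (survives_density (h_survives hn0)) ?finset.subsetIl //.
  by rewrite mulrC.
apply: le_trans step1 _.
have amgm : expect pi (fun c => Z c * G c) <=
    expect pi (fun c => Z c ^+ 2) / 8 + 2 * expect pi (fun c => G c ^+ 2).
  rewrite mulrC -!expectZ -expectD; apply: (ler_expect pi01') => c.
  rewrite -subr_ge0.
  (* the weights leave only an eighth of the energy of [m], to be absorbed *)
  rewrite (_ : _ - _ = 2 * (G c - Z c / 4) ^+ 2); last by field.
  by rewrite mulr_ge0 // sqr_ge0.
apply: le_trans amgm _; rewrite expect_surviving_mass_sqr lerD2l.
have SXm x y : (rX x <= rX y)%N -> SX x \subset SX y.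
  move=> xy; apply: finset.setSU; apply/finset.bigcupsP => x' x'x.
  by apply: (finset.bigcup_sup x'); rewrite (leq_trans x'x).
have SYm x y : (rY x <= rY y)%N -> SY x \subset SY y.
  move=> xy; apply: finset.setSU; apply/finset.bigcupsP => x' x'x.
  by apply: (finset.bigcup_sup x'); rewrite (leq_trans x'x).
have /= := @dual_cairoli _ _ _ pi01' _ _ _ _ _ _ (fun x y => h (x, y)) SXm SYm
   (fun x y c => h_ge0 (x, y) c).
rewrite -/G => hG.
apply: (@le_trans _ _ (2 * (16 * expect pi (fun c =>
     (\sum_x \sum_y h (x, y) c) ^+ 2)))).
  by rewrite ler_wpM2l.
rewrite mulrA (_ : 2 * 16 = 32 :> R); last by ring.
rewrite ler_wpM2l // /m -expect_sum; apply: (ler_expect pi01') => c.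
rewrite pair_big /= (eq_bigr (fun s => h s c)); last by case.
by rewrite expr2 ler_piMl // sumr_ge0.
Qed.

End Quadrant.

(** In each coordinate two points are ordered one way or the other, so four
    quadrants, obtained by reversing the orders, cover the energy.  The multiples
    of the energy in the four bounds add up to one half of it. *)
Lemma energy_le_mass (rX : X -> nat) (rY : Y -> nat) (h : X * Y -> {ffun I -> bool} -> R) :
  (forall x x' x'' i, (rX x <= rX x')%N -> (rX x' <= rX x'')%N ->
    i \in pX x -> i \in pX x'' -> i \in pX x') ->
  (forall x x' x'' i, (rY x <= rY x')%N -> (rY x' <= rY x'')%N ->
    i \in pY x -> i \in pY x'' -> i \in pY x') ->
  (forall s c, 0 <= h s c) -> (forall c, \sum_s h s c <= 1) ->
  (forall s c, h s c != 0 -> survives s c) ->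
  tree_energy (fun s => expect pi (h s)) <= 256 * \sum_s expect pi (h s).
Proof.
move=> cX cY h0 h1 hs; set m := fun s => expect pi (h s).
have m0 s : 0 <= m s by exact: (expect_ge0 pi01').
pose rX' x := (\max_x rX x - rX x)%N; pose rY' y := (\max_y rY y - rY y)%N.
have rX'E x x' : (rX' x <= rX' x')%N = (rX x' <= rX x)%N.
  by rewrite leq_sub2lE // leq_bigmax.
have rY'E x x' : (rY' x <= rY' x')%N = (rY x' <= rY x)%N.
  by rewrite leq_sub2lE // leq_bigmax.
have cX' x x' x'' i : (rX' x <= rX' x')%N -> (rX' x' <= rX' x'')%N ->
    i \in pX x -> i \in pX x'' -> i \in pX x'.
  by rewrite !rX'E => a b ix ix''; exact: (cX _ _ _ _ b a).
have cY' x x' x'' i : (rY' x <= rY' x')%N -> (rY' x' <= rY' x'')%N ->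
    i \in pY x -> i \in pY x'' -> i \in pY x'.
  by rewrite !rY'E => a b ix ix''; exact: (cY _ _ _ _ b a).
have q1 := quadrant_energy cX cY h0 h1 hs.
have q2 := quadrant_energy cX cY' h0 h1 hs.
have q3 := quadrant_energy cX' cY h0 h1 hs.
have q4 := quadrant_energy cX' cY' h0 h1 hs.
have cover : tree_energy m <=
  \sum_s \sum_(t | (rX s.1 <= rX t.1)%N && (rY s.2 <= rY t.2)%N)
     m s * m t * tree_kernel s t +
  \sum_s \sum_(t | (rX s.1 <= rX t.1)%N && (rY' s.2 <= rY' t.2)%N)
     m s * m t * tree_kernel s t +
  (\sum_s \sum_(t | (rX' s.1 <= rX' t.1)%N && (rY s.2 <= rY t.2)%N)
     m s * m t * tree_kernel s t +
  \sum_s \sum_(t | (rX' s.1 <= rX' t.1)%N && (rY' s.2 <= rY' t.2)%N)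
     m s * m t * tree_kernel s t).
  rewrite -!big_split /=; apply: ler_sum => s _.
  rewrite ![X in _ <= X + _ + (_ + _)]big_mkcond ![X in _ <= _ + X + (_ + _)]big_mkcond
    ![X in _ <= _ + (X + _)]big_mkcond ![X in _ <= _ + (_ + X)]big_mkcond -!big_split /=.
  apply: ler_sum => t _; rewrite !rX'E !rY'E.
  have : 0 <= m s * m t * tree_kernel s t.
    by rewrite !mulr_ge0 ?tree_kernel_ge0.
  by case: (leqP (rX s.1) (rX t.1)) => [|/ltnW ->];
     case: (leqP (rY s.2) (rY t.2)) => [|/ltnW ->] /=; do ?case: ifP; lra.
rewrite -/m in q1 q2 q3 q4 *; lra.
Qed.

End ProductTreeEnergy.

(** * The dyadic tree *)

Notation leaf d n := {ffun 'I_d -> 'I_(2 ^ n)}.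

Section DyadicTree.
Context {d : nat}.

Lemma expn2_gt0 k : (0 < 2 ^ k)%N. Proof. by rewrite expn_gt0. Qed.

(** The reduction modulo [2 ^ k] only makes the definition total: it does
    nothing when [k <= n]. *)
Definition anc {n} k (x : leaf d n) : leaf d k :=
  [ffun i => Ordinal (ltn_pmod (x i %/ 2 ^ (n - k)) (expn2_gt0 k))].

Lemma ancE n k (x : leaf d n) i : (k <= n)%N ->
  anc k x i = (x i %/ 2 ^ (n - k))%N :> nat.
Proof.
move=> kn; rewrite ffunE /= modn_small // ltn_divLR ?expn_gt0 //.
by rewrite -expnD subnKC.
Qed.

Lemma leafP k (a b : leaf d k) : (forall i, a i = b i :> nat) -> a = b.
Proof. by move=> h; apply/ffunP => i; apply: val_inj; apply: h. Qed.

Lemma anc_anc n k j (x : leaf d n) : (j <= k)%N -> (k <= n)%N ->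
  anc j (anc k x) = anc j x.
Proof.
move=> jk kn; apply: leafP => i; rewrite !ancE ?(leq_trans jk) //.
by rewrite -divnMA -expnD; congr (_ %/ 2 ^ _)%N; lia.
Qed.

Lemma anc_id n (x : leaf d n) : anc n x = x.
Proof. by apply: leafP => i; rewrite ancE // subnn expn0 divn1. Qed.

Lemma leaf0_eq (a b : leaf d 0) : a = b.
Proof. by apply: leafP => i; case: (a i) (b i) => [[|?] ?] [[|?] ?]. Qed.

Lemma eq_anc_le n k j (x y : leaf d n) : (j <= k)%N -> (k <= n)%N ->
  anc k x = anc k y -> anc j x = anc j y.
Proof. by move=> jk kn e; rewrite -(anc_anc _ jk kn) e anc_anc. Qed.

Lemma card_leaf k : #|{: leaf d k}| = ((2 ^ d) ^ k)%N.
Proof. by rewrite card_ffun !card_ord -!expnM mulnC. Qed.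

(** The position in Morton (Z-curve) order: the digits of the successive
    ancestors, the coarsest first, so that every dyadic cube is an interval. *)
Fixpoint morton k (f : 'I_d -> nat) : nat :=
  if k is k'.+1 then
    (morton k' (fun i => f i %/ 2) * #|{: {ffun 'I_d -> bool}}| +
     enum_rank [ffun i => odd (f i)])%N
  else 0%N.

Lemma eq_morton k f g : f =1 g -> morton k f = morton k g.
Proof.
elim: k f g => //= k IH f g fg; congr (_ * _ + _)%N.
  by apply: IH => i; rewrite fg.
by congr (nat_of_ord (enum_rank _)); apply/ffunP => i; rewrite !ffunE fg.
Qed.

(** Dropping the last [m] binary digits of every coordinate drops the last [m]
    digits of the Morton code. *)
Lemma morton_div k m f :
  morton k (fun i => f i %/ 2 ^ m)%N =
  (morton (m + k) f %/ #|{: {ffun 'I_d -> bool}}| ^ m)%N.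
Proof.
elim: m f => [|m IH] f.
  by rewrite divn1; apply: eq_morton => i; rewrite expn0 divn1.
rewrite (@eq_morton _ _ (fun i => f i %/ 2 %/ 2 ^ m)%N); last first.
  by move=> i; rewrite -divnMA expnS.
rewrite (IH (fun i => f i %/ 2)%N) expnS divnMA /= divnMDl; last first.
  by apply/card_gt0P; exists [ffun=> true].
by rewrite [(enum_rank _ %/ _)%N]divn_small ?addn0 // ltn_ord.
Qed.

Lemma morton_inj k (f g : 'I_d -> nat) :
  (forall i, f i < 2 ^ k)%N -> (forall i, g i < 2 ^ k)%N ->
  morton k f = morton k g -> f =1 g.
Proof.
elim: k f g => [|k IH] f g fk gk /= e i.
  by have := fk i; have := gk i; rewrite expn0; lia.
set B := #|_| in e.
have B0 : (0 < B)%N by apply/card_gt0P; exists [ffun=> true].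
have e1 : morton k (fun i => f i %/ 2)%N = morton k (fun i => g i %/ 2)%N.
  have /(congr1 (fun x => x %/ B)%N) := e.
  by rewrite !divnMDl // !divn_small ?addn0 // ltn_ord.
have e2 : [ffun i => odd (f i)] = [ffun i => odd (g i)].
  have /(congr1 (fun x => x %% B)%N) := e.
  rewrite !modnMDl !modn_small ?ltn_ord //.
  by move/val_inj/enum_rank_inj.
have half_lt (u : 'I_d -> nat) : (forall j, u j < 2 ^ k.+1)%N ->
    forall j, (u j %/ 2 < 2 ^ k)%N.
  by move=> uk j; rewrite ltn_divLR // -expnSr.
have /= e3 := IH _ _ (half_lt _ fk) (half_lt _ gk) e1 i.
move/ffunP/(_ i): e2; rewrite !ffunE => e4.
by rewrite (divn_eq (f i) 2) (divn_eq (g i) 2) !modn2 e4 e3.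
Qed.

Definition rank n (x : leaf d n) : nat := morton n (fun i => x i).

(** Ancestors are quotients of ranks, and quotients are monotone. *)
Lemma rank_convex n k (x y z : leaf d n) : (k <= n)%N ->
  (rank x <= rank y)%N -> (rank y <= rank z)%N ->
  anc k x = anc k z -> anc k y = anc k z.
Proof.
move=> kn xy yz e.
pose r (u : leaf d n) := morton k (fun i => anc k u i).
have H (u v : leaf d n) : (rank u <= rank v)%N -> (r u <= r v)%N.
  have rE w : r w = (rank w %/ #|{: {ffun 'I_d -> bool}}| ^ (n - k))%N.
    rewrite /rank -{1}(subnK kn) -morton_div.
    by apply: eq_morton => i; rewrite ancE.
  by rewrite !rE => /leq_div2r; apply.
have rxz : r x = r z by rewrite /r e.
have zy' := H _ _ xy; have yz' := H _ _ yz; rewrite rxz in zy'.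
have /morton_inj eq : r y = r z by apply/eqP; rewrite eqn_leq yz'.
by apply: leafP => i; apply: eq => j; exact: ltn_ord.
Qed.

Section Chain.
Context {R : realFieldType}.

Lemma prefix_chain (P : nat -> bool) n : P 0%N ->
  (forall k, (k < n)%N -> P k.+1 -> P k) ->
  exists2 K, (K <= n)%N & (forall k, (k <= n)%N -> P k = (k <= K)%N) /\
    (forall rho : R, \prod_(k < n) (if P k.+1 then rho else 1) = rho ^+ K).
Proof.
move=> P0; elim: n => [|n IH] Pd.
  exists 0%N => //; split=> [k|rho]; last by rewrite big_ord0.
  by rewrite leqn0 => /eqP ->.
have [k kn|K Kn [PK prK]] := IH; first by apply: Pd; rewrite ltnW.
have [Pn|nPn] := boolP (P n.+1).
  have Kn' : K = n.
    by apply/eqP; rewrite eqn_leq Kn -PK // Pd.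
  exists n.+1 => //; split=> [k|rho]; last first.
    by rewrite big_ord_recr /= prK Kn' Pn exprSr.
  move=> kn1; rewrite kn1; case: (ltngtP k n.+1) kn1 => // [kn|->] _; last exact: Pn.
  by rewrite PK // Kn'.
exists K; first exact: leqW.
split=> [k|rho]; last by rewrite big_ord_recr /= prK (negbTE nPn) mulr1.
move=> kn1; case: (ltngtP k n.+1) kn1 => // [kn|->] _; first by rewrite PK.
by rewrite (negbTE nPn) leqNgt ltnS Kn.
Qed.

Lemma geometric_prefix (r : R) n K : 0 < r < 1 -> (K <= n)%N ->
  (1 - r) * (\sum_(k < n.+1) (r^-1) ^+ k *+ (k <= K)%N) <= (r^-1) ^+ K.
Proof.
move=> /andP[r0 r1] Kn.
rewrite (eq_bigr (fun k : 'I_n.+1 => if (k < K.+1)%N then (r^-1) ^+ k else 0)); last first.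
  by move=> k _; rewrite ltnS; case: leqP.
rewrite -big_mkcond /= -(big_ord_widen n.+1 (fun k => r^-1 ^+ k)) //.
have : (1 - r) * (\sum_(k < K.+1) r^-1 ^+ k) = r^-1 ^+ K - r.
  elim: K {Kn} => [|K IH]; first by rewrite big_ord_recr big_ord0 /= add0r mulr1 expr0.
  rewrite big_ord_recr /= mulrDr IH exprS; field; lra.
move=> ->; lra.
Qed.
End Chain.

Section MarkedPaths.
Context {R : realFieldType} {n : nat}.

(** Marks of the first tree are injected on the left, those of the second on the
    right; [(k, a)] stands for the vertex [a] of level [k.+1]. *)
Definition mark (n : nat) : finType := (('I_n * leaf d n) + ('I_n * leaf d n))%type.

(** The ancestor of level [k], kept in the type of the leaves so that all marks
    have one type. *)
Definition coarse (k : nat) (x : leaf d n) : leaf d n :=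
  [ffun i => Ordinal (leq_ltn_trans (leq_div (x i) (2 ^ (n - k))) (ltn_ord (x i)))].

Definition left_path (x : leaf d n) : {set mark n} :=
  [set i : mark n | if i is inl ka then ka.2 == coarse ka.1.+1 x else false].

Definition right_path (y : leaf d n) : {set mark n} :=
  [set i : mark n | if i is inr ka then ka.2 == coarse ka.1.+1 y else false].

Definition left_marks : {set mark n} := [set i : mark n | if i is inl _ then true else false].

Definition mark_prob (p q : R) (i : mark n) : R := if i is inl _ then p else q.

Lemma left_path_sub x : left_path x \subset left_marks.
Proof. by apply/fintype.subsetP => -[] ka; rewrite !inE. Qed.

Lemma right_path_sub y : right_path y \subset ~: left_marks.
Proof. by apply/fintype.subsetP => -[] ka; rewrite !inE. Qed.

Lemma eq_coarse k x y : (k <= n)%N -> (coarse k x == coarse k y) = (anc k x == anc k y).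
Proof.
move=> kn; apply/eqP/eqP => /ffunP e.
  apply: leafP => i; rewrite !ancE //; have := e i.
  by rewrite !ffunE => /(congr1 val).
apply: leafP => i; rewrite !ffunE /=; have := e i.
by move/(congr1 val) => /=; rewrite -/(nat_of_ord _) !ancE.
Qed.

Lemma left_path_convex (x y z : leaf d n) i : (rank x <= rank y)%N ->
  (rank y <= rank z)%N -> i \in left_path x -> i \in left_path z -> i \in left_path y.
Proof.
case: i => ka xy yz; rewrite !inE // => /eqP -> /eqP/esym e.
rewrite eq_sym eq_coarse; last exact: ltn_ord.
apply/eqP; move/eqP: e; rewrite eq_coarse ?ltn_ord // => /eqP e.
by rewrite (rank_convex _ xy yz) ?ltn_ord.
Qed.

Lemma right_path_convex (x y z : leaf d n) i : (rank x <= rank y)%N ->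
  (rank y <= rank z)%N -> i \in right_path x -> i \in right_path z -> i \in right_path y.
Proof.
case: i => ka xy yz; rewrite !inE // => /eqP -> /eqP/esym e.
rewrite eq_sym eq_coarse; last exact: ltn_ord.
apply/eqP; move/eqP: e; rewrite eq_coarse ?ltn_ord // => /eqP e.
by rewrite (rank_convex _ xy yz) ?ltn_ord.
Qed.

Definition pair_kernel (p q : R) := tree_kernel (mark_prob p q) left_path right_path.

Lemma pair_kernelE p q s t : pair_kernel p q s t =
  (\prod_(k < n) (if anc k.+1 s.1 == anc k.+1 t.1 then p^-1 else 1)) *
  (\prod_(k < n) (if anc k.+1 s.2 == anc k.+1 t.2 then q^-1 else 1)).
Proof.
rewrite /pair_kernel /tree_kernel big_mkcond /= big_sumType /=; congr (_ * _).
- pose G k a := if (inl (k, a) : mark n) \in pair_path left_path right_path s :&: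
     pair_path left_path right_path t then p^-1 else 1.
  rewrite (eq_bigr (fun u => G u.1 u.2)); last by case.
  rewrite -pair_bigA /G /=.
  apply: eq_bigr => k _; rewrite -eq_coarse ?ltn_ord // (bigD1 (coarse k.+1 s.1)) //=.
  rewrite !inE eqxx /= !orbF big1 ?mulr1 // => a /negbTE an.
  by rewrite !inE /= an.
- pose G k a := if (inr (k, a) : mark n) \in pair_path left_path right_path s :&:
     pair_path left_path right_path t then q^-1 else 1.
  rewrite (eq_bigr (fun u => G u.1 u.2)); last by case.
  rewrite -pair_bigA /G /=.
  apply: eq_bigr => k _; rewrite -eq_coarse ?ltn_ord // (bigD1 (coarse k.+1 s.2)) //=.
  rewrite !inE eqxx /= big1 ?mulr1 // => a /negbTE an.
  by rewrite !inE /= an.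
Qed.

Lemma anc_chain (x y : leaf d n) : exists2 K, (K <= n)%N &
  (forall k, (k <= n)%N -> (anc k x == anc k y) = (k <= K)%N) /\
  (forall rho : R, \prod_(k < n) (if anc k.+1 x == anc k.+1 y then rho else 1) = rho ^+ K).
Proof.
apply: (@prefix_chain R (fun k => anc k x == anc k y) n).
  by apply/eqP/leaf0_eq.
by move=> k kn /eqP e; apply/eqP/(eq_anc_le _ _ e).
Qed.

(** Only the common levels of the two trees are kept. *)
Lemma pair_kernel_ge p q s t : 0 < p <= 1 -> 0 < q <= 1 -> p * q < 1 ->
  (1 - p * q) * (\sum_(k < n.+1) ((p * q)^-1) ^+ k *+
     ((anc k s.1 == anc k t.1) && (anc k s.2 == anc k t.2))) <= pair_kernel p q s t.
Proof.
move=> /andP[p0 p1] /andP[q0 q1] pq1; rewrite pair_kernelE.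
have [K Kn [PK ->]] := anc_chain s.1 t.1; have [L Ln [PL ->]] := anc_chain s.2 t.2.
rewrite (eq_bigr (fun k : 'I_n.+1 => ((p * q)^-1) ^+ k *+ (k <= minn K L)%N)); last first.
  by move=> k _; rewrite PK ?PL -1?ltnS // leq_min.
apply: le_trans (geometric_prefix _ _) _; first by rewrite pq1 mulr_gt0.
  by rewrite geq_min Kn.
have pi0 : 0 <= p^-1 by rewrite invr_ge0 ltW.
have qi0 : 0 <= q^-1 by rewrite invr_ge0 ltW.
rewrite invfM exprMn ler_pM ?exprn_ge0 //; apply: ler_weXn2l.
- by rewrite invf_ge1.
- by rewrite geq_minl.
- by rewrite invf_ge1.
- by rewrite geq_minr.
Qed.

(** The exact pair of numbers of shared levels is one of the terms. *)
Lemma pair_kernel_le p q s t : 0 < p -> 0 < q ->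
  pair_kernel p q s t <= \sum_(k < n.+1) \sum_(l < n.+1) (p^-1) ^+ k * (q^-1) ^+ l *+
     ((anc k s.1 == anc k t.1) && (anc l s.2 == anc l t.2)).
Proof.
move=> p0 q0; rewrite pair_kernelE.
have [K Kn [PK ->]] := anc_chain s.1 t.1; have [L Ln [PL ->]] := anc_chain s.2 t.2.
have nonneg (k l : nat) b : 0 <= (p^-1) ^+ k * (q^-1) ^+ l *+ (b : bool).
  by rewrite mulrn_wge0 // mulr_ge0 // exprn_ge0 // invr_ge0 ltW.
rewrite (bigD1 (Ordinal (Kn : (K < n.+1)%N))) //= (bigD1 (Ordinal (Ln : (L < n.+1)%N))) //=.
rewrite PK // PL // !leqnn mulr1n -addrA lerDl.
by rewrite addr_ge0 ?sumr_ge0 // => k _; rewrite sumr_ge0.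
Qed.

End MarkedPaths.
End DyadicTree.

Arguments mark d n : clear implicits.

(** * Finite families of independent events *)

Section FiniteEvents.
Context {disp : measure_display} {T : measurableType disp} {I : finType}
  (E : I -> set T).

Definition config (w : T) : {ffun I -> bool} := [ffun i => `[< E i w >]].

Lemma measurable_finset (J : finType) (Q : pred J) (F : J -> set T) :
  (forall j, measurable (F j)) -> measurable [set w | exists2 j, Q j & F j w].
Proof.
move=> mF; rewrite (_ : [set w | _] = \bigcup_(j in [set j | Q j]) F j).
  by apply: fin_bigcup_measurable => //; exact: finite_finset.
by apply/seteqP; split=> w [j Qj Fj]; exists j.
Qed.

Hypothesis mE : forall i, measurable (E i).

Lemma configE c : [set w | config w = c] =
  \big[setI/setT]_i (if c i then E i else ~` E i).
Proof.
rewrite -bigcap_seq; apply/seteqP; split=> w /=.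
  by move=> <- i _; rewrite ffunE; case: asboolP.
move=> h; apply/ffunP => i; rewrite ffunE; have := h i.
rewrite /= mem_index_enum => /(_ isT).
by case: (c i) => /= hi; [apply/asboolP | apply/asboolF].
Qed.

Lemma measurable_config c : measurable [set w | config w = c].
Proof.
rewrite configE; apply: bigsetI_measurable => i _.
by case: (c i) => //; apply: measurableC.
Qed.

Lemma measurable_configP (Q : pred {ffun I -> bool}) :
  measurable [set w | Q (config w)].
Proof.
rewrite (_ : [set w | _] = [set w | exists2 c, Q c & [set w | config w = c] w]).
  exact/measurable_finset/measurable_config.
by apply/seteqP; split=> w /= => [Qw|[c Qc ->]] //; exists (config w).
Qed.

End FiniteEvents.

Lemma set_seq_cons (A : eqType) (x : A) (s : seq A) :
  [set` x :: s] = x |` [set` s].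
Proof.
apply/seteqP; split=> y /=; rewrite inE; first by case/orP=> [/eqP ->|]; [left|right].
by case=> [->|->]; rewrite ?eqxx ?orbT.
Qed.

Section RealProbability.
Context {disp : measure_display} {T : measurableType disp} {R : realType}
  (P : probability T R).

(** Probabilities as real numbers, for the finite sums below. *)
Definition pr (A : set T) : R := fine (P A).

Lemma pr_ge0 A : 0 <= pr A. Proof. exact: fine_ge0. Qed.

Lemma prE A : measurable A -> P A = (pr A)%:E.
Proof.
by move=> mA; rewrite fineK // fin_num_measure.
Qed.

Lemma pr_le A B : measurable A -> measurable B -> A `<=` B -> pr A <= pr B.
Proof. by move=> mA mB AB; rewrite -lee_fin -!prE // le_measure ?inE. Qed.

Lemma pr_sum (J : finType) (Q : pred J) (F : J -> set T) :
  (forall j, measurable (F j)) ->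
  (forall i j w, F i w -> F j w -> i = j) ->
  pr [set w | exists2 j, Q j & F j w] = \sum_(j | Q j) pr (F j).
Proof.
move=> mF tF; apply: EFin_inj; rewrite -prE; last exact: measurable_finset.
rewrite /pr EFin_sum_fine; last by move=> j _; rewrite fin_num_measure.
rewrite -big_enum /= fsbig_seq; last exact: enum_uniq.
rewrite -measure_fin_bigcup //.
- congr (P _); apply/seteqP; split=> w [j Qj Fj]; exists j => //=.
    by rewrite mem_enum.
  by move: Qj; rewrite /= mem_enum.
- by move=> i j _ _ [w [Fi Fj]]; exact: tF Fi Fj.
Qed.

Lemma pr_config_partition (I : finType) (E : I -> set T) (A : set T) :
  (forall i, measurable (E i)) -> measurable A ->
  \sum_c pr (A `&` [set w | config E w = c]) = pr A.
Proof.
move=> mE mA; rewrite -pr_sum //.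
- congr (pr _); apply/seteqP; split=> w; first by case=> c _ [].
  by move=> Aw; exists (config E w).
- by move=> c; apply: measurableI => //; exact: measurable_config.
- by move=> c c' w [_ /= <-] [_ <-].
Qed.

(** Independence is a product rule for intersections of the events; the
    complements enter one at a time. *)
Lemma pr_config (I : finType) (E : I -> set T) (pi : I -> R) c :
  (forall i, measurable (E i)) ->
  (forall s : seq I, uniq s -> pr (\bigcap_(i in [set` s]) E i) = \prod_(i <- s) pi i) ->
  pr [set w | config E w = c] = weight pi c.
Proof.
move=> mE indE.
have mcap (s : seq I) : measurable (\bigcap_(i in [set` s]) E i).
  by rewrite bigcap_seq; exact: bigsetI_measurable.
have mcapC (s : seq I) : measurable (\bigcap_(i in [set` s]) ~` E i).
  by rewrite bigcap_seq; apply: bigsetI_measurable => i _; exact: measurableC.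
have key (t s : seq I) : uniq (s ++ t) ->
    pr ((\bigcap_(i in [set` s]) E i) `&` (\bigcap_(i in [set` t]) ~` E i)) =
    \prod_(i <- s) pi i * \prod_(i <- t) (1 - pi i).
  elim: t s => [|j t IH] s ust.
    by rewrite set_nil bigcap_set0 setIT big_nil mulr1 indE // -[s]cats0.
  have us1 : uniq (s ++ t).
    by apply: subseq_uniq ust; apply: cat_subseq => //; exact: subseq_cons.
  have us2 : uniq ((j :: s) ++ t).
    by rewrite -(perm_uniq (permEl (perm_catCA s [:: j] t))).
  set A := \bigcap_(i in [set` s]) E i; set B := \bigcap_(i in [set` t]) ~` E i.
  rewrite set_seq_cons bigcap_setU1 big_cons setICA setIC -setDE.
  have mAB : measurable (A `&` B) by apply: measurableI; [exact: mcap|exact: mcapC].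
  have -> : pr ((A `&` B) `\` E j) = pr (A `&` B) - pr ((A `&` B) `&` E j).
    have mI : measurable ((A `&` B) `&` E j) by apply: measurableI.
    have mD : measurable ((A `&` B) `\` E j) by apply: measurableD.
    apply: EFin_inj; rewrite EFinB -!prE //.
    by rewrite measureD // (le_lt_trans (probability_le1 P mAB)) // ltry.
  rewrite IH // (_ : _ `&` E j = (\bigcap_(i in [set` j :: s]) E i) `&` B); last first.
    by rewrite set_seq_cons bigcap_setU1 -/A [LHS]setIC setIA.
  by rewrite IH // big_cons; ring.
have := key [seq i <- index_enum I | ~~ c i] [seq i <- index_enum I | c i].
rewrite (perm_uniq (_ : perm_eq _ (index_enum I))) ?index_enum_uniq; last first.
  exact: (permEl (perm_filterC (fun i => c i) (index_enum I))).
move=> /(_ isT) h; rewrite /weight (bigID (fun i => c i)) /=.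
rewrite !big_filter in h.
rewrite [X in _ = X * _](eq_bigr pi); last by move=> i ->.
rewrite [X in _ = _ * X](eq_bigr (fun i => 1 - pi i)); last by move=> i /negbTE ->.
rewrite -h; congr (pr _); apply/seteqP; split=> w /=.
  move=> <-; split=> i /=; rewrite mem_filter ffunE => /andP[].
    by move/asboolP.
  by move/asboolPn.
move=> [h1 h2]; apply/ffunP => i; rewrite ffunE.
have [ci|nci] := boolP (c i); [apply/asboolP/h1|apply/asboolPn/h2];
by rewrite /= mem_filter ?ci ?nci mem_index_enum.
Qed.

End RealProbability.

(** * Energies level by level *)

Section CauchySchwarzCover.
Context {R : realFieldType}.

Lemma sqr_sum_le (I : finType) (Q : pred I) (x : I -> R) :
  (\sum_(i | Q i) x i) ^+ 2 <= #|[pred i | Q i]|%:R * \sum_(i | Q i) x i ^+ 2.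
Proof.
have -> : (\sum_(i | Q i) x i) ^+ 2 = \sum_(i | Q i) \sum_(j | Q j) x i * x j.
  by rewrite expr2 mulr_suml; apply: eq_bigr => i _; rewrite mulr_sumr.
apply: (@le_trans _ _ (\sum_(i | Q i) \sum_(j | Q j) (x i ^+ 2 / 2 + x j ^+ 2 / 2))).
  apply: ler_sum => i _; apply: ler_sum => j _.
  rewrite -subr_ge0 (_ : _ - _ = (x i - x j) ^+ 2 / 2); last by field.
  by rewrite divr_ge0 // sqr_ge0.
under eq_bigr do rewrite big_split /=.
rewrite big_split /= [X in _ + X]exchange_big /= -big_split /=.
rewrite mulr_sumr; apply: ler_sum => i _.
by rewrite !sumr_const -mulrnDl -splitr mulr_natl.
Qed.

(** Cauchy-Schwarz on every cell [v], then exchange of the summations. *)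
Lemma cover_sum_sqr (U V : finType) (rel : U -> V -> bool) (N M : R)
    (mu : U -> R) (nu : V -> R) :
  (forall u, 0 <= mu u) -> (forall v, 0 <= nu v) ->
  (forall v, nu v <= \sum_(u | rel u v) mu u) ->
  (forall v, #|[pred u | rel u v]|%:R <= N) ->
  (forall u, #|[pred v | rel u v]|%:R <= M) -> 0 <= N ->
  \sum_v nu v ^+ 2 <= N * M * \sum_u mu u ^+ 2.
Proof.
move=> mu0 nu0 cov cN cM N0.
apply: (@le_trans _ _ (\sum_v N * \sum_(u | rel u v) mu u ^+ 2)).
  apply: ler_sum => v _; apply: le_trans (_ : (\sum_(u | rel u v) mu u) ^+ 2 <= _).
    by rewrite lerXn2r ?nnegrE // sumr_ge0.
  apply: le_trans (sqr_sum_le _ _) _; apply: ler_wpM2r => //.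
  by apply: sumr_ge0 => u _; rewrite sqr_ge0.
rewrite -mulr_sumr -mulrA ler_wpM2l // (exchange_big_dep predT) //=.
rewrite mulr_sumr; apply: ler_sum => u _.
rewrite sumr_const -[leLHS]mulr_natl; apply: ler_wpM2r; first exact: sqr_ge0.
exact: cM.
Qed.

(** Energies of the kernels used here are sums of squares of masses of
    classes. *)
Lemma sum_same_class (S V : finType) (g : S -> V) (m : S -> R) :
  \sum_s \sum_t m s * m t *+ (g s == g t) = \sum_v (\sum_(s | g s == v) m s) ^+ 2.
Proof.
under [RHS]eq_bigr do rewrite expr2 mulr_suml.
rewrite [RHS](exchange_big_dep predT) //=; apply: eq_bigr => s _.
rewrite [RHS](bigD1 (g s)) //= [X in _ + X]big1 ?addr0; last first.
  by move=> v /andP[/eqP <-]; rewrite eqxx.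
rewrite mulr_sumr [RHS]big_mkcond; apply: eq_bigr => t _.
by rewrite eq_sym; case: eqP.
Qed.

Lemma geometric_tail (x : R) k n : 0 <= x < 1 ->
  \sum_(l < n.+1 | (k <= l)%N) x ^+ l <= x ^+ k / (1 - x).
Proof.
move=> /andP[x0 x1]; rewrite ler_pdivlMr ?subr_gt0 //.
have main m : \sum_(l < m | (k <= l)%N) x ^+ l * (1 - x) =
    if (k <= m)%N then x ^+ k - x ^+ m else 0.
  elim: m => [|m IH]; first by rewrite big_ord0; case: ltngtP => // ->; rewrite subrr.
  rewrite big_mkcond big_ord_recr /= -big_mkcond IH.
  have [km|km] := leqP k m; first by rewrite leqW // exprS; ring.
  rewrite addr0; case: leqP => // km'.
  by rewrite (_ : k = m.+1) ?subrr //; apply/eqP; rewrite eqn_leq km km'.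
rewrite mulr_suml main; case: ifP => _; last by rewrite exprn_ge0.
by rewrite gerBl exprn_ge0.
Qed.

End CauchySchwarzCover.

Section Cells.
Context {d : nat}.

Lemma card_window k w (lo : 'I_d -> nat) (Q : pred (leaf d k)) :
  (forall a, Q a -> forall i, (lo i <= a i < lo i + w)%N) ->
  (#|[pred a | Q a]| <= w ^ d)%N.
Proof.
case: w => [|w] h.
  have [-> //|/card_gt0P[a /= Qa]] := posnP #|[pred a | Q a]|.
  case: d lo Q h a Qa => [|d'] lo Q h a Qa; last first.
    by have := h a Qa ord0; rewrite addn0; case: leqP => // ? /=; rewrite ltnNge => /negP.
  by rewrite (leq_trans (max_card _)) // card_ffun !card_ord expn0.
pose f (a : leaf d k) : {ffun 'I_d -> 'I_w.+1} := [ffun i => inord (a i - lo i)].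
rewrite -(card_in_image (f := f)).
  by rewrite (leq_trans (max_card _)) // card_ffun !card_ord.
move=> a b Qa Qb /ffunP e; apply: leafP => i; have := e i; rewrite !ffunE.
have /andP[a1 a2] := h a Qa i; have /andP[b1 b2] := h b Qb i.
move=> /(congr1 val) /=; rewrite !inordK; lia.
Qed.

(** Up to rounding, [a + b = c + 2 ^ k.-1], which is addition of the cubes when
    coordinates are counted from the corner of the unit box.  Everything is
    doubled so that level 0 makes sense, and the slack 4 covers both half-open
    and closed cubes. *)
Definition near k (a b c : leaf d k) : bool :=
  [forall i, (2 * (a i + b i) <= 2 * c i + 2 ^ k + 4)%N &&
             (2 * c i + 2 ^ k <= 2 * (a i + b i) + 4)%N].

Lemma card_near_target k (a b : leaf d k) : (#|[pred c | near a b c]| <= 6 ^ d)%N.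
Proof.
apply: (@card_window _ _ (fun i => (2 * (a i + b i) - 4 - 2 ^ k) %/ 2)%N).
by move=> c /forallP h i; have := h i; lia.
Qed.

Lemma card_near_left k (b c : leaf d k) : (#|[pred a | near a b c]| <= 6 ^ d)%N.
Proof.
apply: (@card_window _ _ (fun i => (2 * c i + 2 ^ k - 4 - 2 * b i) %/ 2)%N).
by move=> a /forallP h i; have := h i; lia.
Qed.

(** The second cube is free and determines the first up to a bounded choice. *)
Lemma card_near_pair k (B : pred (leaf d k)) N (c : leaf d k) :
  (#|[pred b | B b]| <= N)%N ->
  (#|[pred ab : leaf d k * leaf d k | near ab.1 ab.2 c && B ab.2]| <= 6 ^ d * N)%N.
Proof.
move=> BN; rewrite -sum1_card.
rewrite (eq_bigl (fun ab : leaf d k * leaf d k => predT ab.1 && (near ab.1 ab.2 c && B ab.2))) //.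
rewrite -(pair_big_dep predT (fun a b => near a b c && B b) (fun _ _ => 1%N)) /=.
rewrite (exchange_big_dep (fun b => B b)) /=; last by move=> a b _ /andP[].
apply: (@leq_trans (\sum_(b | B b) 6 ^ d)).
  apply: leq_sum => b Bb; rewrite sum1_card; apply: leq_trans (card_near_left b c).
  by apply/subset_leq_card/fintype.subsetP => a; rewrite !inE => /andP[].
by rewrite sum_nat_const mulnC leq_mul2l BN orbT.
Qed.

Lemma card_descendants n l (b : leaf d l) : (l <= n)%N ->
  (#|[pred y : leaf d n | anc l y == b]| <= (2 ^ (n - l)) ^ d)%N.
Proof.
move=> ln; apply: (@card_window _ _ (fun i => b i * 2 ^ (n - l))%N) => y /eqP <- i.
rewrite ancE // leq_trunc_div /= -mulSnr.
by rewrite ltn_ceil // expn_gt0.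
Qed.

Context {R : realFieldType}.

Definition level_mass {n} k (nu : leaf d n -> R) (c : leaf d k) : R :=
  \sum_(z | anc k z == c) nu z.

Definition level_mass2 {n} k l (m : leaf d n * leaf d n -> R)
    (ab : leaf d k * leaf d l) : R :=
  \sum_(s | (anc k s.1, anc l s.2) == ab) m s.

Arguments level_mass {n} k nu c.
Arguments level_mass2 {n} k l m ab.

(** Riesz energy on the dyadic tree. *)
Definition dyadic_energy {n} (r : R) (nu : leaf d n -> R) : R :=
  \sum_(k < n.+1) (r^-1) ^+ k * \sum_c level_mass k nu c ^+ 2.

Definition pair_energy n (p q : R) (m : leaf d n * leaf d n -> R) : R :=
  \sum_s \sum_t m s * m t * pair_kernel p q s t.

Lemma pair_energy_ge n p q (m : leaf d n * leaf d n -> R) :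
  0 < p <= 1 -> 0 < q <= 1 -> p * q < 1 -> (forall s, 0 <= m s) ->
  (1 - p * q) * (\sum_(k < n.+1) ((p * q)^-1) ^+ k *
     \sum_ab level_mass2 k k m ab ^+ 2) <= pair_energy p q m.
Proof.
move=> p01 q01 pq1 m0.
under eq_bigr => k _.
  rewrite -(sum_same_class (fun s : leaf d n * leaf d n => (anc k s.1, anc k s.2))).
  over.
apply: (@le_trans _ _ (\sum_s \sum_t m s * m t * ((1 - p * q) *
    \sum_(k < n.+1) (p * q)^-1 ^+ k *+
     ((anc k s.1 == anc k t.1) && (anc k s.2 == anc k t.2))))); last first.
  apply: ler_sum => s _; apply: ler_sum => t _; apply: ler_wpM2l; first by rewrite mulr_ge0.
  exact: pair_kernel_ge.
rewrite le_eqVlt; apply/orP; left; apply/eqP.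
rewrite mulr_sumr; under [LHS]eq_bigr => k _.
  rewrite mulrA mulr_sumr; under eq_bigr do rewrite mulr_sumr.
  over.
rewrite [LHS]exchange_big /=; apply: eq_bigr => s _.
rewrite [LHS]exchange_big /=; apply: eq_bigr => t _.
rewrite mulr_sumr mulr_sumr; apply: eq_bigr => k _.
rewrite xpair_eqE; case: (_ && _); rewrite ?mulr0n ?mulr1n ?mulr0 //; ring.
Qed.

Lemma pair_energy_le_levels n p q (m : leaf d n * leaf d n -> R) :
  0 < p -> 0 < q -> (forall s, 0 <= m s) ->
  pair_energy p q m <= \sum_(k < n.+1) \sum_(l < n.+1) (p^-1) ^+ k * (q^-1) ^+ l *
     \sum_ab level_mass2 k l m ab ^+ 2.
Proof.
move=> p0 q0 m0.
under [leRHS]eq_bigr => k _ do under eq_bigr => l _ do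
  rewrite -(sum_same_class (fun s : leaf d n * leaf d n => (anc k s.1, anc l s.2))).
apply: (@le_trans _ _ (\sum_s \sum_t m s * m t * (\sum_(k < n.+1) \sum_(l < n.+1)
   (p^-1) ^+ k * (q^-1) ^+ l *+
     ((anc k s.1 == anc k t.1) && (anc l s.2 == anc l t.2))))).
  apply: ler_sum => s _; apply: ler_sum => t _; apply: ler_wpM2l; first by rewrite mulr_ge0.
  exact: pair_kernel_le.
rewrite le_eqVlt; apply/orP; left; apply/eqP.
rewrite [RHS]pair_big /=; under [RHS]eq_bigr => kl _.
  rewrite mulr_sumr; under eq_bigr do rewrite mulr_sumr.
  over.
rewrite [RHS]exchange_big /=; apply: eq_bigr => s _.
rewrite [RHS]exchange_big /=; apply: eq_bigr => t _.
rewrite pair_big mulr_sumr; apply: eq_bigr => -[k l] _ /=.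
by rewrite xpair_eqE; case: (_ && _); rewrite ?mulr0n ?mulr1n ?mulr0 //; ring.
Qed.

End Cells.
Arguments level_mass {d R n} k nu c.
Arguments level_mass2 {d R n} k l m ab.

(** * Lifting charges to pairs of points *)

Section Lifts.
Context {R : realFieldType} {d : nat}.

(** [x + y = z] for the integer points that [x], [y], [z] stand for, the
    coordinates of each being shifted by [2 ^ n.-1]. *)
Definition adds_to n (s : leaf d n * leaf d n) (z : leaf d n) : bool :=
  [forall i, s.1 i + s.2 i == z i + 2 ^ n.-1]%N.

Lemma adds_to_near n k (s : leaf d n * leaf d n) z : (0 < n)%N -> (k <= n)%N ->
  adds_to s z -> near (anc k s.1) (anc k s.2) (anc k z).
Proof.
move=> n0 kn /forallP h; apply/forallP => i; have /eqP := h i.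
rewrite !ancE //; set E := (2 ^ (n - k))%N.
have E0 : (0 < E)%N by rewrite expn_gt0.
have hE : (2 * 2 ^ n.-1 = E * 2 ^ k)%N by rewrite /E -expnD subnK // -expnS prednK.
have := ltn_pmod (s.1 i) E0; have := ltn_pmod (s.2 i) E0; have := ltn_pmod (z i) E0.
rewrite {2}(divn_eq (s.1 i) E) {2}(divn_eq (s.2 i) E) {2}(divn_eq (z i) E).
move: (s.1 i %/ E)%N (s.1 i %% E)%N (s.2 i %/ E)%N (s.2 i %% E)%N (z i %/ E)%N (z i %% E)%N.
move: (2 ^ n.-1)%N (2 ^ k)%N hE E0 => H K; move: E => {h n0 kn z s} E hE E0.
move=> a ra b rb c rc lc lb la e.
by apply/andP; split; rewrite -(leq_pmul2l E0); nia.
Qed.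

Lemma adds_to_inj n (s t : leaf d n * leaf d n) z :
  adds_to s z -> adds_to t z -> s.2 = t.2 -> s = t.
Proof.
case: s t => [x y] [x' y'] /forallP h /forallP h' /= e; rewrite e in h *.
congr pair; apply: leafP => i; move: (h i) (h' i) => /= /eqP a /eqP b.
by apply/eqP; rewrite -(eqn_add2r (y' i)) a b.
Qed.

Section LiftSum.
Context {n : nat} (n0 : (0 < n)%N).
Let D : R := 2 ^+ d.
Implicit Types nu : leaf d n -> R.

Let D0 : 0 < D. Proof. by rewrite exprn_gt0. Qed.

(** The law of [(x, z - x)] with [z] of law [nu] and [x] uniform, without the
    pairs that leave the box. *)
Definition lift_sum nu (s : leaf d n * leaf d n) : R :=
  \sum_(z | adds_to s z) nu z / D ^+ n.

Lemma lift_sum_ge0 nu s : (forall z, 0 <= nu z) -> 0 <= lift_sum nu s.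
Proof. by move=> nu0; apply: sumr_ge0 => z _; rewrite divr_ge0 // exprn_ge0 ?ltW. Qed.

Lemma lift_sum_supp nu s : lift_sum nu s != 0 ->
  exists2 z, nu z != 0 & adds_to s z.
Proof.
move=> h; have [[z /andP[sz nz]]|no] :=
    altP (@existsP _ (fun z => adds_to s z && (nu z != 0))); first by exists z.
rewrite negb_exists in no; move/forallP: no => no.
rewrite /lift_sum big1 ?eqxx // in h => z sz.
by have := no z; rewrite sz /= negbK => /eqP ->; rewrite mul0r.
Qed.

(** In each coordinate at least half of the admissible values of [x] leave
    [z - x] admissible. *)
Lemma card_adds_to z : (((2 ^ d) ^ n.-1) <= #|[pred s | @adds_to n s z]|)%N.
Proof.
set h := (2 ^ n.-1)%N.
have h0 : (0 < h)%N by rewrite expn_gt0.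
have hn : (2 ^ n = h + h)%N by rewrite -[in LHS](prednK n0) expnS mul2n addnn.
have zlt i : (z i < h + h)%N by rewrite -hn.
have lt1 (w : 'I_h) i : (w + (if z i < h then 0 else h) < 2 ^ n)%N.
  apply: leq_trans (eq_leq (esym hn)).
  by have := ltn_ord w; case: ifP; lia.
have lt2 (w : 'I_h) i : (z i + h - (w + (if z i < h then 0 else h)) < 2 ^ n)%N.
  apply: leq_trans (eq_leq (esym hn)).
  by have := ltn_ord w; have := zlt i; case: ifP; lia.
pose f (w : {ffun 'I_d -> 'I_h}) : leaf d n * leaf d n :=
  ([ffun i => Ordinal (lt1 (w i) i)], [ffun i => Ordinal (lt2 (w i) i)]).
have finj : injective f.
  move=> w w' [/ffunP e _]; apply/ffunP => i; apply: val_inj.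
  have := e i; rewrite !ffunE => /(congr1 val) /=.
  by move/eqP; rewrite eqn_add2r => /eqP.
rewrite -(card_leaf (d := d) n.-1) -(card_imset predT finj).
apply/subset_leq_card/fintype.subsetP => _ /imsetP[w _ ->]; rewrite inE.
apply/forallP => i; rewrite -/h /= !ffunE /=; apply/eqP.
have := ltn_ord (w i); have := zlt i.
by move: (nat_of_ord (w i)) (nat_of_ord (z i)) => a b; case: ifP; clearbody h; lia.
Qed.

Lemma sum_lift_sum nu : (forall z, 0 <= nu z) ->
  D^-1 * \sum_z nu z <= \sum_s lift_sum nu s.
Proof.
move=> nu0; rewrite /lift_sum (exchange_big_dep predT) //= mulr_sumr.
apply: ler_sum => z _; rewrite sumr_const -[leRHS]mulr_natl [leRHS]mulrCA [leLHS]mulrC.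
rewrite ler_wpM2l // ler_pdivlMr ?exprn_gt0 //.
rewrite -[X in D ^+ X](prednK n0) exprS mulKf ?gt_eqF //.
by rewrite /D -!natrX ler_nat card_adds_to.
Qed.

(** Once [z] is fixed, [y] determines [x], and [y] ranges over the points of one
    cube of level [l]. *)
Lemma level_lift_sum k l nu (ab : leaf d k * leaf d l) :
  (k <= l)%N -> (l <= n)%N -> (forall z, 0 <= nu z) ->
  level_mass2 k l (lift_sum nu) ab <=
  \sum_(c | near ab.1 (anc k ab.2) c) D ^- l * level_mass k nu c.
Proof.
move=> kl ln nu0; rewrite /level_mass2 /lift_sum (exchange_big_dep predT) //=.
pose near' (z : leaf d n) := near ab.1 (anc k ab.2) (anc k z).
rewrite (bigID near') /= [X in _ + X]big1 ?addr0; last first.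
  move=> z nz; rewrite big1 // => s /andP[/eqP sab sz]; case/negP: nz.
  by rewrite /near' -sab /= anc_anc //; apply: adds_to_near => //; exact: leq_trans ln.
rewrite [leRHS](_ : _ = \sum_(z | near' z) D ^- l * nu z); last first.
  rewrite [RHS](partition_big (anc k) (fun c => near ab.1 (anc k ab.2) c)) //=.
  apply: eq_bigr => c nc; rewrite /level_mass mulr_sumr; apply: eq_bigl => z.
  by rewrite /near'; case: eqP => [->|]; rewrite ?nc ?andbF.
apply: ler_sum => z _; rewrite sumr_const -[leLHS]mulr_natl [leLHS]mulrCA [leLHS]mulrC.
rewrite ler_wpM2r //.
have DE : D ^- l * D ^+ n = D ^+ (n - l).
  by rewrite -[in LHS](subnK ln) exprD mulrC mulfK // expf_neq0 // gt_eqF.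
rewrite ler_pdivrMr ?exprn_gt0 // DE.
rewrite /D -!natrX ler_nat -expnM mulnC expnM.
apply: leq_trans (card_descendants ab.2 ln).
rewrite -(card_in_image (f := snd)); last first.
  by move=> s t /andP[_ sz] /andP[_ tz]; exact: adds_to_inj sz tz.
apply/subset_leq_card/fintype.subsetP => y /fintype.imageP[s].
by move=> /andP[/eqP sab _] ->; rewrite inE -sab.
Qed.

Lemma level2_lift_sum k l nu : (k <= l)%N -> (l <= n)%N -> (forall z, 0 <= nu z) ->
  \sum_ab level_mass2 k l (lift_sum nu) ab ^+ 2 <=
  36 ^+ d * D ^- l * \sum_c level_mass k nu c ^+ 2.
Proof.
move=> kl ln nu0.
have lm0 c : 0 <= D ^- l * level_mass k nu c.
  apply: mulr_ge0; last by apply: sumr_ge0.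
  by rewrite invr_ge0 exprn_ge0 // ltW.
have := @cover_sum_sqr R (leaf d k) (leaf d k * leaf d l)%type
  (fun c ab => near ab.1 (anc k ab.2) c) (6 ^+ d) (6 ^+ d * D ^+ l) _ _ lm0.
move=> /(_ (level_mass2 k l (lift_sum nu))) H.
apply: (le_trans (H _ _ _ _ _)).
- by move=> ab; apply: sumr_ge0 => s _; exact: lift_sum_ge0.
- by move=> ab; exact: level_lift_sum.
- by move=> ab; rewrite -natrX ler_nat card_near_target.
- move=> c; rewrite /D -!natrX -natrM ler_nat -sum1_card.
  rewrite (eq_bigl (fun ab : leaf d k * leaf d l => predT ab.1 && near ab.1 (anc k ab.2) c)) //.
  rewrite -(pair_big_dep predT (fun a b => near a (anc k b) c) (fun _ _ => 1%N)) /=.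
  rewrite (exchange_big_dep predT) //= -card_leaf mulnC -sum_nat_const.
  apply: leq_sum => b _; rewrite sum1_card; exact: card_near_left.
- by rewrite exprn_ge0.
under eq_bigr do rewrite exprMn.
rewrite -mulr_sumr (_ : (36 : R) ^+ d = 6 ^+ d * 6 ^+ d); last first.
  by rewrite -exprMn; congr (_ ^+ _); ring.
have : D ^+ l != 0 by rewrite expf_neq0 // gt_eqF.
move: (D ^+ l) (\sum_c _) => x S x0.
by rewrite le_eqVlt; apply/orP; left; apply/eqP; field.
Qed.

Lemma level_lift_sumC k l nu :
  \sum_ab level_mass2 k l (lift_sum nu) ab ^+ 2 =
  \sum_ab level_mass2 l k (lift_sum nu) ab ^+ 2.
Proof.
pose sw (A B : Type) (u : A * B) := (u.2, u.1).
have swK A B : cancel (@sw A B) (@sw B A) by case.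
have swB A B : bijective (@sw A B) by exists (@sw B A); apply: swK.
rewrite (reindex (@sw (leaf d l) (leaf d k))) /=; last exact/onW_bij/swB.
apply: eq_bigr => -[a b] _; congr (_ ^+ 2).
rewrite /level_mass2 (reindex (@sw (leaf d n) (leaf d n))) /=; last exact/onW_bij/swB.
apply: eq_big => [[x y]|[x y] _] /=; first by rewrite !xpair_eqE andbC.
by apply: eq_bigl => z; apply: eq_forallb => i /=; rewrite addnC.
Qed.

(** The terms with [k <= l] decay geometrically in [l] because [q * 2 ^ d > 1],
    and what remains is the energy at level [k]; the terms with [l <= k] are
    symmetric. *)
Lemma lift_sum_energy p q nu : 0 < p -> 0 < q -> 1 < p * D -> 1 < q * D ->
  (forall z, 0 <= nu z) ->
  pair_energy p q (lift_sum nu) <=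
  36 ^+ d * ((1 - (p * D)^-1)^-1 + (1 - (q * D)^-1)^-1) * dyadic_energy (p * q * D) nu.
Proof.
move=> p0 q0 pD qD nu0.
apply: le_trans (pair_energy_le_levels p0 q0 (fun s => lift_sum_ge0 s nu0)) _.
set W := fun k l => \sum_ab level_mass2 k l (lift_sum nu) ab ^+ 2.
pose e k := \sum_c level_mass k nu c ^+ 2.
have W0 k l : 0 <= W k l by apply: sumr_ge0 => ab _; exact: sqr_ge0.
have e0 k : 0 <= e k by apply: sumr_ge0 => c _; exact: sqr_ge0.
have half (u v : R) : 0 < u -> 0 < v -> 1 < v * D ->
    \sum_(k < n.+1) \sum_(l < n.+1 | (k <= l)%N) u^-1 ^+ k * v^-1 ^+ l * W k l <=
    36 ^+ d * (1 - (v * D)^-1)^-1 * dyadic_energy (u * v * D) nu.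
  move=> u0 v0 vD; rewrite /dyadic_energy mulr_sumr; apply: ler_sum => k _.
  have x01 : 0 <= (v * D)^-1 < 1.
    by rewrite invr_ge0 ltW ?(lt_trans _ vD) //= invf_lt1 // (lt_trans _ vD).
  apply: (@le_trans _ _ (u^-1 ^+ k * 36 ^+ d * e k *
      \sum_(l < n.+1 | (k <= l)%N) (v * D)^-1 ^+ l)).
    rewrite mulr_sumr; apply: ler_sum => l kl.
    have wkl : W k l <= 36 ^+ d * D ^- l * e k.
      by apply: level2_lift_sum => //; rewrite -ltnS ltn_ord.
    apply: le_trans (ler_wpM2l _ wkl) _.
      by rewrite mulr_ge0 // exprn_ge0 // invr_ge0 ltW.
    by rewrite invfM exprMn -[D ^- l]exprVn le_eqVlt; apply/orP; left; apply/eqP; ring.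
  apply: le_trans (ler_wpM2l _ (geometric_tail _ _ x01)) _.
    by rewrite !mulr_ge0 // exprn_ge0 // invr_ge0 ltW.
  rewrite -/(e k).
  rewrite (_ : ((u * v * D)^-1) = u^-1 * (v * D)^-1); last by rewrite -mulrA invfM.
  by rewrite exprMn le_eqVlt; apply/orP; left; apply/eqP; ring.
have h1 := half p q p0 q0 qD; have h2 := half q p q0 p0 pD.
rewrite [q * p]mulrC in h2.
apply: (@le_trans _ _ (\sum_(k < n.+1) \sum_(l < n.+1 | (k <= l)%N) p^-1 ^+ k * q^-1 ^+ l * W k l
  + \sum_(k < n.+1) \sum_(l < n.+1 | (k <= l)%N) q^-1 ^+ k * p^-1 ^+ l * W k l)).
  rewrite [X in _ <= _ + X](exchange_big_dep predT) //= -big_split /=.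
  apply: ler_sum => k _; rewrite ![X in _ <= X + _]big_mkcond ![X in _ <= _ + X]big_mkcond -big_split /=.
  apply: ler_sum => l _.
  have t0 : 0 <= p^-1 ^+ k * q^-1 ^+ l * W k l.
    by apply: mulr_ge0 (W0 _ _); apply: mulr_ge0; rewrite exprn_ge0 // invr_ge0 ltW.
  rewrite -/(W k l) [W l k]level_lift_sumC -/(W k l) [q^-1 ^+ l * _]mulrC.
  by case: (leqP k l) => [kl|/ltnW ->]; [case: ifP|]; lra.
apply: le_trans (lerD h1 h2) _.
by rewrite -mulrDl -mulrDr addrC.
Qed.

End LiftSum.

Section LiftPoint.

(** The origin of the integer lattice, in coordinates counted from the corner. *)
Definition center n : leaf d n :=
  [ffun=> Ordinal (ltn_pmod (2 ^ n.-1) (expn2_gt0 n))].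

Lemma centerE n i : (0 < n)%N -> center n i = (2 ^ n.-1)%N :> nat.
Proof. by move=> n0; rewrite ffunE /= modn_small // ltn_exp2l // prednK. Qed.

Lemma anc_center n k : (k <= n)%N -> anc k (center n) = center k.
Proof.
case: k => [|k] kn; first exact: leaf0_eq.
apply: leafP => i; rewrite ancE // !centerE // ?(leq_trans _ kn) //.
case: n kn => // n kn /=; rewrite subSS -{1}(subnK (_ : k <= n)%N) //.
by rewrite expnD mulKn // expn_gt0.
Qed.

Context {n : nat}.
Implicit Types nu : leaf d n -> R.

Definition lift_point nu (s : leaf d n * leaf d n) : R :=
  if s.2 == center n then nu s.1 else 0.

Lemma sum_lift_point nu (Q : pred (leaf d n)) :
  \sum_(s | Q s.1) lift_point nu s = \sum_(z | Q z) nu z.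
Proof.
rewrite (eq_bigl (fun s : leaf d n * leaf d n => Q s.1 && predT s.2)); last by move=> s; rewrite andbT.
rewrite -(pair_big Q predT (fun x y => lift_point nu (x, y))) /=.
apply: eq_bigr => x _; rewrite (bigD1 (center n)) //= big1 ?addr0 /lift_point ?eqxx //.
by move=> y /negbTE /= ->.
Qed.

Lemma lift_point_energy p nu : 0 < p -> (forall z, 0 <= nu z) ->
  pair_energy p 1 (lift_point nu) <= dyadic_energy p nu.
Proof.
move=> p0 nu0.
have m0 s : 0 <= lift_point nu s by rewrite /lift_point; case: ifP.
apply: (@le_trans _ _ (\sum_s \sum_t lift_point nu s * lift_point nu t *
   (\sum_(k < n.+1) (p^-1) ^+ k *+ (anc k s.1 == anc k t.1)))).
  apply: ler_sum => s _; apply: ler_sum => t _; rewrite ler_wpM2l ?mulr_ge0 //.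
  rewrite pair_kernelE [X in _ * X]big1 ?mulr1; last by move=> k _; case: ifP; rewrite ?invr1.
  have [K Kn [PK ->]] := anc_chain (R := R) s.1 t.1.
  rewrite (bigD1 (Ordinal (Kn : (K < n.+1)%N))) //= PK // leqnn mulr1n lerDl.
  by apply: sumr_ge0 => k _; rewrite mulrn_wge0 // exprn_ge0 // invr_ge0 ltW.
rewrite le_eqVlt; apply/orP; left; apply/eqP; rewrite /dyadic_energy.
under [RHS]eq_bigr => k _.
  under eq_bigr do rewrite /level_mass -(sum_lift_point nu (fun z => anc k z == _)).
  rewrite -(sum_same_class (fun s : leaf d n * leaf d n => anc k s.1)) mulr_sumr.
  under eq_bigr do rewrite mulr_sumr.
  over.
rewrite [RHS]exchange_big; apply: eq_bigr => s _ /=.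
rewrite [RHS]exchange_big; apply: eq_bigr => t _ /=.
rewrite mulr_sumr; apply: eq_bigr => k _.
by case: (_ == _); rewrite ?mulr0n ?mulr1n ?mulr0 // mulrC.
Qed.

End LiftPoint.
End Lifts.

(** * Percolation as marks on the dyadic tree *)

Section Alive.
Context {disp : measure_display} {T : measurableType disp} {R : realType}
  {P : probability T R} {d : nat}.

(** The corner, in units of [2 ^- k.+1], of the cube of level [k.+1] with
    coordinates [a] counted from the corner of the unit box. *)
Definition vertex k (a : 'I_d -> nat) : 'rV[int]_d :=
  \row_i ((a i)%:Z - 2 ^+ k).

Lemma vertex_inj k (a b : 'I_d -> nat) : vertex k a = vertex k b -> a =1 b.
Proof.
by move=> /rowP e i; have := e i; rewrite !mxE => /addIr [].
Qed.

Definition alive {p} (X : percolation P d p) k (a : leaf d k) : set T :=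
  [set w | forall j, (j < k)%N -> keep X (j.+1, vertex j (fun i => anc j.+1 a i)) w].

Lemma alive_anc p (X : percolation P d p) k j (a : leaf d k) : (j <= k)%N ->
  alive X a `<=` alive X (anc j a).
Proof.
move=> jk w aw l lj; rewrite /= (@anc_anc _ _ _ _ a) //.
by apply: aw; rewrite (leq_trans lj).
Qed.

Lemma measurable_alive p (X : percolation P d p) k (a : leaf d k) :
  measurable (alive X a).
Proof.
rewrite (_ : alive X a = \bigcap_(j in [set j | (j < k)%N])
   keep X (j.+1, vertex j (fun i => anc j.+1 a i))) //.
by apply: bigcap_measurableType => // j _; exact: keep_measurable.
Qed.

Section Pair.
Context {p q : R} (X : percolation P d p) (Y : percolation P d q).
Hypothesis indXY : independent_families P (keep X) (keep Y).
Hypothesis p01 : 0 < p <= 1.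
Hypothesis q01 : 0 < q <= 1.

Definition alive2 n (s : leaf d n * leaf d n) : set T := alive X s.1 `&` alive Y s.2.

Lemma measurable_alive2 n s : measurable (@alive2 n s).
Proof. by apply: measurableI; apply: measurable_alive. Qed.

Section Level.
Context {n : nat}.

Definition kept_left (ka : 'I_n * leaf d n) : set T :=
  keep X (ka.1.+1, vertex ka.1 (fun i => ka.2 i)).
Definition kept_right (ka : 'I_n * leaf d n) : set T :=
  keep Y (ka.1.+1, vertex ka.1 (fun i => ka.2 i)).
Definition kept_mark (i : mark d n) : set T :=
  match i with inl ka => kept_left ka | inr ka => kept_right ka end.

Lemma pr_bigcap_keep r (Z : percolation P d r) (s : seq ('I_n * leaf d n)) : uniq s ->
  pr P (\bigcap_(ka in [set` s]) keep Z (ka.1.+1, vertex ka.1 (fun i => ka.2 i))) =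
  \prod_(ka <- s) r.
Proof.
move=> us; pose f (ka : 'I_n * leaf d n) := (ka.1.+1, vertex ka.1 (fun i => ka.2 i)).
have finj : injective f.
  case=> k a [l b]; rewrite /f /= => -[kl].
  have {}kl : k = l by exact: val_inj.
  by rewrite -kl => /vertex_inj ab; congr pair; apply: leafP.
have := keep_independent Z (s := map f s); rewrite map_inj_uniq // => /(_ us).
rewrite big_map (eq_bigr (fun=> r%:E)); last by move=> ka _; exact: keep_prob.
rewrite prodEFin => h; apply: EFin_inj; rewrite -h -prE; last first.
  by rewrite bigcap_seq; apply: bigsetI_measurable => ka _; exact: keep_measurable.
congr (P _); apply/seteqP; split=> w h' c /=.
  by move=> /mapP[ka kas ->]; apply: h'.
by move=> cs; apply: (h' (f c)); apply/mapP; exists c.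
Qed.

Lemma measurable_kept_left ka : measurable (kept_left ka).
Proof. exact: keep_measurable. Qed.
Lemma measurable_kept_right ka : measurable (kept_right ka).
Proof. exact: keep_measurable. Qed.
Lemma measurable_kept_mark i : measurable (kept_mark i).
Proof. by case: i => ka; exact: keep_measurable. Qed.

(** Events of a finite configuration belong to the sigma-algebra on which
    independence of the two percolations is assumed. *)
Lemma config_generated (I : finType) (J : Type) (F : J -> set T) (u : I -> J) c :
  <<s range F >> [set w | config (F \o u) w = c].
Proof.
have := @measurable_config _ (g_sigma_algebraType (range F)) I (F \o u).
by apply=> i; apply: sub_sigma_algebra; exists (u i).
Qed.

Lemma pr_kept_config c :
  pr P [set w | config kept_mark w = c] = weight (mark_prob p q) c.
Proof.
pose cl : {ffun 'I_n * leaf d n -> bool} := [ffun ka => c (inl ka)].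
pose cr : {ffun 'I_n * leaf d n -> bool} := [ffun ka => c (inr ka)].
have -> : [set w | config kept_mark w = c] =
    [set w | config kept_left w = cl] `&` [set w | config kept_right w = cr].
  apply/seteqP; split=> w /=.
    by move=> wc; split; apply/ffunP => ka; rewrite !ffunE -wc ffunE.
  move=> [/ffunP hl /ffunP hr]; apply/ffunP => -[] ka.
    by have := hl ka; rewrite !ffunE.
  by have := hr ka; rewrite !ffunE.
pose f (ka : 'I_n * leaf d n) := (ka.1.+1, vertex ka.1 (fun i => ka.2 i)).
have := indXY (@config_generated _ _ (keep X) f cl) (@config_generated _ _ (keep Y) f cr).
rewrite -/kept_left -/kept_right => h.
have ml := measurable_config measurable_kept_left cl.
have mr := measurable_config measurable_kept_right cr.
have : pr P ([set w | config kept_left w = cl] `&` [set w | config kept_right w = cr]) =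
  pr P [set w | config kept_left w = cl] * pr P [set w | config kept_right w = cr].
  apply: EFin_inj; rewrite EFinM -!prE //; exact: measurableI.
move=> ->; rewrite (pr_config cl measurable_kept_left (@pr_bigcap_keep _ X)).
rewrite (pr_config cr measurable_kept_right (@pr_bigcap_keep _ Y)).
rewrite /weight big_sumType /=.
by congr (_ * _); apply: eq_bigr => ka _; rewrite ffunE.
Qed.

Lemma mark_prob01 (i : mark d n) : 0 < mark_prob p q i <= 1.
Proof. by case: i. Qed.

Lemma survivesE s w :
  survives left_path right_path s (config kept_mark w) <-> alive2 s w.
Proof.
have cE (x : leaf d n) (k : nat) : (k < n)%N ->
    vertex k (fun i => coarse k.+1 x i) = vertex k (fun i => anc k.+1 x i).
  by move=> kn; apply/rowP => i; rewrite !mxE ancE // ffunE.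
split=> [/forall_inP h|[hX hY]].
  split=> k kn.
    have := h (inl (Ordinal kn, coarse k.+1 s.1)); rewrite !inE eqxx => /(_ isT).
    by rewrite ffunE => /asboolP; rewrite /kept_mark /kept_left /= cE.
  have := h (inr (Ordinal kn, coarse k.+1 s.2)); rewrite !inE eqxx => /(_ isT).
  by rewrite ffunE => /asboolP; rewrite /kept_mark /kept_right /= cE.
apply/forall_inP => -[] [k a]; rewrite !inE ?orbF /= => /eqP ->;
  rewrite ffunE; apply/asboolP.
  rewrite /kept_mark /kept_left /= cE; last exact: ltn_ord.
  exact: hX.
rewrite /kept_mark /kept_right /= cE; last exact: ltn_ord.
exact: hY.
Qed.

(** Dividing by the law of the marks turns disjoint events into weights of total
    at most one on every configuration. *)
Lemma pair_energy_le (H : leaf d n * leaf d n -> set T) :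
  (forall s, measurable (H s)) -> (forall s t w, H s w -> H t w -> s = t) ->
  (forall s, H s `<=` alive2 s) ->
  pair_energy p q (fun s => pr P (H s)) <= 256 * \sum_s pr P (H s).
Proof.
move=> mH tH aH; pose W := weight (@mark_prob d R n p q).
pose C c := [set w | config kept_mark w = c].
have mC c : measurable (C c) by apply: measurable_config; exact: measurable_kept_mark.
have mHC s c : measurable (H s `&` C c) by apply: measurableI.
have W0 c : 0 <= W c.
  by apply: weight_ge0 => i; case/andP: (mark_prob01 i) => h1 h2; rewrite ltW.
have WE c : W c = pr P (C c) by rewrite /W -pr_kept_config.
pose h s c := pr P (H s `&` C c) / W c.
have hW s c : W c * h s c = pr P (H s `&` C c).
  have [W00|Wn0] := eqVneq (W c) 0; last by rewrite /h mulrC divfK.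
  rewrite W00 mul0r; apply/eqP; rewrite eq_le pr_ge0 /=.
  by rewrite -W00 WE; apply: pr_le.
have hE s : expect (mark_prob p q) (h s) = pr P (H s).
  rewrite -(pr_config_partition P measurable_kept_mark (mH s)).
  by apply: eq_bigr => c _; exact: hW.
have := @energy_le_mass _ _ _ _ _ mark_prob01 _ _ _ (@left_path_sub d n)
  (@right_path_sub d n) (@rank d n) (@rank d n) h (@left_path_convex d n)
  (@right_path_convex d n).
rewrite /tree_energy /= -/(pair_kernel _ _).
under eq_bigr do under eq_bigr do rewrite !hE.
under [X in _ <= _ * X]eq_bigr do rewrite hE.
apply.
- by move=> s c; rewrite /h divr_ge0 ?pr_ge0.
- move=> c; rewrite -mulr_suml.
  have [W00|Wn0] := eqVneq (W c) 0; first by rewrite W00 invr0 mulr0.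
  rewrite ler_pdivrMr ?lt_neqAle 1?eq_sym ?Wn0 ?W0 // mul1r WE.
  rewrite -(@pr_sum _ _ _ P _ xpredT) //.
    apply: pr_le => //; first exact: measurable_finset.
    by move=> w [s _ []].
  by move=> s t w [Hs _] [Ht _]; exact: tH Hs Ht.
- move=> s c; rewrite /h mulf_eq0 negb_or => /andP[hn0 _].
  have [w [Hw <-]] : exists w, (H s `&` C c) w.
    apply/not_existsP => no; move/eqP: hn0; apply.
    by rewrite (_ : _ `&` _ = set0) ?/pr ?measure0 // -subset0 => w /no.
  by apply/survivesE/aH.
Qed.

Lemma pair_second_moment (m : leaf d n * leaf d n -> R) (A : set T) :
  measurable A -> (forall s, 0 <= m s) ->
  (forall s, m s != 0 -> alive2 s `<=` A) ->
  (\sum_s m s) ^+ 2 <= pair_energy p q m * pr P A.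
Proof.
move=> mA m0 mAs.
have := @second_moment _ _ _ _ _ mark_prob01 (@left_path d n) (@right_path d n) m m0.
move=> /le_trans; apply; rewrite -[tree_energy _ _ _ _]/(pair_energy p q m).
have W0 c : 0 <= weight (@mark_prob d R n p q) c.
  by apply: weight_ge0 => i; case/andP: (mark_prob01 i) => h1 h2; rewrite ltW.
apply: ler_wpM2l.
  apply: sumr_ge0 => s _; apply: sumr_ge0 => t _; rewrite !mulr_ge0 //.
  exact: (tree_kernel_ge0 mark_prob01).
rewrite -(pr_config_partition P measurable_kept_mark mA).
apply: ler_sum => c _; rewrite -pr_kept_config.
case: existsP => [[s /andP[ms ss]]|_]; last by rewrite mulr0 pr_ge0.
rewrite mulr1; apply: pr_le.
- by apply: measurable_config; exact: measurable_kept_mark.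
- by apply: measurableI => //; apply: measurable_config; exact: measurable_kept_mark.
- move=> w /= wc; split=> //; apply: (mAs _ ms); apply/survivesE; by rewrite wc.
Qed.

End Level.
End Pair.
End Alive.

(** * A measurable form of Koenig's lemma *)

Section MeasurableKoenig.
Context {disp : measure_display} {T : measurableType disp}
  (V : nat -> finType) (par : forall k, V k.+1 -> V k) (v0 : forall k, V k)
  (D : forall k, V k -> set T).
Hypothesis mD : forall k v, measurable (@D k v).
Hypothesis D_par : forall k v, @D k.+1 v `<=` D (par v).

Definition infinite_branch : set T := [set w | forall k, exists v, @D k v w].

(** Survival of [v] for [m] generations, by recursion on [m] so that only finite
    unions of events occur; the intersection over [m] is countable. *)
Fixpoint reach m : forall k, V k -> set T :=
  if m is m'.+1 then
    fun k v => [set w | exists2 c, par c == v & reach m' c w]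
  else D.

Definition extendable k (v : V k) : set T := \bigcap_m reach m v.

(** The first surviving child is taken at every step: the choice depends on
    finitely many events, so it is measurable. *)
Fixpoint branch k (w : T) : V k :=
  match k with
  | 0%N => odflt (v0 0) [pick v | config (@extendable 0) w v]
  | k'.+1 => odflt (v0 k'.+1)
      [pick c | (par c == branch k' w) && config (@extendable k'.+1) w c]
  end.

Lemma measurable_reach m k (v : V k) : measurable (reach m v).
Proof.
elim: m k v => [|m IH] k v /=; first exact: mD.
exact: (measurable_finset (fun c => par c == v)).
Qed.

Lemma measurable_extendable k (v : V k) : measurable (extendable v).
Proof. by apply: bigcapT_measurable => m; exact: measurable_reach. Qed.

Lemma measurable_infinite_branch : measurable infinite_branch.
Proof.
rewrite (_ : infinite_branch = \bigcap_k [set w | exists2 v, predT v & @D k v w]).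
  by apply: bigcapT_measurable => k; exact: measurable_finset.
apply/seteqP; split=> w h k; first by move=> _; have [v] := h k; exists v.
by have [v _] := h k I; exists v.
Qed.

Lemma reachS m k (v : V k) : reach m.+1 v `<=` reach m v.
Proof.
elim: m k v => [|m IH] k v w /=; first by case=> c /eqP <- /D_par.
by case=> c pc [c' pc' h]; exists c => //; apply: IH; exists c'.
Qed.

Lemma reach_le m m' k (v : V k) : (m <= m')%N -> reach m' v `<=` reach m v.
Proof.
move=> /subnK <-; elim: (m' - m)%N => // j IH w h.
by apply: IH; rewrite addSn in h; exact: reachS h.
Qed.

(** Otherwise every member has failed by the largest of the failure times. *)
Lemma uniform_witness (J : finType) (Q : pred J) (A : nat -> J -> Prop) :
  (forall m m' j, (m <= m')%N -> A m' j -> A m j) ->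
  (forall m, exists2 j, Q j & A m j) -> exists2 j, Q j & forall m, A m j.
Proof.
move=> Adec h; apply: contrapT => no.
have fail j : exists m, Q j -> ~ A m j.
  apply: contrapT => /forallNP nf; apply: no; exists j.
    by apply: contrapT => nQ; apply: (nf 0%N) => /nQ.
  by move=> m; apply: contrapT => nA; apply: (nf m) => _.
have [f hf] := choice fail.
have [j Qj] := h (\max_j f j); apply: contraPP => _.
by move=> hA; apply: (hf j Qj); apply: Adec hA; exact: leq_bigmax.
Qed.

Lemma extendable_child k (v : V k) w : extendable v w ->
  exists2 c, par c == v & extendable c w.
Proof.
move=> ev; have [|m|c pc h] := @uniform_witness _ (fun c => par c == v) (fun m c => reach m c w).
- by move=> m m' c mm'; exact: reach_le.
- by have /= := ev m.+1 I.
- by exists c => // m _; exact: h.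
Qed.

Lemma reach_root k j (u : V k) w : reach j u w -> exists v : V 0, reach (k + j) v w.
Proof.
elim: k j u => [|k IH] j u h; first by exists u.
rewrite addSnnS; apply: (IH _ (par u)); exists u => //; exact: eqxx.
Qed.

Lemma extendable_root w : infinite_branch w -> exists v : V 0, extendable v w.
Proof.
move=> hw; have [|m|v _ h] := @uniform_witness _ predT (fun m (v : V 0) => reach m v w).
- by move=> m m' c mm'; exact: reach_le.
- have [u Du] := hw m; have [v] := @reach_root m 0 u w Du.
  by rewrite addn0; exists v.
- by exists v => m _; exact: h.
Qed.

Lemma branch_extendable k w : infinite_branch w -> extendable (branch k w) w.
Proof.
move=> hw; elim: k => [|k IH] /=.
  case: pickP => [v|no]; first by rewrite ffunE => /asboolP.
  by have [v ev] := extendable_root hw; have := no v; rewrite ffunE asboolT.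
case: pickP => [v /andP[_]|no]; first by rewrite ffunE => /asboolP.
have [c pc ec] := extendable_child IH; have := no c.
by rewrite pc ffunE asboolT.
Qed.

Lemma branch_in k w : infinite_branch w -> D (branch k w) w.
Proof. by move=> hw; exact: (branch_extendable k hw) 0%N I. Qed.

Lemma par_branch k w : infinite_branch w -> par (branch k.+1 w) = branch k w.
Proof.
move=> hw /=; case: pickP => [v /andP[/eqP]//|no].
have [c pc ec] := extendable_child (branch_extendable k hw).
by have := no c; rewrite pc ffunE asboolT.
Qed.

Lemma measurable_branch k v : measurable (infinite_branch `&` [set w | branch k w = v]).
Proof.
elim: k v => [|k IH] v /=.
  apply: measurableI; first exact: measurable_infinite_branch.
  have := measurable_configP (@measurable_extendable 0)
    (fun f => odflt (v0 0) [pick v | f v] == v).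
  by congr measurable; apply/seteqP; split=> w /= /eqP.
rewrite (_ : _ `&` _ = [set w | exists2 u : V k, predT u &
    ((infinite_branch `&` [set w | branch k w = u]) `&`
     [set w | odflt (v0 k.+1) [pick c | (par c == u) &&
        config (@extendable k.+1) w c] == v]) w]).
  apply: measurable_finset => u; apply: measurableI; first exact: IH.
  exact: (measurable_configP (@measurable_extendable k.+1)
    (fun f => odflt (v0 k.+1) [pick c | (par c == u) && f c] == v)).
apply/seteqP; split=> w /=; first by move=> [hw /eqP bv]; exists (branch k w).
by case=> u _ [[hw <-] /eqP].
Qed.

End MeasurableKoenig.

(** * Hitting probabilities at a finite level *)

(** The parameter [B] restricts the second coordinate: it is everything for the
    sum of two percolations, and the origin for a single one.  The growth rate
    [lam] of [B] is what enters the exponent. *)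
Section Model.
Context {disp : measure_display} {T : measurableType disp} {R : realType}
  {P : probability T R} {d : nat} {p q : R}
  (X : percolation P d p) (Y : percolation P d q).
Hypothesis indXY : independent_families P (keep X) (keep Y).
Hypothesis p01 : 0 < p <= 1.
Hypothesis q01 : 0 < q <= 1.
Hypothesis pq1 : p * q < 1.
Context (B : forall k, pred (leaf d k)) (lam : nat).
Hypothesis cardB : forall k, (#|[pred b | @B k b]| <= lam ^ k)%N.
Hypothesis lam0 : (0 < lam)%N.
Hypothesis B_anc : forall n k (b : leaf d n), (k <= n)%N -> B b -> B (anc k b).

Let r : R := p * q * lam%:R.
Let C1 : R := 36 ^+ d * 256 / (1 - p * q).

Let p0 : 0 < p. Proof. by case/andP: p01. Qed.
Let q0 : 0 < q. Proof. by case/andP: q01. Qed.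
Let pq_gt0 : 0 < p * q. Proof. exact: mulr_gt0. Qed.
Let subpq0 : 0 < 1 - p * q. Proof. by rewrite subr_gt0. Qed.

Lemma near_sum_sqr k (mu : leaf d k * leaf d k -> R) (nu : leaf d k -> R) :
  (forall ab, 0 <= mu ab) -> (forall c, 0 <= nu c) ->
  (forall c, nu c <= \sum_(ab | near ab.1 ab.2 c && B ab.2) mu ab) ->
  \sum_c nu c ^+ 2 <= 36 ^+ d * lam%:R ^+ k * \sum_ab mu ab ^+ 2.
Proof.
move=> mu0 nu0 cov.
have := @cover_sum_sqr R (leaf d k * leaf d k)%type (leaf d k)
  (fun ab c => near ab.1 ab.2 c && B ab.2) (6 ^+ d * lam%:R ^+ k) (6 ^+ d) mu nu mu0 nu0 cov.
move=> H; apply: le_trans (H _ _ _) _.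
- by move=> c; rewrite -!natrX -natrM ler_nat; exact: card_near_pair.
- move=> ab; rewrite -natrX ler_nat; apply: leq_trans (card_near_target ab.1 ab.2).
  by apply/subset_leq_card/fintype.subsetP => c; rewrite !inE => /andP[].
- by rewrite mulr_ge0 ?exprn_ge0.
rewrite (_ : (36 : R) ^+ d = 6 ^+ d * 6 ^+ d); last first.
  by rewrite -exprMn; congr (_ ^+ _); ring.
by rewrite le_eqVlt; apply/orP; left; apply/eqP; ring.
Qed.

Lemma level_energy_le n (H : leaf d n * leaf d n -> set T) :
  (forall s, measurable (H s)) -> (forall s t w, H s w -> H t w -> s = t) ->
  (forall s, H s `<=` alive2 X Y s) ->
  \sum_(k < n.+1) ((p * q)^-1) ^+ k *
     \sum_ab level_mass2 k k (fun s => pr P (H s)) ab ^+ 2 <=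
  256 / (1 - p * q) * \sum_s pr P (H s).
Proof.
move=> mH tH aH.
have := pair_energy_le indXY p01 q01 mH tH aH.
move=> /(le_trans (pair_energy_ge p01 q01 pq1 (fun s => pr_ge0 P (H s)))).
by rewrite mulrC -ler_pdivlMr // => /le_trans; apply; rewrite mulrAC.
Qed.

Definition discrete_hit n (A : pred (leaf d n)) : set T :=
  [set w | exists s z, [/\ A z, B s.2, adds_to s z & alive2 X Y s w]].

Lemma measurable_discrete_hit n (A : pred (leaf d n)) :
  measurable (discrete_hit A).
Proof.
rewrite (_ : discrete_hit A = [set w | exists2 s,
   [exists z, [&& A z, B s.2 & adds_to s z]] & alive2 X Y s w]).
  by apply: measurable_finset => s; exact: measurable_alive2.
apply/seteqP; split=> w.
  by move=> [s [z [Az Bs sz hs]]]; exists s => //; apply/existsP; exists z; rewrite Az Bs.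
by move=> [s /existsP[z /and3P[Az Bs sz]] hs]; exists s, z.
Qed.

Lemma adds_to_target_inj n (s : leaf d n * leaf d n) z z' :
  adds_to s z -> adds_to s z' -> z = z'.
Proof.
move=> /forallP h /forallP h'; apply: leafP => i.
by apply/eqP; rewrite -(eqn_add2r (2 ^ n.-1)) -(eqP (h i)) (eqP (h' i)).
Qed.

(** The law of the sum of a surviving pair, chosen first among those that add up
    to a point of [A]. *)
Lemma discrete_hit_charge n (A : pred (leaf d n)) : (0 < n)%N ->
  exists nu : leaf d n -> R, [/\ forall z, 0 <= nu z,
    forall z, nu z != 0 -> A z, \sum_z nu z = pr P (discrete_hit A) &
    dyadic_energy r nu <= C1 * pr P (discrete_hit A)].
Proof.
move=> n0.
pose G (s : leaf d n * leaf d n) := [exists z, [&& A z, B s.2 & adds_to s z]].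
pose first c := [pick s | G s && survives left_path right_path s c].
pose H s := [set w | first (config (kept_mark X Y) w) == Some s].
have mH s : measurable (H s).
  exact: (measurable_configP (@measurable_kept_mark _ _ _ _ _ _ _ X Y n)
    (fun c => first c == Some s)).
have tH s t w : H s w -> H t w -> s = t.
  by rewrite /H /= => /eqP -> /eqP [].
have HG s w : H s w -> G s /\ alive2 X Y s w.
  rewrite /H /= /first; case: pickP => // u /andP[Gu su] /eqP[<-].
  by split=> //; apply/survivesE.
have aH s : H s `<=` alive2 X Y s by move=> w /HG[].
pose m s := pr P (H s).
have m0 s : 0 <= m s by exact: pr_ge0.
have mG s : ~~ G s -> m s = 0.
  move=> nG; rewrite /m (_ : H s = set0) ?/pr ?measure0 //.
  by rewrite -subset0 => w /HG[]; rewrite (negbTE nG).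
have sum_m : \sum_s m s = pr P (discrete_hit A).
  rewrite -(@pr_sum _ _ _ P _ xpredT) //; congr (pr P _).
  apply/seteqP; split=> w.
    by move=> [s _ /HG[/existsP[z /and3P[? ? ?]] ?]]; exists s, z.
  move=> [s [z [Az Bs sz hs]]].
  case E : (first (config (kept_mark X Y) w)) => [t|].
    by exists t => //; rewrite /H /= E.
  move: E; rewrite /first; case: pickP => // no _.
  have /negP[] := no s; apply/andP; split; last exact/survivesE.
  by apply/existsP; exists z; rewrite Az Bs.
exists (fun z => \sum_(s | G s && adds_to s z) m s); split.
- by move=> z; apply: sumr_ge0.
- move=> z; apply: contraNT => nA; rewrite big_pred0 // => s.
  apply/negP => /andP[/existsP[z' /and3P[Az' _ sz']] sz].
  by rewrite (adds_to_target_inj sz sz') Az' in nA.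
- rewrite (exchange_big_dep (fun s => G s)) /=; last by move=> z s _ /andP[].
  rewrite -sum_m [RHS](bigID G) /= [X in _ = _ + X]big1 ?addr0; last by move=> s /mG.
  apply: eq_bigr => s Gs; have /existsP[z /and3P[_ _ sz]] := Gs.
  rewrite (bigD1 z) /= ?Gs ?sz // big1 ?addr0 // => z' /andP[/andP[_ sz']].
  by rewrite (adds_to_target_inj sz' sz) eqxx.
rewrite /dyadic_energy -sum_m.
have := level_energy_le mH tH aH; rewrite -(ler_pM2l (_ : 0 < 36 ^+ d)) ?exprn_gt0 //.
rewrite mulr_sumr mulrA mulrA -/C1 => /(le_trans _); apply.
apply: ler_sum => k _.
have kn : (k <= n)%N by rewrite -ltnS.
have := @near_sum_sqr k (level_mass2 k k m)
  (level_mass k (fun z => \sum_(s | G s && adds_to s z) m s)).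
move=> /(_ _ _ _) h; apply: le_trans (ler_wpM2l _ (h _ _ _)) _.
- by rewrite exprn_ge0 // invr_ge0 /r mulr_ge0 // ltW.
- by move=> ab; apply: sumr_ge0.
- by move=> c; apply: sumr_ge0 => z _; apply: sumr_ge0.
- move=> c; rewrite /level_mass /level_mass2.
  rewrite (exchange_big_dep (fun s => G s && near (anc k s.1) (anc k s.2) c)) /=; last first.
    move=> z s /eqP <- /andP[-> sz]; exact: adds_to_near.
  rewrite [leRHS](_ : _ = \sum_(s | near (anc k s.1) (anc k s.2) c && B (anc k s.2)) m s); last first.
    rewrite [RHS](partition_big (fun s : leaf d n * leaf d n => (anc k s.1, anc k s.2))
      (fun ab => near ab.1 ab.2 c && B ab.2)) //=.
    apply: eq_bigr => -[a b] /= nab; apply: eq_bigl => s.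
    by rewrite xpair_eqE; case: andP => [[/eqP -> /eqP ->]|]; rewrite ?nab ?andbF.
  rewrite [leLHS]big_mkcond [leRHS]big_mkcond; apply: ler_sum => s _ /=.
  case: ifP => [/andP[Gs ns]|_]; last by case: ifP.
  have /existsP[z /and3P[Az Bs sz]] := Gs.
  rewrite ns (B_anc kn Bs) /= [leLHS](_ : _ = \sum_(z' | z' == z) (if anc k z == c then m s else 0)).
    by rewrite big_pred1_eq; case: ifP.
  rewrite [RHS]big_mkcond [LHS]big_mkcond; apply: eq_bigr => z' _.
  rewrite Gs /=; have [->|ne] := eqVneq z' z; first by rewrite sz andbT.
  rewrite andbC; case: (boolP (adds_to s z')) => //= sz'.
  by rewrite (adds_to_target_inj sz' sz) eqxx in ne.
rewrite /r invfM exprMn le_eqVlt; apply/orP; left; apply/eqP.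
have : lam%:R ^+ k != 0 :> R by rewrite expf_neq0 // pnatr_eq0 -lt0n.
rewrite -[X in _ = _ * (X * _)]/((p * q)^-1 ^+ k).
move: (\sum_ab _) ((p * q)^-1 ^+ k) => S x; rewrite exprVn.
by move: (lam%:R ^+ k) (36 ^+ d) => y c y0; field.
Qed.

Lemma discrete_hit_ge n (A : pred (leaf d n)) (c0 C0 : R) (nu : leaf d n -> R)
    (m : leaf d n * leaf d n -> R) : 0 <= c0 ->
  (forall z, 0 <= nu z) -> (forall z, nu z != 0 -> A z) ->
  (forall s, 0 <= m s) ->
  (forall s, m s != 0 -> B s.2 /\ exists2 z, nu z != 0 & adds_to s z) ->
  c0 * \sum_z nu z <= \sum_s m s ->
  pair_energy p q m <= C0 * dyadic_energy r nu ->
  (c0 * \sum_z nu z) ^+ 2 <= C0 * dyadic_energy r nu * pr P (discrete_hit A).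
Proof.
move=> c00 nu0 nuA m0 mB mass en.
apply: (@le_trans _ _ ((\sum_s m s) ^+ 2)).
  by rewrite lerXn2r // nnegrE ?mulr_ge0 ?sumr_ge0.
have mA : measurable (discrete_hit A) by exact: measurable_discrete_hit.
apply: le_trans (pair_second_moment indXY p01 q01 mA m0 _) _.
  move=> s /mB[Bs [z nz sz]] w hs; exists s, z; split=> //; exact: nuA.
by apply: ler_wpM2r => //; exact: pr_ge0.
Qed.

End Model.

(** * The cubes of a percolation *)

Section Cubes.
Context {R : realType} {d : nat}.

(** Cubes of the dyadic subdivision of the unit box, their coordinates being
    counted from its corner. *)
Definition cell k (a : leaf d k) : set 'rV[R]_d :=
  [set x | forall i, (a i)%:R / 2 ^+ k - 2^-1 <= x ord0 i < (a i).+1%:R / 2 ^+ k - 2^-1].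

Definition closed_cell k (a : leaf d k) : set 'rV[R]_d :=
  [set x | forall i, (a i)%:R / 2 ^+ k - 2^-1 <= x ord0 i <= (a i).+1%:R / 2 ^+ k - 2^-1].

Let pow_gt0 k : 0 < 2 ^+ k :> R. Proof. by rewrite exprn_gt0. Qed.

Lemma cell_vertex k (a : leaf d k.+1) :
  dyadic_cube k.+1 (vertex k (fun i => a i)) = cell a.
Proof.
have E (u : nat) : ((u%:Z - 2 ^+ k)%:~R / 2 ^+ k.+1 : R) = u%:R / 2 ^+ k.+1 - 2^-1.
  rewrite rmorphB /= rmorphXn /= mulrBl exprS; congr (_ - _).
  by field; rewrite gt_eqF.
have E1 (u : nat) : ((u%:Z - 2 ^+ k + 1)%:~R / 2 ^+ k.+1 : R) = u.+1%:R / 2 ^+ k.+1 - 2^-1.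
  by rewrite -E -[u.+1]addn1 PoszD; congr (_%:~R / _); ring.
by apply/seteqP; split=> x h i; have := h i; rewrite mxE E E1.
Qed.

Lemma cell_sub_anc n k (a : leaf d n) : (k <= n)%N -> closed_cell a `<=` closed_cell (anc k a).
Proof.
move=> kn x h i; have /andP[h1 h2] := h i; rewrite ancE //.
have -> : (2 : R) ^+ k = 2 ^+ n / 2 ^+ (n - k).
  have -> : 2 ^+ n = 2 ^+ (n - k) * 2 ^+ k :> R by rewrite -exprD subnK.
  by rewrite mulrAC divff ?mul1r // gt_eqF.
have E0 := pow_gt0 (n - k); have N0 := pow_gt0 n.
have e1 : ((a i %/ 2 ^ (n - k))%:R : R) * 2 ^+ (n - k) <= (a i)%:R.
  by rewrite -natrX -natrM ler_nat leq_trunc_div.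
have e2 : ((a i).+1%:R : R) <= (a i %/ 2 ^ (n - k)).+1%:R * 2 ^+ (n - k).
  by rewrite -natrX -natrM ler_nat ltn_ceil // expn_gt0.
rewrite !invf_div !mulrA; apply/andP; split.
  apply: le_trans h1; rewrite lerD2r ler_pM2r ?invr_gt0 //.
by apply: le_trans h2 _; rewrite lerD2r ler_pM2r ?invr_gt0.
Qed.

Lemma cell_anc_sub k (a : leaf d k.+1) : cell a `<=` cell (anc k a).
Proof.
move=> x h i; have /andP[h1 h2] := h i; rewrite ancE // subSnn expn1.
rewrite exprS invfM !mulrA in h1 h2; have N0 : 0 < (2 ^+ k)^-1 :> R by rewrite invr_gt0.
have e1 : ((a i %/ 2)%:R : R) <= (a i)%:R / 2.
  by rewrite ler_pdivlMr // -natrM ler_nat leq_trunc_div.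
have e2 : ((a i).+1%:R : R) / 2 <= (a i %/ 2).+1%:R.
  by rewrite ler_pdivrMr // -natrM ler_nat ltn_ceil.
apply/andP; split; first by apply: le_trans h1; rewrite lerD2r ler_pM2r.
by apply: lt_le_trans h2 _; rewrite lerD2r ler_pM2r.
Qed.

Lemma closed_closed_cell k (a : leaf d k) : closed (closed_cell a).
Proof.
rewrite (_ : closed_cell a = \bigcap_(i in setT)
   ((fun x : 'rV[R]_d => x ord0 i) @^-1`
     `[(a i)%:R / 2 ^+ k - 2^-1, (a i).+1%:R / 2 ^+ k - 2^-1])).
  apply: closed_bigI => i _; apply: preimage_closed; last exact: interval_closed.
  by move=> x _; exact: coord_continuous.
apply/seteqP; split=> x h i; first by move=> _; rewrite /= in_itv /=; exact: h.
by have := h i I; rewrite /= in_itv.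
Qed.

(** Moving a point of the closed cube towards the lower corner makes it enter
    the half-open one. *)
Lemma closure_cell k (a : leaf d k) : closure (cell a) = closed_cell a.
Proof.
apply/seteqP; split.
  rewrite [X in _ `<=` X]((closure_id _).1 (@closed_closed_cell k a)).
  apply: closure_subset => x h i.
  by have /andP[-> /ltW ->] := h i.
move=> x h U /nbhs_ballP[e /= e0 eU].
pose lo i : R := (a i)%:R / 2 ^+ k - 2^-1.
pose t : R := Num.min (e / 2) (2^-1).
have t0 : 0 < t by rewrite /t lt_min; apply/andP; split; lra.
have t1 : t <= 2^-1 by rewrite /t ge_min lexx orbT.
have te : t <= e / 2 by rewrite /t ge_min lexx.
have w0 : 0 < (2 ^+ k)^-1 :> R by rewrite invr_gt0.
have w1 : (2 ^+ k)^-1 <= 1 :> R by rewrite invf_le1 // exprn_ege1 // ler1n.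
have hi i : (a i).+1%:R / 2 ^+ k - 2^-1 = lo i + (2 ^+ k)^-1.
  by rewrite /lo -addn1 natrD mulrDl mul1r; ring.
pose y : 'rV[R]_d := \row_i (x ord0 i - t * (x ord0 i - lo i)).
have bounds i : exists2 z, x ord0 i = lo i + z & 0 <= z <= (2 ^+ k)^-1.
  exists (x ord0 i - lo i); first by rewrite addrC subrK.
  have := h i; rewrite hi -/(lo i) => /andP[l u].
  by apply/andP; split; lra.
exists y; split.
  move=> i; rewrite mxE hi -/(lo i); have [z -> /andP[z0 zw]] := bounds i.
  move: (2 ^+ k)^-1 w0 zw => W w0 zw.
  have m1 : 0 <= (1 - t) * z by apply: mulr_ge0 => //; lra.
  have m2 : 0 <= (1 - t) * (W - z) by apply: mulr_ge0; lra.
  have m3 : 0 < t * W by apply: mulr_gt0.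
  have -> : lo i + z - t * (lo i + z - lo i) = lo i + (1 - t) * z by ring.
  have m4 : (1 - t) * (W - z) = W - t * W - (1 - t) * z by ring.
  by rewrite m4 in m2; apply/andP; split; lra.
apply: eU; split=> // i j; rewrite ord1 /ball /= mxE.
have [z -> /andP[z0 zw]] := bounds j.
have -> : lo j + z - (lo j + z - t * (lo j + z - lo j)) = t * z by ring.
rewrite ger0_norm ?mulr_ge0 ?(ltW t0) //.
apply: (@le_lt_trans _ _ (t * 1)); last by lra.
by apply: ler_wpM2l; [exact: ltW|lra].
Qed.

End Cubes.

Section PercolationCells.
Context {disp : measure_display} {T : measurableType disp} {R : realType}
  {P : probability T R} {d : nat} {p : R} (X : percolation P d p).

Let pow_gt0 k : 0 < 2 ^+ k :> R. Proof. by rewrite exprn_gt0. Qed.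

(** The parent of a kept cube is recovered from the inclusion: the lower corner
    of the cube lies in a single cube of the previous level. *)
Lemma kept_cubesE k w (Q : set 'rV[R]_d) :
  kept_cubes X k w Q <-> exists2 a : leaf d k, Q = cell a & alive X a w.
Proof.
elim: k Q => [|k IH] Q /=.
  pose o : leaf d 0 := [ffun=> Ordinal (expn2_gt0 0)].
  have oE : unit_box = @cell R d 0 o.
    have e0 : 0%:R / 2 ^+ 0 - 2^-1 = - 2^-1 :> R by rewrite mul0r sub0r.
    have e1 : 1%:R / 2 ^+ 0 - 2^-1 = 2^-1 :> R by rewrite expr0 divr1; lra.
    by apply/seteqP; split=> x h i; have := h i; rewrite ffunE /= e0 e1.
  split=> [->|[a -> _]]; first by exists o.
  by rewrite (leaf0_eq a o) -oE.
split=> [[z [QE [Q' /IH[a Q'E aw] QQ'] kz]]|[b QE bw]]; last first.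
  exists (vertex k (fun i => b i)); split; first by rewrite QE cell_vertex.
    exists (cell (anc k b)); first by apply/IH; exists (anc k b) => //; exact: alive_anc bw.
    by rewrite QE; exact: cell_anc_sub.
  by have := bw k (ltnSn k); rewrite anc_id.
have corner : cell a (\row_i ((z ord0 i)%:~R / 2 ^+ k.+1) : 'rV[R]_d).
  rewrite -Q'E; apply: QQ'; rewrite QE => i; rewrite mxE lexx /= ltr_pM2r ?invr_gt0 //.
  by rewrite ltr_int ltzD1.
have zP i : exists u : nat, [/\ (z ord0 i = u%:Z - 2 ^+ k)%R, (u %/ 2 = a i)%N & (u < 2 ^ k.+1)%N].
  have := corner i; rewrite mxE => /andP[c1 c2].
  have K0 := pow_gt0 k.
  have e : (z ord0 i)%:~R / 2 ^+ k.+1 = ((z ord0 i)%:~R / 2) / 2 ^+ k :> R.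
    by rewrite exprS invfM mulrA.
  rewrite e in c1 c2.
  have f1 : ((a i)%:R * 2 - 2 ^+ k : R) <= (z ord0 i)%:~R.
    move: c1; rewrite lerBlDr => c1.
    have := ler_wpM2r (ltW K0) c1; rewrite mulrDl !divfK ?gt_eqF // => c3; lra.
  have f2 : (z ord0 i)%:~R < ((a i).+1%:R * 2 - 2 ^+ k : R).
    move: c2; rewrite ltrBrDr => c2.
    have : ((z ord0 i)%:~R / 2 / 2 ^+ k + 2^-1) * 2 ^+ k < (a i).+1%:R / 2 ^+ k * 2 ^+ k :> R.
      by rewrite ltr_pM2r.
    rewrite mulrDl !divfK ?gt_eqF // => c3; lra.
  have g1 : ((a i)%:Z * 2 - 2 ^+ k <= z ord0 i)%R.
    by rewrite -(ler_int R) rmorphB rmorphM rmorphXn.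
  have g2 : (z ord0 i < (a i).+1%:Z * 2 - 2 ^+ k)%R.
    by rewrite -(ltr_int R) rmorphB rmorphM rmorphXn.
  have pe : (2 : int) ^+ k = (2 ^ k)%N%:Z by rewrite -natrX natz.
  rewrite pe in g1 g2 *.
  have ai := ltn_ord (a i).
  exists (absz (z ord0 i + (2 ^ k)%N%:Z)); rewrite expnS.
  move: (2 ^ k)%N (nat_of_ord (a i)) g1 g2 ai => K A; move: (z ord0 i : int) => zi.
  by move=> *; split; lia.
have [u hu] := choice zP.
have ul i : (u i < 2 ^ k.+1)%N by have [] := hu i.
pose b : leaf d k.+1 := [ffun i => Ordinal (ul i)].
have zE : z = vertex k (fun i => b i).
  by apply/rowP => i; rewrite mxE ffunE /=; have [] := hu i.
have ab : anc k b = a.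
  by apply: leafP => i; rewrite ancE // ffunE /= subSnn expn1; have [] := hu i.
exists b; first by rewrite QE zE cell_vertex.
move=> j; rewrite ltnS leq_eqVlt => /orP[/eqP ->|jk]; first by rewrite anc_id -zE.
by rewrite -(@anc_anc _ _ k) // ab; exact: aw.
Qed.

Lemma discrete_percolationE n w (x : 'rV[int]_d) : (0 < n)%N ->
  discrete_percolation X n w x <->
  exists2 a : leaf d n, x = vertex n.-1 (fun i => a i) & alive X a w.
Proof.
move=> n0; have N0 := pow_gt0 n.
have half (u : nat) : u%:R / 2 ^+ n - 2^-1 = (u%:Z - 2 ^+ n.-1)%:~R / 2 ^+ n :> R.
  rewrite rmorphB /= rmorphXn /= mulrBl -[in X in _ - _ / X](prednK n0) exprS; congr (_ - _).
  by field; rewrite gt_eqF.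
have halfS (u : nat) : u.+1%:R / 2 ^+ n - 2^-1 = (u%:Z - 2 ^+ n.-1 + 1)%:~R / 2 ^+ n :> R.
  by rewrite half -[u.+1]addn1 PoszD; congr (_%:~R / _); ring.
split.
  move=> [_ /kept_cubesE[a -> aw] [y ya yx]]; exists a => //.
  apply/rowP => i; rewrite mxE.
  have yi : y ord0 i = (x ord0 i)%:~R / 2 ^+ n.
    by have /rowP/(_ i) := yx; rewrite !mxE => <-; rewrite mulrC mulKf ?gt_eqF.
  have := ya i; rewrite yi half halfS ler_pM2r ?invr_gt0 // ltr_pM2r ?invr_gt0 //.
  rewrite ler_int ltr_int ltzD1 => h; apply/eqP; rewrite eq_sym eq_le; exact: h.
move=> [a -> aw]; exists (cell a); first by apply/kept_cubesE; exists a.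
exists (\row_i (((a i)%:Z - 2 ^+ n.-1)%:~R / 2 ^+ n)); last first.
  by apply/rowP => i; rewrite !mxE mulrC divfK ?gt_eqF.
move=> i; rewrite mxE half halfS lexx /= ltr_pM2r ?invr_gt0 //.
by rewrite ltr_int ltzD1.
Qed.

Lemma continuous_percolationE w (x : 'rV[R]_d) :
  continuous_percolation X w x <->
  forall n, (0 < n)%N -> exists2 a : leaf d n, closed_cell a x & alive X a w.
Proof.
split=> h n n0.
  have [_ /kept_cubesE[a -> aw]] := h n n0.
  by rewrite closure_cell => xa; exists a.
have [a xa aw] := h n n0; exists (cell a); first by apply/kept_cubesE; exists a.
by rewrite closure_cell.
Qed.

End PercolationCells.

(** * Conditional laws and nested cubes *)

Section ConditionalLaw.
Local Open Scope ereal_scope.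
Context {d1 d2 : measure_display} {T1 : measurableType d1} {T2 : measurableType d2}
  {R : realType} (P : probability T1 R) (A : set T1) (f : T1 -> T2).
Hypothesis mA : measurable A.
Hypothesis mf : forall U, measurable U -> measurable (A `&` f @^-1` U).
Hypothesis A0 : (0 < pr P A)%R.

Definition conditional_law (U : set T2) : \bar R :=
  P (A `&` f @^-1` U) * ((pr P A)^-1)%:E.

Let law0 : conditional_law set0 = 0.
Proof. by rewrite /conditional_law preimage_set0 setI0 measure0 mul0e. Qed.

Let law_ge0 U : 0 <= conditional_law U.
Proof. by rewrite /conditional_law mule_ge0 // lee_fin invr_ge0 ltW. Qed.

Let law_sigma_additive : semi_sigma_additive conditional_law.
Proof.
move=> F mF tF mUF; rewrite /conditional_law.
rewrite [X in X @ _ --> _](_ : _ = (fun n => \sum_(0 <= i < n) P (A `&` f @^-1` F i)) \*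
                               cst ((pr P A)^-1)%:E); last first.
  by apply/funext => n; rewrite -ge0_sume_distrl.
apply: cvgeZr => //; rewrite preimage_bigcup setI_bigcupr.
apply: measure_semi_sigma_additive => [i||].
- exact: mf.
- apply/trivIsetP => i j _ _ ij; rewrite setIACA setIid -preimage_setI.
  by have /trivIsetP/(_ i j I I ij) -> := tF; rewrite preimage_set0 setI0.
- by rewrite -setI_bigcupr -preimage_bigcup; exact: mf.
Qed.

HB.instance Definition _ := isMeasure.Build _ _ _ conditional_law
  law0 law_ge0 law_sigma_additive.

Let law1 : conditional_law setT = 1.
Proof.
rewrite /conditional_law preimage_setT setIT (prE P mA) -EFinM divff //.
by rewrite gt_eqF.
Qed.

HB.instance Definition _ := Measure_isProbability.Build _ _ _ conditional_law law1.

Lemma conditional_law_exists : exists nu : probability T2 R,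
  forall U, measurable U -> nu U = (pr P (A `&` f @^-1` U) / pr P A)%:E.
Proof.
exists conditional_law => U mU.
by rewrite /= /conditional_law (prE P (mf mU)) -EFinM.
Qed.
End ConditionalLaw.

Section NestedCells.
Context {R : realType} {d : nat}.

Definition lower_corner k (a : leaf d k) i : R := (a i)%:R / 2 ^+ k - 2^-1.

(** The intersection of a decreasing sequence of closed cubes, as the supremum
    of their lower corners. *)
Definition limit_point (a : forall k, leaf d k) : 'rV[R]_d :=
  \row_i sup [set lower_corner (a k) i | k in setT].

Lemma limit_point_in (a : forall k, leaf d k) :
  (forall k, anc k (a k.+1) = a k) -> forall k, closed_cell (a k) (limit_point a).
Proof.
move=> aS; have anc_a j k : (j <= k)%N -> anc j (a k) = a j.
  move=> /subnK <-; elim: (k - j)%N => [|m IH]; first by rewrite anc_id.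
  by rewrite addSn -IH -(aS (m + j)%N) anc_anc ?leq_addl.
pose corner k : 'rV[R]_d := \row_i lower_corner (a k) i.
have cornerP k : closed_cell (a k) (corner k).
  move=> i; rewrite mxE /lower_corner lexx /= lerD2r.
  by rewrite ler_pM2r ?invr_gt0 ?exprn_gt0 // ler_nat.
have below j k i : lower_corner (a j) i <= (a k i).+1%:R / 2 ^+ k - 2^-1.
  have [jk|kj] := leqP j k.
    have := cell_sub_anc jk (cornerP k) i; rewrite anc_a // => /andP[h _].
    by apply: le_trans h _; have /andP[_] := cornerP k i.
  have := cell_sub_anc (ltnW kj) (cornerP j) i; rewrite anc_a ?(ltnW kj) //.
  by rewrite mxE => /andP[].
move=> k i; rewrite mxE; apply/andP; split.
  apply: ub_le_sup; last by exists k.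
  by exists ((a 0%N i).+1%:R / 2 ^+ 0 - 2^-1) => _ [j _ <-].
apply: ge_sup; first by exists (lower_corner (a 0%N) i), 0%N.
by move=> _ [j _ <-].
Qed.

Lemma closed_cell_dist k (a : leaf d k) (x y : 'rV[R]_d) i :
  closed_cell a x -> closed_cell a y -> `|x ord0 i - y ord0 i| <= 2 ^- k.
Proof.
move=> /(_ i) /andP[x1 x2] /(_ i) /andP[y1 y2].
rewrite -[(a i).+1]addn1 natrD mulrDl mul1r in x2 y2.
by rewrite ler_norml; apply/andP; split; lra.
Qed.

Lemma closed_cell_near k (a b c : leaf d k) (x y : 'rV[R]_d) :
  closed_cell a x -> closed_cell b y -> closed_cell c (x + y) -> near a b c.
Proof.
move=> ha hb hc; apply/forallP => i.
have := hc i; have := hb i; have := ha i; rewrite mxE.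
have K0 : 0 < 2 ^+ k :> R by rewrite exprn_gt0.
have shift (u : nat) (v : R) : u%:R / 2 ^+ k - 2^-1 <= v -> (2 * u)%:R <= (2 * v + 1) * 2 ^+ k.
  by move=> h; rewrite natrM -ler_pdivrMr // -mulrA; lra.
have shift' (u : nat) (v : R) : v <= u%:R / 2 ^+ k - 2^-1 -> (2 * v + 1) * 2 ^+ k <= (2 * u)%:R.
  by move=> h; rewrite natrM -ler_pdivlMr // -mulrA; lra.
move=> /andP[/shift a1 /shift' a2] /andP[/shift b1 /shift' b2] /andP[/shift c1 /shift' c2].
have e1 : ((2 * (a i + b i))%N%:R : R) <= (2 * (c i).+1 + 2 ^ k)%N%:R.
  rewrite mulnDr [leLHS]natrD [leRHS]natrD natrX; apply: le_trans (lerD a1 b1) _.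
  by apply: le_trans (lerD c2 (lexx _)); rewrite le_eqVlt; apply/orP; left; apply/eqP; ring.
have e2 : ((2 * c i + 2 ^ k)%N%:R : R) <= (2 * (a i).+1 + 2 * (b i).+1)%N%:R.
  rewrite [leLHS]natrD [leRHS]natrD natrX; apply: le_trans (lerD a2 b2).
  by apply: le_trans (lerD c1 (lexx _)) _; rewrite le_eqVlt; apply/orP; left; apply/eqP; ring.
rewrite !ler_nat in e1 e2.
by apply/andP; split; lia.
Qed.

Lemma closed_approx (L : set 'rV[R]_d) (x : 'rV[R]_d) (C : R) : closed L ->
  (forall k, exists2 y, L y & forall i, `|x ord0 i - y ord0 i| <= C * 2 ^- k) -> L x.
Proof.
move=> cL h; apply: cL => U /nbhs_ballP[e /= e0 eU].
have [k hk] : exists k, C * 2 ^- k < e.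
  have [k hk] : exists k : nat, C / e < k%:R.
    exists (Num.bound `|C / e|); apply: le_lt_trans (ler_norm _) _.
    exact/archi_boundP/normr_ge0.
  exists k; rewrite ltr_pdivrMr ?exprn_gt0 // mulrC -ltr_pdivrMr //.
  by apply: lt_trans hk _; rewrite -natrX ltr_nat ltn_expl.
have [y Ly xy] := h k; exists y; split=> //; apply: eU; split=> // i j.
by rewrite ord1 /ball /=; apply: le_lt_trans (xy j) hk.
Qed.

End NestedCells.

(** * The limit set *)

Section ContinuousModel.
Context {disp : measure_display} {T : measurableType disp} {R : realType}
  {P : probability T R} {d : nat} {p q : R}
  (X : percolation P d p) (Y : percolation P d q).
Hypothesis indXY : independent_families P (keep X) (keep Y).
Hypothesis p01 : 0 < p <= 1.
Hypothesis q01 : 0 < q <= 1.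
Hypothesis pq1 : p * q < 1.
Context (B : forall k, pred (leaf d k)) (lam : nat).
Hypothesis cardB : forall k, (#|[pred b | @B k b]| <= lam ^ k)%N.
Hypothesis lam0 : (0 < lam)%N.
Hypothesis B_anc : forall n k (b : leaf d n), (k <= n)%N -> B b -> B (anc k b).
Context (L : set 'rV[R]_d).
Hypothesis cL : closed L.

Let r : R := p * q * lam%:R.
Let C1 : R := 36 ^+ d * 256 / (1 - p * q).

Definition meets k (s : leaf d k * leaf d k) : Prop :=
  B s.2 /\ exists x y, [/\ closed_cell s.1 x, closed_cell s.2 y & L (x + y)].

Definition cell_hit k (s : leaf d k * leaf d k) : set T :=
  [set w | meets s /\ alive2 X Y s w].

Definition pair_anc k (s : leaf d k.+1 * leaf d k.+1) : leaf d k * leaf d k :=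
  (anc k s.1, anc k s.2).

Definition origin k : leaf d k * leaf d k :=
  ([ffun=> Ordinal (expn2_gt0 k)], [ffun=> Ordinal (expn2_gt0 k)]).

Definition continuous_hit : set T := infinite_branch cell_hit.

Lemma measurable_cell_hit k (s : leaf d k * leaf d k) : measurable (cell_hit s).
Proof.
have [ms|nms] := pselect (meets s).
  rewrite (_ : cell_hit s = alive2 X Y s); first exact: measurable_alive2.
  by apply/seteqP; split=> w //; case.
by rewrite (_ : cell_hit s = set0) // -subset0 => w [].
Qed.

Lemma cell_hit_anc k (s : leaf d k.+1 * leaf d k.+1) :
  cell_hit s `<=` cell_hit (pair_anc s).
Proof.
move=> w [[Bs [x [y [xs ys Lxy]]]] [aX aY]]; split; last first.
  by split; [exact: (alive_anc _ aX)|exact: (alive_anc _ aY)].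
split; first exact: B_anc.
by exists x, y; split=> //; exact: cell_sub_anc.
Qed.

Let sel k (w : T) : leaf d k * leaf d k := branch pair_anc origin cell_hit k w.

Let measurable_sel k (s : leaf d k * leaf d k) : measurable (continuous_hit `&` [set w | sel k w = s]).
Proof. exact: (measurable_branch _ _ measurable_cell_hit). Qed.

Let measurable_hit : measurable continuous_hit.
Proof. exact: (measurable_infinite_branch measurable_cell_hit). Qed.

Let point1 w : 'rV[R]_d := limit_point (fun k => (sel k w).1).
Let point2 w : 'rV[R]_d := limit_point (fun k => (sel k w).2).
Let hit_point w : 'rV[R]_d := point1 w + point2 w.

Let sel_in k w : continuous_hit w -> cell_hit (sel k w) w.
Proof. exact: (branch_in _ cell_hit_anc). Qed.

Let par_sel k w : continuous_hit w -> pair_anc (sel k.+1 w) = sel k w.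
Proof. exact: (par_branch _ cell_hit_anc). Qed.

Let point1_in k w : continuous_hit w -> closed_cell (sel k w).1 (point1 w).
Proof.
move=> hw; apply: (@limit_point_in _ _ (fun k => (sel k w).1)) => j.
by rewrite -(par_sel j hw).
Qed.

Let point2_in k w : continuous_hit w -> closed_cell (sel k w).2 (point2 w).
Proof.
move=> hw; apply: (@limit_point_in _ _ (fun k => (sel k w).2)) => j.
by rewrite -(par_sel j hw).
Qed.

Let sum_dist k (s : leaf d k * leaf d k) (x y x' y' : 'rV[R]_d) i :
  closed_cell s.1 x -> closed_cell s.2 y -> closed_cell s.1 x' -> closed_cell s.2 y' ->
  `|(x + y) ord0 i - (x' + y') ord0 i| <= 2 * 2 ^- k.
Proof.
move=> xs ys xs' ys'; rewrite !mxE.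
have := closed_cell_dist i xs xs'; have := closed_cell_dist i ys ys'.
have -> : x ord0 i + y ord0 i - (x' ord0 i + y' ord0 i) =
  (x ord0 i - x' ord0 i) + (y ord0 i - y' ord0 i) by ring.
move=> h1 h2; apply: le_trans (ler_normD _ _) _; lra.
Qed.

Let hit_point_in w : continuous_hit w -> L (hit_point w).
Proof.
move=> hw; apply: (closed_approx (C := 2) cL) => k.
have [[_ [x [y [xs ys Lxy]]]] _] := sel_in k hw.
exists (x + y) => // i; apply: (@sum_dist k (sel k w)) => //.
  exact: point1_in.
exact: point2_in.
Qed.

(** An infinite branch of surviving pairs of cubes whose sums meet [L] shrinks
    to two points whose sum is a limit of points of the closed set [L]. *)
Lemma continuous_hitE w : continuous_hit w <->
  exists x y, [/\ L (x + y),
    forall n, (0 < n)%N -> exists2 a : leaf d n, closed_cell a x & alive X a w &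
    forall n, (0 < n)%N -> exists b : leaf d n, [/\ closed_cell b y, B b & alive Y b w]].
Proof.
split=> [hw|[x [y [Lxy hx hy]]]].
  exists (point1 w), (point2 w); split; first exact: hit_point_in.
    move=> n _; have [_ [aX _]] := sel_in n hw.
    by exists (sel n w).1 => //; exact: point1_in.
  move=> n _; have [[Bs _] [_ aY]] := sel_in n hw.
  by exists (sel n w).2; split=> //; exact: point2_in.
have pos n : (0 < n)%N -> exists v : leaf d n * leaf d n, cell_hit v w.
  move=> n0; have [a xa aw] := hx n n0; have [b [yb Bb bw]] := hy n n0.
  by exists (a, b); split=> //; split=> //; exists x, y.
case=> [|n]; last exact: pos.
by have [v vw] := pos 1%N isT; exists (pair_anc v); exact: cell_hit_anc vw.
Qed.

(** The finite-level events decrease to the limiting one. *)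
Lemma sub_continuous_hit (c : R) :
  (forall n, (0 < n)%N -> c <= pr P [set w | exists s : leaf d n * leaf d n, cell_hit s w]) ->
  c <= pr P continuous_hit.
Proof.
move=> h; pose E n := [set w | exists s : leaf d n * leaf d n, cell_hit s w].
have mE n : measurable (E n).
  rewrite (_ : E n = [set w | exists2 s : leaf d n * leaf d n, predT s & cell_hit s w]).
    apply: measurable_finset; exact: measurable_cell_hit.
  by apply/seteqP; split=> w [s]; [move=> ?; exists s | move=> _ ?; exists s].
have HE : continuous_hit = \bigcap_n E n.
  by apply/seteqP; split=> w hw n; [move=> _; exact: hw | exact: hw].
have Edec : {homo E : n m / (n <= m)%N >-> (m <= n)%O}.
  apply/nonincreasing_seqP => n; rewrite subsetEset => w [s sw].
  by exists (pair_anc s); exact: cell_hit_anc.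
have cv := @nonincreasing_cvg_mu _ _ _ P E.
have {}cv : P (E n) @[n --> \oo] --> P (\bigcap_n E n).
  apply: cv => //; last by rewrite -HE.
  by rewrite (le_lt_trans (probability_le1 P (mE 0%N))) // ltry.
rewrite -lee_fin -prE // HE -(cvg_lim _ cv) //.
apply: lime_ge; first by apply/cvg_ex; exists (P (\bigcap_n E n)).
by exists 1%N => // n /= n0; rewrite prE // lee_fin; exact: h.
Qed.

Lemma discrete_sub_cell_hit n (A : pred (leaf d n)) : (0 < n)%N ->
  (forall z, A z -> exists2 x, L x & closed_cell z x) ->
  discrete_hit X Y B A `<=` [set w | exists s : leaf d n * leaf d n, cell_hit s w].
Proof.
move=> n0 hA w [s [z [Az Bs sz sw]]]; exists s; split=> //; split=> //.
have [x Lx xz] := hA z Az.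
pose y : 'rV[R]_d := \row_i lower_corner (s.2) i.
have N0 : 0 < 2 ^+ n :> R by rewrite exprn_gt0.
exists (x - y), y; split; last by rewrite subrK.
  move=> i; rewrite !mxE /lower_corner.
  have /eqP := forallP sz i; have := xz i.
  rewrite -[(z i).+1]addn1 -[(s.1 i).+1]addn1 !natrD !mulrDl mul1r.
  move=> /andP[x1 x2] /(congr1 (fun u : nat => u%:R / 2 ^+ n : R)).
  rewrite [in LHS]natrD [in RHS]natrD natrX !mulrDl.
  have -> : 2 ^+ n.-1 / 2 ^+ n = 2^-1 :> R.
    by rewrite -[X in _ / 2 ^+ X](prednK n0) exprS invfM mulrCA divff ?mulr1 // gt_eqF ?exprn_gt0.
  by move=> e; apply/andP; split; lra.
move=> i; rewrite mxE /lower_corner lexx /= lerD2r.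
by rewrite ler_pM2r ?invr_gt0 // ler_nat.
Qed.

Let measurable_hit_point U : @measurable _ (borel_space R d) U ->
  measurable (continuous_hit `&` hit_point @^-1` U).
Proof.
suff mf : @measurable_fun _ _ T (borel_space R d) continuous_hit hit_point by exact: mf.
apply: (@measurability _ _ _ (borel_space R d) _ _ [set U : set 'rV[R]_d | open U]) => //.
move=> _ [V oV <-] /=.
(* the branch point is in the open set [V] once the whole cell is *)
pose inside k (s : leaf d k * leaf d k) : bool :=
  `[< forall x y, closed_cell s.1 x -> closed_cell s.2 y -> V (x + y) >].
rewrite (_ : _ `&` _ = \bigcup_k [set w | exists2 s, @inside k s &
    (continuous_hit `&` [set w | sel k w = s]) w]).
  by apply: bigcupT_measurable => k; apply: measurable_finset.
apply/seteqP; split=> w; last first.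
  move=> [k _ [s /asboolP ins [hw ws]]]; split=> //.
  by apply: ins; rewrite -ws; [exact: point1_in|exact: point2_in].
move=> [hw Vw]; apply: contrapT => no.
have : closed (~` V) by exact: open_closedC.
move=> cV; apply: (closed_approx (C := 2) cV _) (Vw) => k.
have : ~ (exists2 s, @inside k s & (continuous_hit `&` [set w | sel k w = s]) w).
  by move=> ex; apply: no; exists k.
move=> nk; apply: contrapT => none; apply: nk; exists (sel k w) => //.
apply/asboolP => x y xs ys; apply: contrapT => nV; apply: none; exists (x + y) => // i.
by apply: (@sum_dist k (sel k w)) => //; [exact: point1_in|exact: point2_in].
Qed.

Let sel_mass k (s : leaf d k * leaf d k) : R := pr P (continuous_hit `&` [set w | sel k w = s]).

Let sel_mass_level n k : (k <= n)%N ->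
  level_mass2 k k (@sel_mass n) =1 @sel_mass k.
Proof.
move=> kn s; rewrite /level_mass2 /sel_mass -pr_sum //; last first.
  by move=> i j w [_ <-] [_ <-].
have anc_sel w : continuous_hit w -> (anc k (sel n w).1, anc k (sel n w).2) = sel k w.
  move=> hw; move: kn => /subnK <-; elim: (n - k)%N => [|j IH].
    by rewrite !anc_id; case: (sel k w).
  by rewrite -IH addSn -(par_sel (j + k)%N hw) /pair_anc /= !anc_anc ?leq_addl.
congr (pr P _); apply/seteqP; split=> w.
  by move=> [t /eqP <- [hw /= wt]]; split=> //=; rewrite -anc_sel // wt.
by move=> [hw /= ws]; exists (sel n w) => //; rewrite anc_sel // ws.
Qed.

Lemma sum_sel_mass n : \sum_s @sel_mass n s = pr P continuous_hit.
Proof.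
rewrite /sel_mass -pr_sum //; last by move=> i j w [_ <-] [_ <-].
congr (pr P _); apply/seteqP; split=> w; first by case=> s _ [].
by move=> hw; exists (sel n w).
Qed.

(** The measure is the law of the sum of the two points on the selected branch,
    given that there is one.  At every level the selected pairs of cubes are
    disjoint events contained in survival, so the energy bound applies to them;
    each cube of the sum is reached by few of these pairs. *)
Lemma hitting_law : 0 < pr P continuous_hit ->
  exists2 nu : probability (borel_space R d) R, nu L = 1%E &
   forall n, \sum_(k < n.+1) (r^-1) ^+ k *
     \sum_(c : leaf d k) fine (nu (closed_cell c)) ^+ 2 <= C1 / pr P continuous_hit.
Proof.
move=> M0; set M := pr P continuous_hit in M0 *.
have mclosed (F : set 'rV[R]_d) : closed F -> @measurable _ (borel_space R d) F.
  move=> cF; rewrite -[F]setCK; apply: measurableC.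
  by apply: sub_sigma_algebra; exact: closed_openC.
have [nu nuE] := conditional_law_exists (T2 := borel_space R d) measurable_hit
  measurable_hit_point M0.
exists nu.
  rewrite nuE; last exact: mclosed.
  rewrite (_ : _ `&` _ = continuous_hit) ?divff ?gt_eqF //.
  by apply/seteqP; split=> w; [case|move=> hw; split=> //; exact: hit_point_in].
move=> n; have M_ge0 : 0 <= M by exact: ltW.
have aH s : (continuous_hit `&` [set w | sel n w = s]) `<=` alive2 X Y s.
  by move=> w [hw /= <-]; have [_] := sel_in n hw.
have tH s t w : (continuous_hit `&` [set w | sel n w = s]) w ->
    (continuous_hit `&` [set w | sel n w = t]) w -> s = t.
  by move=> [_ <-] [_ <-].
have := level_energy_le indXY p01 q01 pq1 (measurable_sel (k := n)) tH aH.
rewrite -/(@sel_mass n) sum_sel_mass -/M => en.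
have cell_le k (c : leaf d k) : fine (nu (closed_cell c)) <=
    \sum_(ab | near ab.1 ab.2 c && B ab.2) (@sel_mass k ab / M).
  have mcc : @measurable _ (borel_space R d) (closed_cell c).
    by apply: mclosed; exact: closed_closed_cell.
  rewrite nuE //= -mulr_suml ler_pM2r ?invr_gt0 //.
  rewrite /sel_mass -pr_sum //; last by move=> i j w [_ <-] [_ <-].
  apply: pr_le; [exact: measurable_hit_point|exact: measurable_finset|].
  move=> w [hw /= wc]; exists (sel k w) => //.
  have [[Bs _] _] := sel_in k hw; rewrite Bs andbT.
  apply: (@closed_cell_near _ _ _ _ _ _ (point1 w) (point2 w)) => //.
    exact: point1_in.
  exact: point2_in.
have pq0 : 0 < p * q by case/andP: p01 q01 => ? _ /andP[? _]; exact: mulr_gt0.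
have lamR : 0 < lam%:R :> R by rewrite ltr0n.
apply: (@le_trans _ _ (\sum_(k < n.+1) (36 ^+ d / M ^+ 2) * ((p * q)^-1 ^+ k *
    \sum_ab level_mass2 k k (@sel_mass n) ab ^+ 2))).
  apply: ler_sum => k _; have kn : (k <= n)%N by rewrite -ltnS.
  have h := @near_sum_sqr R d B lam cardB k (fun ab => @sel_mass k ab / M)
    (fun c => fine (nu (closed_cell c))).
  apply: le_trans (ler_wpM2l _ (h _ _ _)) _.
  - by rewrite exprn_ge0 // invr_ge0 /r mulr_ge0 // ltW.
  - by move=> ab; rewrite divr_ge0 // pr_ge0.
  - by move=> c; exact: fine_ge0.
  - exact: cell_le.
  under [X in _ <= _ * (_ * X)]eq_bigr do rewrite sel_mass_level //.
  have -> : \sum_ab (@sel_mass k ab / M) ^+ 2 = (\sum_ab @sel_mass k ab ^+ 2) * M^-1 ^+ 2.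
    by rewrite mulr_suml; apply: eq_bigr => ab _; rewrite exprMn.
  rewrite /r invfM exprMn le_eqVlt; apply/orP; left; apply/eqP.
  have : lam%:R ^+ k != 0 :> R by rewrite expf_neq0 // gt_eqF.
  move: (\sum_ab _) ((p * q)^-1 ^+ k) => S x; rewrite !exprVn.
  have : M != 0 by rewrite gt_eqF.
  by move: (lam%:R ^+ k) (36 ^+ d) => y c M1 y0; field; apply/andP.
rewrite -mulr_sumr; apply: le_trans (ler_wpM2l _ en) _.
  by rewrite divr_ge0 // exprn_ge0.
rewrite /C1 le_eqVlt; apply/orP; left; apply/eqP; field.
by rewrite gt_eqF //= subr_eq0 gt_eqF.
Qed.

End ContinuousModel.

(** * The Riesz kernel and dyadic cells *)

Section AdjacentCells.
Context {R : realType} {d : nat}.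
Implicit Types x y : 'rV[R]_d.

Definition adjacent k (a b : leaf d k) : bool :=
  [forall i, (a i <= b i + 2)%N && (b i <= a i + 2)%N].

Lemma adjacentC k (a b : leaf d k) : adjacent a b = adjacent b a.
Proof. by apply: eq_forallb => i; rewrite andbC. Qed.

Lemma card_adjacent k (a : leaf d k) : (#|[pred b | adjacent a b]| <= 6 ^ d)%N.
Proof.
apply: (@card_window _ _ _ (fun i => a i - 2)%N) => b /forallP h i; have := h i; lia.
Qed.

Definition box : set 'rV[R]_d := [set x | forall i, - 2^-1 <= x ord0 i <= 2^-1].

Lemma exists_closed_cell k x : box x -> exists c : leaf d k, closed_cell c x.
Proof.
move=> bx; have K0 : 0 < 2 ^+ k :> R by rewrite exprn_gt0.
have h i : exists u : 'I_(2 ^ k), (u : nat)%:R / 2 ^+ k - 2^-1 <= x ord0 i <= u.+1%:R / 2 ^+ k - 2^-1.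
  have /andP[x1 x2] := bx i.
  pose t := (x ord0 i + 2^-1) * 2 ^+ k.
  have t0 : 0 <= t by rewrite mulr_ge0 ?(ltW K0) //; lra.
  have t1 : t <= 2 ^+ k by rewrite -[leRHS]mul1r ler_pM2r //; lra.
  have tE : x ord0 i = t / 2 ^+ k - 2^-1 by rewrite /t mulfK ?gt_eqF // addrK.
  have goal u : (u%:R <= t <= u.+1%:R) -> u%:R / 2 ^+ k - 2^-1 <= x ord0 i <= u.+1%:R / 2 ^+ k - 2^-1.
    by move=> /andP[a b]; rewrite tE !lerD2r !ler_pM2r ?invr_gt0 // a b.
  have := truncn_itv t0 => /andP[a b].
  have [tk|kt] := ltnP (Num.truncn t) (2 ^ k).
    by exists (Ordinal tk); apply: goal; rewrite /= a ltW.
  have p0 := expn2_gt0 k.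
  have lt : ((2 ^ k).-1 < 2 ^ k)%N by rewrite prednK.
  exists (Ordinal lt); apply: goal; rewrite /= prednK // natrX t1 andbT.
  apply: le_trans a; rewrite ler_nat; apply: leq_trans kt; exact: leq_pred.
have [u hu] := choice h; exists [ffun i => u i] => i; rewrite ffunE; exact: hu.
Qed.

Lemma exists_adjacent k x y : box x -> box y ->
  (forall i, `|x ord0 i - y ord0 i| <= 2 ^- k) ->
  exists a b : leaf d k, [/\ adjacent a b, closed_cell a x & closed_cell b y].
Proof.
move=> bx by_ xy; have [a xa] := exists_closed_cell k bx.
have [b yb] := exists_closed_cell k by_; exists a, b; split=> //.
have K0 : 0 < 2 ^+ k :> R by rewrite exprn_gt0.
have W0 : 0 < 2 ^- k :> R by rewrite invr_gt0.
have half (u v : nat) (s t : R) : u%:R / 2 ^+ k - 2^-1 <= s -> t <= v.+1%:R / 2 ^+ k - 2^-1 ->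
    s - t <= 2 ^- k -> (u <= v + 2)%N.
  move=> h1 h2 h3; rewrite -(ler_nat R) -(ler_pM2r W0).
  have -> : ((v + 2)%N%:R : R) = v.+1%:R + 1 by rewrite -[v.+1]addn1 !natrD; ring.
  rewrite mulrDl mul1r; lra.
apply/forallP => i; have /andP[x1 x2] := xa i; have /andP[y1 y2] := yb i.
have := xy i; rewrite ler_norml => /andP[n1 n2]; apply/andP; split.
  exact: half x1 y2 n2.
by apply: half y1 x2 _; lra.
Qed.

End AdjacentCells.

Section RieszKernel.
Context {R : realType} {d : nat} (beta r : R).
Hypothesis beta0 : 0 < beta.
Hypothesis rE : 2 `^ (- beta) = r.
Hypothesis d0 : (0 < d)%N.
Implicit Types x y : 'rV[R]_d.

Lemma r_gt0 : 0 < r. Proof. by rewrite -rE powR_gt0. Qed.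

Lemma r_lt1 : r < 1.
Proof.
rewrite -rE powRN invf_lt1 ?powR_gt0 //.
have : 1 `^ beta < 2 `^ beta by apply: gt0_ltr_powR; rewrite ?nnegrE // ltr1n.
by rewrite powR1.
Qed.

Lemma dyadic_powR k : (2 ^- k) `^ (- beta) = r^-1 ^+ k :> R.
Proof.
have -> : r^-1 = 2 `^ beta by rewrite -rE -powRN opprK.
rewrite -powR_inv1 ?exprn_ge0 // -powR_mulrn // -!powRrM.
rewrite -[RHS]powR_mulrn ?powR_ge0 // -powRrM; congr (_ `^ _); ring.
Qed.

Lemma euclid_norm_ge x i : `|x ord0 i| <= euclid_norm x.
Proof.
rewrite -sqrtr_sqr ler_wsqrtr // (bigD1 i) //= lerDl.
by apply: sumr_ge0 => j _; exact: sqr_ge0.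
Qed.

Lemma euclid_norm_le x (e : R) : (forall i, `|x ord0 i| <= e) ->
  euclid_norm x <= d%:R * e.
Proof.
move=> h; have e0 : 0 <= e by apply: le_trans (h (Ordinal d0)); exact: normr_ge0.
have de0 : 0 <= d%:R * e by rewrite mulr_ge0.
rewrite -[leRHS]ger0_norm // -sqrtr_sqr ler_wsqrtr //.
apply: (@le_trans _ _ (\sum_(i < d) e ^+ 2)).
  apply: ler_sum => i _; rewrite -real_normK ?num_real //.
  by apply: lerXn2r; rewrite ?nnegrE.
rewrite sumr_const card_ord exprMn -[leLHS]mulr_natl ler_wpM2r ?sqr_ge0 //.
by rewrite expr2 -natrM ler_nat leq_pmulr.
Qed.

Lemma euclid_norm_eq0 x : euclid_norm x = 0 -> x = 0.
Proof.
move=> h; apply/rowP => i; rewrite mxE; apply/eqP; rewrite -normr_le0.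
by rewrite -h euclid_norm_ge.
Qed.

Lemma powR_antitone (u v : R) : 0 < u -> u <= v -> v `^ (- beta) <= u `^ (- beta).
Proof.
move=> u0 uv; have v0 : 0 < v by exact: lt_le_trans uv.
rewrite !powRN lef_pV2 ?posrE ?powR_gt0 //.
by apply: ge0_ler_powR => //; rewrite ?nnegrE ltW.
Qed.

Lemma riesz_kernel_ge0 z : (0 <= @riesz_kernel R d beta z)%E.
Proof. by rewrite /riesz_kernel; case: ifP => // _; rewrite lee_fin powR_ge0. Qed.

(** Points sharing a closed cell of level [k] are at distance of order
    [2 ^- k]. *)
Lemma riesz_kernel_ge k (c : leaf d k) x y : closed_cell c x -> closed_cell c y ->
  ((d%:R `^ (- beta) * r^-1 ^+ k)%:E <= riesz_kernel beta (x, y))%E.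
Proof.
move=> xc yc; rewrite /riesz_kernel /=; case: eqP => [_|xy]; first by rewrite leey.
rewrite lee_fin -dyadic_powR -powRM ?invr_ge0 ?exprn_ge0 //.
have n0 : 0 < euclid_norm (x - y).
  rewrite lt_neqAle sqrtr_ge0 andbT eq_sym; apply/eqP => h; apply: xy.
  by apply/eqP; rewrite -subr_eq0; apply/eqP/euclid_norm_eq0.
apply: powR_antitone => //; apply: euclid_norm_le => i; rewrite !mxE.
exact: closed_cell_dist xc yc.
Qed.

(** For [x != y] at sup-distance in [(2 ^- k.+1, 2 ^- k]], only the term of
    index [k] is used; on the diagonal infinitely many terms are at least 1. *)
Lemma riesz_kernel_le x y : box x -> box y ->
  (riesz_kernel beta (x, y) <= \sum_(0 <= k <oo) (r^-1 ^+ k.+1 *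
    \sum_(ab : leaf d k * leaf d k | adjacent ab.1 ab.2)
       \1_(closed_cell ab.1 `*` closed_cell ab.2) (x, y))%:E)%E.
Proof.
move=> bx by_; have r0 := r_gt0; have r1 := r_lt1.
pose t k : R := r^-1 ^+ k.+1 *
    \sum_(ab : leaf d k * leaf d k | adjacent ab.1 ab.2)
       \1_(closed_cell ab.1 `*` closed_cell ab.2) (x, y).
have ri k : 1 <= r^-1 ^+ k by rewrite exprn_ege1 // invf_ge1 // ltW.
have t0 k : 0 <= t k.
  apply: mulr_ge0; first exact: le_trans (ri _).
  by apply: sumr_ge0 => ab _; rewrite indicE.
have big k : (forall i, `|x ord0 i - y ord0 i| <= 2 ^- k) -> r^-1 ^+ k.+1 <= t k.
  move=> h; have [a [b [ab xa yb]]] := exists_adjacent bx by_ h.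
  rewrite -[leLHS]mulr1; apply: ler_wpM2l; first exact: le_trans (ri _).
  rewrite (bigD1 (a, b)) //= indicE mem_set //= lerDl.
  by apply: sumr_ge0 => ab' _; rewrite indicE.
rewrite /riesz_kernel /=; case: eqP => [xy|xy].
  rewrite leye_eq; apply/eqP.
  have h k : 1 <= t k.
    by apply: le_trans (ri k.+1) _; apply: big => i; rewrite xy subrr normr0 invr_ge0 exprn_ge0.
  apply/eqP; rewrite -leye_eq leNgt; apply/negP => fin.
  have tE0 k : (0 <= (t k)%:E)%E by rewrite lee_fin.
  have ge0S : (0 <= \sum_(0 <= k <oo) (t k)%:E)%E by apply: nneseries_ge0.
  have SE : (\sum_(0 <= k <oo) (t k)%:E)%E \is a fin_num by rewrite ge0_fin_numE.
  have ub n : (n%:R%:E <= \sum_(0 <= k <oo) (t k)%:E)%E.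
    apply: le_trans (nneseries_lim_ge n _) => //.
    rewrite sumEFin lee_fin big_mkord -[n in leLHS]card_ord -sumr_const; exact: ler_sum.
  have := ub (Num.bound (fine (\sum_(0 <= k <oo) (t k)%:E))).
  rewrite -{2}(fineK SE) lee_fin leNgt archi_boundP //; exact: fine_ge0.
have [i0 hi0] : exists i, x ord0 i != y ord0 i.
  apply/not_existsP => h; apply: xy; apply/rowP => i.
  by apply/eqP/negPn/negP => n; exact: (h i).
pose D := \big[Num.max/0]_(i < d) `|x ord0 i - y ord0 i|.
have Dge i : `|x ord0 i - y ord0 i| <= D by apply: le_bigmax.
have D0 : 0 < D by apply: lt_le_trans (Dge i0); rewrite normr_gt0 subr_eq0.
have D1 : D <= 1.
  apply: bigmax_le => // i _; have /andP[x1 x2] := bx i; have /andP[y1 y2] := by_ i.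
  by rewrite ler_norml; apply/andP; split; lra.
have Dle : D <= euclid_norm (x - y).
  apply: bigmax_le => [|i _]; first exact: sqrtr_ge0.
  have -> : x ord0 i - y ord0 i = (x - y) ord0 i by rewrite !mxE.
  exact: euclid_norm_ge.
have [k Dk kD] : exists2 k, D <= 2 ^- k & 2 ^- k.+1 < D.
  have exk : exists k, 2 ^- k.+1 < D.
    exists (Num.bound D^-1); rewrite invf_plt ?posrE ?exprn_gt0 //.
    have := archi_boundP (ltW (_ : 0 < D^-1)); rewrite invr_gt0 => /(_ D0) h.
    by apply: lt_trans h _; rewrite -natrX ltr_nat ltnW // ltn_expl.
  case: (ex_minnP exk) => k hk kmin; exists k => //.
  case: k hk kmin => [|k] hk kmin; first by rewrite expr0 invr1.
  by rewrite leNgt; apply/negP => /kmin; rewrite ltnn.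
apply: (@le_trans _ _ (t k)%:E).
  rewrite lee_fin; apply: le_trans (big k _); last by move=> i; exact: le_trans (Dge i) Dk.
  rewrite -dyadic_powR; apply: powR_antitone; first by rewrite invr_gt0 exprn_gt0.
  by apply: le_trans (ltW kD) Dle.
apply: le_trans (nneseries_lim_ge k.+1 _); last by move=> j _ _; rewrite lee_fin; exact: t0.
rewrite sumEFin lee_fin big_nat_recr //= lerDr; apply: sumr_ge0 => j _; exact: t0.
Qed.

End RieszKernel.

(** * Riesz energies of measures *)

Section RieszEnergy.
Context {R : realType} {d : nat} (beta r : R).
Hypothesis beta0 : 0 < beta.
Hypothesis rE : 2 `^ (- beta) = r.
Hypothesis d0 : (0 < d)%N.

Let S := borel_space R d.

Lemma closed_borel (F : set 'rV[R]_d) : closed F -> measurable (F : set S).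
Proof.
move=> cF; rewrite -[F]setCK; apply: measurableC.
by apply: sub_sigma_algebra; exact: closed_openC.
Qed.

Lemma measurable_coord i : measurable_fun setT (fun x : S => (x : 'rV[R]_d) ord0 i).
Proof.
have /continuousP cf : continuous (fun x : 'rV[R]_d => x ord0 i).
  by move=> x; exact: coord_continuous.
apply: (measurability _ (RGenOpens.measurableE R)) => _ [_ [a [b ->]] <-].
rewrite setTI; apply: sub_sigma_algebra.
by apply: cf; exact: interval_open.
Qed.

(** In terms of the squared distance, which is a polynomial in the
    coordinates. *)
Lemma measurable_riesz : measurable_fun [set: S * S] (@riesz_kernel R d beta).
Proof.
pose sq (z : S * S) : R := \sum_(i <- enum 'I_d)
  (((z.1 : 'rV[R]_d) ord0 i - (z.2 : 'rV[R]_d) ord0 i) ^+ 2).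
have msq : measurable_fun setT sq.
  apply: measurable_sum => i; apply: measurable_funX; apply: measurable_funB.
    exact: (measurableT_comp (measurable_coord i) measurable_fst).
  exact: (measurableT_comp (measurable_coord i) measurable_snd).
have sqE z : euclid_norm ((z.1 : 'rV[R]_d) - z.2) = sq z `^ 2^-1.
  rewrite powR12_sqrt; last by apply: sumr_ge0 => i _; exact: sqr_ge0.
  congr Num.sqrt; rewrite /sq big_enum /=; apply: eq_bigr => i _.
  by rewrite !mxE.
rewrite (_ : riesz_kernel beta = fun z : S * S =>
    if sq z == 0 then +oo%E else (sq z `^ (2^-1 * - beta))%:E).
  apply: measurable_fun_ifT.
  - apply: measurable_fun_eqr => //; exact: measurable_cst.
  - exact: measurable_cst.
  - apply/measurable_EFinP.
    exact: (measurableT_comp (measurable_powR (2^-1 * - beta)) msq).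
apply/funext => z; rewrite /riesz_kernel sqE -powRrM.
have -> : (z.1 == z.2 :> 'rV[R]_d) = (sq z == 0); last by [].
apply/eqP/eqP => [e|s0].
  by rewrite /sq e big1 // => i _; rewrite subrr expr0n.
apply/eqP; rewrite -subr_eq0; apply/eqP; apply: euclid_norm_eq0.
by rewrite sqE s0 powR0 // invr_neq0.
Qed.

Section Measures.
Context (L : set 'rV[R]_d) (nu : probability S R).
Hypothesis cL : closed L.
Hypothesis nuL : nu L = 1%E.
Hypothesis Lbox : L `<=` box.

Definition riesz_energy : \bar R :=
  (\int[(nu \x nu)%E]_(z in L `*` L) riesz_kernel beta z)%E.

Let mL : measurable (L : set S). Proof. exact: closed_borel. Qed.

Let mLL : measurable (L `*` L : set (S * S)).
Proof. exact: measurableX. Qed.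

Let mcell k (c : leaf d k) : measurable (closed_cell c : set S).
Proof. by apply: closed_borel; exact: closed_closed_cell. Qed.

Let nu_fin (A : set S) : measurable A -> nu A = (fine (nu A))%:E.
Proof. by move=> mA; rewrite fineK // fin_num_measure. Qed.

Let r0 : 0 < r. Proof. exact: r_gt0 rE. Qed.
Let r1 : r < 1. Proof. exact: r_lt1 beta0 rE. Qed.

(** The kernel is integrated term by term; masses of adjacent cells are
    compared by the inequality between means. *)
Lemma riesz_energy_le (K : R) :
  (forall n, \sum_(k < n.+1) (r^-1) ^+ k *
     \sum_(c : leaf d k) fine (nu (closed_cell c)) ^+ 2 <= K) ->
  (riesz_energy <= (r^-1 * 6 ^+ d * K)%:E)%E.
Proof.
move=> hK.
pose t k (z : S * S) : R := r^-1 ^+ k.+1 *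
    \sum_(ab : leaf d k * leaf d k | adjacent ab.1 ab.2)
       \1_(closed_cell ab.1 `*` closed_cell ab.2) z.
have t0 k z : 0 <= t k z.
  apply: mulr_ge0; first by rewrite exprn_ge0 // invr_ge0 ltW.
  by apply: sumr_ge0 => ab _; rewrite indicE.
have tE k : (fun z => (t k z)%:E) = (fun z => (r^-1 ^+ k.+1)%:E *
    \sum_(ab <- enum [pred ab : leaf d k * leaf d k | adjacent ab.1 ab.2])
       (\1_(closed_cell ab.1 `*` closed_cell ab.2 : set (S * S)) z)%:E)%E.
  by apply/funext => z; rewrite /t EFinM sumEFin big_enum.
have mind k (ab : leaf d k * leaf d k) : measurable_fun [set: S * S]
    (fun z => (\1_(closed_cell ab.1 `*` closed_cell ab.2 : set (S * S)) z)%:E : \bar R).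
  apply/measurable_EFinP; apply: measurable_indic; exact: measurableX.
have mt k : measurable_fun [set: S * S] (fun z => (t k z)%:E).
  rewrite tE.
  apply: emeasurable_funM; first exact: measurable_cst.
  by apply: emeasurable_sum => ab; exact: mind.
have intt k : (\int[(nu \x nu)%E]_z (t k z)%:E <=
    (r^-1 ^+ k.+1 * (6 ^+ d * \sum_(c : leaf d k) fine (nu (closed_cell c)) ^+ 2))%:E)%E.
  rewrite tE.
  rewrite ge0_integralZl //; last 3 first.
  - by apply: emeasurable_sum => ab; exact: mind.
  - by move=> z _; rewrite sumEFin lee_fin; apply: sumr_ge0 => ab _; rewrite indicE.
  - by rewrite lee_fin exprn_ge0 // invr_ge0 ltW.
  rewrite EFinM lee_pmul2l ?lte_fin ?exprn_gt0 ?invr_gt0 //.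
  rewrite ge0_integral_sum //.
  rewrite (eq_bigr (fun ab : leaf d k * leaf d k =>
     (fine (nu (closed_cell ab.1)) * fine (nu (closed_cell ab.2)))%:E)); last first.
    move=> ab _; rewrite integral_indic //; last exact: measurableX.
    rewrite setIT; apply: eq_trans (product_measure1E nu nu (mcell ab.1) (mcell ab.2)) _.
    by rewrite EFinM -!nu_fin.
  rewrite sumEFin lee_fin big_enum /=.
  pose f c := fine (nu (closed_cell c)) ^+ 2 : R.
  apply: (@le_trans _ _ (\sum_(ab : leaf d k * leaf d k | adjacent ab.1 ab.2)
     (f _ ab.1 / 2 + f _ ab.2 / 2))).
    apply: ler_sum => ab _; rewrite /f -subr_ge0.
    rewrite (_ : _ - _ = (fine (nu (closed_cell ab.1)) - fine (nu (closed_cell ab.2))) ^+ 2 / 2);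
      last by field.
    by rewrite divr_ge0 // sqr_ge0.
  have sum1 : \sum_(ab : leaf d k * leaf d k | adjacent ab.1 ab.2) f _ ab.1 / 2 <=
      6 ^+ d * (\sum_(c : leaf d k) f _ c) / 2.
    rewrite (eq_bigl (fun ab : leaf d k * leaf d k => predT ab.1 && adjacent ab.1 ab.2)) //.
    rewrite -(pair_big_dep predT (fun a b => adjacent a b) (fun a b => f _ a / 2)) /=.
    rewrite mulr_sumr mulr_suml; apply: ler_sum => a _; rewrite sumr_const -[leLHS]mulr_natl -mulrA.
    apply: ler_wpM2r; first by rewrite divr_ge0 // sqr_ge0.
    by rewrite -natrX ler_nat card_adjacent.
  have sum2 : \sum_(ab : leaf d k * leaf d k | adjacent ab.1 ab.2) f _ ab.2 / 2 <=
      6 ^+ d * (\sum_(c : leaf d k) f _ c) / 2.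
    rewrite (eq_bigl (fun ab : leaf d k * leaf d k => predT ab.1 && adjacent ab.1 ab.2)) //.
    rewrite -(pair_big_dep predT (fun a b => adjacent a b) (fun a b => f _ b / 2)) /=.
    rewrite (exchange_big_dep predT) //=.
    rewrite mulr_sumr mulr_suml; apply: ler_sum => a _; rewrite sumr_const -[leLHS]mulr_natl -mulrA.
    apply: ler_wpM2r; first by rewrite divr_ge0 // sqr_ge0.
    rewrite -natrX ler_nat; apply: leq_trans (card_adjacent a).
    by apply/subset_leq_card/fintype.subsetP => b; rewrite !inE adjacentC.
  rewrite big_split /=; apply: le_trans (lerD sum1 sum2) _.
  by rewrite -splitr.
apply: (@le_trans _ _ (\int[(nu \x nu)%E]_(z in L `*` L) \sum_(0 <= k <oo) (t k z)%:E)%E).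
  apply: ge0_le_integral => //.
  - by move=> z _; exact: riesz_kernel_ge0.
  - exact: measurable_funTS measurable_riesz.
  - apply: ge0_emeasurable_sum; first by move=> k z _ _; rewrite lee_fin.
    by move=> k _; exact: measurable_funTS.
  - by move=> [x y] [/= Lx Ly]; exact: (riesz_kernel_le beta0 rE (Lbox Lx) (Lbox Ly)).
apply: (@le_trans _ _ (\int[(nu \x nu)%E]_z \sum_(0 <= k <oo) (t k z)%:E)%E).
  apply: ge0_subset_integral => //.
  - by apply: ge0_emeasurable_sum => [k z _ _|k _]; [rewrite lee_fin|exact: mt].
  - by move=> z _; apply: nneseries_ge0 => k _ _; rewrite lee_fin.
rewrite integral_nneseries //; last by move=> k z _; rewrite lee_fin.
apply: lime_le.
  by apply: is_cvg_nneseries => k _ _; apply: integral_ge0 => z _; rewrite lee_fin.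
apply: nearW => n; apply: (@le_trans _ _ (\sum_(0 <= k < n)
   (r^-1 ^+ k.+1 * (6 ^+ d * \sum_(c : leaf d k) fine (nu (closed_cell c)) ^+ 2))%:E)%E).
  by apply: lee_sum => k _; exact: intt.
rewrite sumEFin lee_fin; apply: (@le_trans _ _ (\sum_(0 <= k < n.+1)
   (r^-1 * 6 ^+ d) * (r^-1 ^+ k * \sum_(c : leaf d k) fine (nu (closed_cell c)) ^+ 2))).
  rewrite big_nat_recr //= -[leLHS]addr0; apply: lerD; last first.
    by rewrite !mulr_ge0 ?invr_ge0 ?exprn_ge0 ?invr_ge0 ?sumr_ge0 ?(ltW r0) // => c _; exact: sqr_ge0.
  by apply: ler_sum => k _; rewrite exprS le_eqVlt; apply/orP; left; apply/eqP; ring.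
rewrite -mulr_sumr big_mkord; apply: ler_wpM2l; last exact: hK.
by rewrite mulr_ge0 ?exprn_ge0 // invr_ge0 ltW.
Qed.

Let seen n (v : leaf d n) : set 'rV[R]_d :=
  [set x | exists2 u : leaf d n, (enum_rank u < enum_rank v)%N & closed_cell u x].

(** Half-open cells would miss the upper faces of the box, so the closed ones are
    made disjoint by enumeration. *)
Let piece n (v : leaf d n) : set 'rV[R]_d := L `&` (closed_cell v `\` seen v).

Let mpiece n (v : leaf d n) : measurable (piece v : set S).
Proof.
apply: measurableI => //; apply: measurableD; first exact: mcell.
exact: (@measurable_finset _ S _ (fun u : leaf d n => (enum_rank u < enum_rank v)%N)).
Qed.

Let piece_disj n (u v : leaf d n) x : piece u x -> piece v x -> u = v.
Proof.
move=> [_ [ux nu_]] [_ [vx nv]]; apply: enum_rank_inj; apply: val_inj => /=.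
by case: (ltngtP (enum_rank u) (enum_rank v)) => // h; exfalso;
  [apply: nv; exists u | apply: nu_; exists v].
Qed.

Let piece_cover n x : L x -> exists v : leaf d n, piece v x.
Proof.
move=> Lx; have [v0 xv0] := exists_closed_cell n (Lbox Lx).
pose Q (v : leaf d n) := `[< closed_cell v x >].
have Qv0 : Q v0 by apply/asboolP.
case: (@arg_minnP _ v0 Q (fun v => enum_rank v : nat) Qv0) => v /asboolP xv vmin.
exists v; split=> //; split=> // -[u uv /asboolP xu].
by have := vmin u xu; rewrite leqNgt uv.
Qed.

Definition cell_law n (v : leaf d n) : R := fine (nu (piece v)).

Lemma cell_law_ge0 n (v : leaf d n) : 0 <= cell_law v. Proof. exact: fine_ge0. Qed.

Lemma sum_cell_law n : \sum_(v : leaf d n) cell_law v = 1.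
Proof.
have := @pr_sum _ S _ nu _ predT (@piece n) (@mpiece n)
  (fun u v x ux vx => piece_disj ux vx).
rewrite /pr => <-; rewrite (_ : [set w | _] = L) ?nuL //.
apply/seteqP; split=> x; first by move=> [v _ []].
by move=> /(piece_cover n)[v xv]; exists v.
Qed.

Lemma cell_law_supp n (v : leaf d n) : cell_law v != 0 ->
  exists2 x, L x & closed_cell v x.
Proof.
move=> h; have [x [Lx [vx _]]] : exists x, piece v x.
  apply/not_existsP => no; move/eqP: h; apply.
  by rewrite /cell_law (_ : piece v = set0) ?measure0 // -subset0 => x /no.
by exists x.
Qed.

(** Two points of pieces that share their ancestors up to level [K] are within
    [2 ^- K] in every coordinate, and the geometric sum of the weights up to [K]
    is of the order of its last term. *)
Lemma cell_law_energy n :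
  ((dyadic_energy r (@cell_law n))%:E <= (d%:R `^ beta / (1 - r))%:E * riesz_energy)%E.
Proof.
pose kap (u v : leaf d n) : R := \sum_(k < n.+1) r^-1 ^+ k *+ (anc k u == anc k v).
have kap0 u v : 0 <= kap u v.
  by apply: sumr_ge0 => k _; rewrite mulrn_wge0 // exprn_ge0 // invr_ge0 ltW.
have DE : dyadic_energy r (@cell_law n) =
    \sum_(uv : leaf d n * leaf d n) kap uv.1 uv.2 * (cell_law uv.1 * cell_law uv.2).
  rewrite /dyadic_energy /level_mass.
  under eq_bigr do rewrite -sum_same_class mulr_sumr.
  rewrite exchange_big /= -(pair_bigA _ (fun u v => kap u v * (cell_law u * cell_law v))) /=.
  apply: eq_bigr => u _; under eq_bigr do rewrite mulr_sumr.
  rewrite exchange_big; apply: eq_bigr => v _; rewrite /kap mulr_suml.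
  apply: eq_bigr => k _; case: (_ == _); rewrite ?mulr0n ?mulr1n ?mul0r ?mulr0 //.
have c0 : 0 < d%:R `^ beta / (1 - r).
  by rewrite divr_gt0 ?powR_gt0 ?ltr0n // subr_gt0.
have kap_le u v x y : closed_cell u x -> closed_cell v y ->
    ((kap u v)%:E <= (d%:R `^ beta / (1 - r))%:E * riesz_kernel beta (x, y))%E.
  move=> ux vy; have [K Kn [PK _]] := anc_chain (R := R) u v.
  have kle : kap u v <= r^-1 ^+ K / (1 - r).
    rewrite ler_pdivlMr ?subr_gt0 // mulrC /kap.
    rewrite (eq_bigr (fun k : 'I_n.+1 => r^-1 ^+ k *+ (k <= K)%N)); last first.
      by move=> k _; rewrite PK // -ltnS.
    by apply: geometric_prefix => //; rewrite r0 r1.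
  have /eqP e : anc K u == anc K v by rewrite PK.
  have hx : closed_cell (anc K u) x by exact: cell_sub_anc ux.
  have hy : closed_cell (anc K u) y by rewrite e; exact: cell_sub_anc vy.
  have := riesz_kernel_ge beta0 rE d0 hx hy.
  move=> /(lee_wpmul2l _) h; apply: le_trans (h (d%:R `^ beta / (1 - r))%:E _); last first.
    by rewrite lee_fin ltW.
  rewrite -EFinM lee_fin; apply: le_trans kle _.
  have dn0 : d%:R `^ beta != 0 :> R by rewrite gt_eqF // powR_gt0 ?ltr0n.
  rewrite powRN le_eqVlt; apply/orP; left; apply/eqP; move: (r^-1 ^+ K) => t.
  by field; rewrite dn0 subr_eq0 gt_eqF.
pose g (z : S * S) : \bar R := (\sum_(uv <- enum {: leaf d n * leaf d n})
  ((kap uv.1 uv.2)%:E * (\1_(piece uv.1 `*` piece uv.2 : set (S * S)) z)%:E))%E.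
have mterm (uv : leaf d n * leaf d n) : measurable_fun [set: S * S] (fun z =>
   ((kap uv.1 uv.2)%:E * (\1_(piece uv.1 `*` piece uv.2 : set (S * S)) z)%:E)%E : \bar R).
  apply: emeasurable_funM; first exact: measurable_cst.
  by apply/measurable_EFinP; apply: measurable_indic; exact: measurableX.
have term0 (uv : leaf d n * leaf d n) z :
   (0 <= (kap uv.1 uv.2)%:E * (\1_(piece uv.1 `*` piece uv.2 : set (S * S)) z)%:E :> \bar R)%E.
  by rewrite mule_ge0 // lee_fin ?indicE.
have intg : (\int[(nu \x nu)%E]_(z in L `*` L) g z)%E = (dyadic_energy r (@cell_law n))%:E.
  rewrite /g (ge0_integral_sum _ mLL (fun uv => measurable_funTS (mterm uv))
    (fun uv z _ => term0 uv z)).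
  rewrite DE -sumEFin big_enum /=; apply: eq_bigr => uv _.
  have mi : measurable_fun (L `*` L : set (S * S)) (fun z =>
      (\1_(piece uv.1 `*` piece uv.2 : set (S * S)) z)%:E : \bar R).
    apply: measurable_funTS; apply/measurable_EFinP; apply: measurable_indic.
    exact: measurableX.
  rewrite (ge0_integralZl _ mLL mi); last 2 first.
  - by move=> z _; rewrite lee_fin indicE.
  - by rewrite lee_fin.
  rewrite integral_indic //; last exact: measurableX.
  rewrite (_ : _ `&` _ = piece uv.1 `*` piece uv.2); last first.
    by apply/seteqP; split=> z; [case|move=> [[? ?] [? ?]]].
  rewrite EFinM; congr (_ * _)%E.
  apply: eq_trans (product_measure1E nu nu (mpiece uv.1) (mpiece uv.2)) _.
  by rewrite EFinM -!nu_fin.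
rewrite -intg /riesz_energy -ge0_integralZl //; last 3 first.
- exact: measurable_funTS measurable_riesz.
- by move=> z _; exact: riesz_kernel_ge0.
- by rewrite lee_fin ltW.
apply: ge0_le_integral => //.
- by move=> z _; apply: sume_ge0 => uv _.
- by apply: measurable_funTS; apply: emeasurable_sum.
- apply: emeasurable_funM; first exact: measurable_cst.
  exact: measurable_funTS measurable_riesz.
move=> [x y] [/= Lx Ly].
have [u xu] := piece_cover n Lx; have [v yv] := piece_cover n Ly.
rewrite /g big_enum /= (bigD1 (u, v)) //= big1 ?adde0; last first.
  move=> [u' v'] /= ne; rewrite indicE memNset ?mule0 // => -[/= xu' yv'].
  by move/eqP: ne; apply; rewrite (piece_disj xu xu') (piece_disj yv yv').
rewrite indicE mem_set // mule1; case: xu yv => [_ [ux _]] [_ [vy _]].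
exact: kap_le.
Qed.

End Measures.
End RieszEnergy.

(** * Hitting probabilities and capacity *)

Section ModelBounds.
Context {disp : measure_display} {T : measurableType disp} {R : realType}
  {P : probability T R} {d : nat} {p q : R}
  (X : percolation P d p) (Y : percolation P d q).
Hypothesis indXY : independent_families P (keep X) (keep Y).
Hypothesis p01 : 0 < p <= 1.
Hypothesis q01 : 0 < q <= 1.
Hypothesis pq1 : p * q < 1.
Context (B : forall k, pred (leaf d k)) (lam : nat).
Hypothesis cardB : forall k, (#|[pred b | @B k b]| <= lam ^ k)%N.
Hypothesis lam0 : (0 < lam)%N.
Hypothesis B_anc : forall n k (b : leaf d n), (k <= n)%N -> B b -> B (anc k b).
Context (r c0 C0 : R).
Hypothesis r_def : r = p * q * lam%:R.
Hypothesis c0_gt0 : 0 < c0.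
Hypothesis C0_gt0 : 0 < C0.

(** The only ingredient that is proved differently for the sum and for a single
    percolation. *)
Hypothesis lifting : forall n (nu : leaf d n -> R), (0 < n)%N ->
  (forall z, 0 <= nu z) -> exists m : leaf d n * leaf d n -> R,
  [/\ forall s, 0 <= m s,
      forall s, m s != 0 -> B s.2 /\ exists2 z, nu z != 0 & adds_to s z,
      c0 * \sum_z nu z <= \sum_s m s &
      pair_energy p q m <= C0 * dyadic_energy r nu].

Lemma discrete_hit_lower n (A : pred (leaf d n)) (nu : leaf d n -> R) : (0 < n)%N ->
  (forall z, 0 <= nu z) -> (forall z, nu z != 0 -> A z) ->
  (\sum_z nu z) ^+ 2 <=
    C0 / c0 ^+ 2 * dyadic_energy r nu * pr P (discrete_hit X Y B A).
Proof.
move=> n0 nu0 nuA; have [m [m0 mB mass en]] := lifting n0 nu0.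
rewrite r_def in en *.
have := discrete_hit_ge indXY p01 q01 (ltW c0_gt0) nu0 nuA m0 mB mass en.
rewrite exprMn mulrC -ler_pdivlMr ?exprn_gt0 // => h; apply: le_trans h _.
by rewrite le_eqVlt; apply/orP; left; apply/eqP; ring.
Qed.

Context (beta : R) (L : set 'rV[R]_d).
Hypothesis beta0 : 0 < beta.
Hypothesis rE : 2 `^ (- beta) = r.
Hypothesis d0 : (0 < d)%N.
Hypothesis cL : closed L.
Hypothesis Lbox : L `<=` box.

Let M : R := pr P (continuous_hit X Y B L).

Let r0 : 0 < r. Proof. exact: r_gt0 rE. Qed.
Let r1 : r < 1. Proof. exact: r_lt1 beta0 rE. Qed.

Lemma energy_ge0 (nu : probability (borel_space R d) R) : (0 <= riesz_energy beta L nu)%E.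
Proof. by apply: integral_ge0 => z _; exact: riesz_kernel_ge0. Qed.

Lemma capacity_ge0 : (0 <= capacity beta L)%E.
Proof.
rewrite /capacity inve_ge0; apply: le_ereal_inf_tmp => _ [nu _ <-].
exact: energy_ge0.
Qed.

(** The law of the intersection point competes in the definition of the
    capacity. *)
Lemma hit_le_capacity :
  (M%:E <= (r^-1 * 6 ^+ d * (36 ^+ d * 256 / (1 - p * q)))%:E * capacity beta L)%E.
Proof.
set K := _ * _ * _; have K0 : 0 < K.
  by rewrite /K !mulr_gt0 ?exprn_gt0 ?invr_gt0 // subr_gt0.
have [M0|Mn0] := leP M 0.
  apply: (@le_trans _ _ 0%E); first by rewrite lee_fin.
  by rewrite mule_ge0 ?capacity_ge0 // lee_fin ltW.
have [nu nuL en] := hitting_law indXY p01 q01 pq1 cardB lam0 B_anc cL Mn0.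
rewrite -r_def -/M in en.
have := riesz_energy_le beta0 rE cL Lbox en.
rewrite mulrA -/K => enu.
have infle : (ereal_inf [set riesz_energy beta L mu | mu in
    [set mu : probability (borel_space R d) R | mu L = 1%E]] <= (K / M)%:E)%E.
  by apply: le_trans enu; apply: ereal_inf_lbound; exists nu.
have infge : (0 <= ereal_inf [set riesz_energy beta L mu | mu in
    [set mu : probability (borel_space R d) R | mu L = 1%E]])%E.
  by apply: le_ereal_inf_tmp => _ [mu _ <-]; exact: energy_ge0.
have KM0 : (0 <= (K / M)%:E)%E by rewrite lee_fin divr_ge0 // ltW.
have : ((K / M)%:E^-1 <= capacity beta L)%E by rewrite /capacity lee_pV2 ?inE.
rewrite inver mulf_eq0 invr_eq0 !gt_eqF //= => h.
apply: (@le_trans _ _ (K%:E * ((K / M)^-1)%:E)%E).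
  by rewrite -EFinM lee_fin invf_div mulrC divfK // gt_eqF.
by apply: lee_wpmul2l => //; rewrite lee_fin ltW.
Qed.

(** Any measure of finite energy, discretized at level [n] and lifted to pairs,
    forces a positive probability of hitting at level [n], uniformly in [n]. *)
Lemma capacity_le_hit :
  (capacity beta L <= (C0 / c0 ^+ 2 * (d%:R `^ beta / (1 - r)) * M)%:E)%E.
Proof.
set K := C0 / c0 ^+ 2 * _; have K0 : 0 < K.
  apply: mulr_gt0; apply: divr_gt0 => //; first exact: exprn_gt0.
    by rewrite powR_gt0 ?ltr0n.
  by rewrite subr_gt0.
have main (mu : probability (borel_space R d) R) (I : R) : mu L = 1%E ->
    riesz_energy beta L mu = I%:E -> 1 <= K * I * M.
  move=> muL IE.
  have I0 : 0 <= I by rewrite -lee_fin -IE; exact: energy_ge0.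
  have lev n : (0 < n)%N -> 1 <= K * I *
      pr P [set w | exists s : leaf d n * leaf d n, cell_hit X Y B L s w].
    move=> n0; pose A z := `[< exists2 x, L x & @closed_cell R d n z x >].
    have := @discrete_hit_lower n A (@cell_law R d L mu n) n0 (@cell_law_ge0 R d L mu n) _.
    rewrite sum_cell_law // expr1n => h; apply: le_trans (h _) _.
      by move=> z /cell_law_supp h1; apply/asboolP/h1.
    have en := cell_law_energy beta0 rE d0 mu cL Lbox n.
    rewrite IE -EFinM lee_fin in en.
    have sub : discrete_hit X Y B A `<=`
        [set w | exists s : leaf d n * leaf d n, cell_hit X Y B L s w].
      by apply: discrete_sub_cell_hit => // z /asboolP.
    apply: ler_pM.
    - apply: mulr_ge0; first by rewrite divr_ge0 ?exprn_ge0 // ltW.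
      apply: sumr_ge0 => k _; apply: mulr_ge0; first by rewrite exprn_ge0 // invr_ge0 ltW.
      by apply: sumr_ge0 => c _; exact: sqr_ge0.
    - exact: pr_ge0.
    - rewrite /K -[leRHS]mulrA; apply: ler_wpM2l => //.
      by rewrite divr_ge0 ?exprn_ge0 // ltW.
    apply: pr_le sub; first exact: measurable_discrete_hit.
    rewrite (_ : [set w | _] = [set w | exists2 s : leaf d n * leaf d n,
      predT s & cell_hit X Y B L s w]).
      by apply: measurable_finset; exact: measurable_cell_hit.
    by apply/seteqP; split=> w [s]; [move=> ?; exists s | move=> _ ?; exists s].
  have [KI0|KI0] := leP (K * I) 0.
    have := lev 1%N isT; move=> /le_trans /(_ (mulr_le0_ge0 KI0 (pr_ge0 P _))).
    by rewrite ler10.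
  rewrite mulrC -ler_pdivrMr // div1r; apply: (sub_continuous_hit B_anc) => n n0.
  by rewrite -div1r ler_pdivrMr // mulrC; exact: lev.
have M_ge0 : 0 <= M by exact: pr_ge0.
(* if the hitting probability vanishes, no measure on [L] has finite energy *)
have [M0|Mn0] := eqVneq M 0.
  rewrite M0 mulr0 /capacity.
  suff -> : ereal_inf [set riesz_energy beta L mu | mu in
    [set mu : probability (borel_space R d) R | mu L = 1%E]] = +oo%E by rewrite invey.
  apply/eqP; rewrite -leye_eq; apply: le_ereal_inf_tmp => _ [mu muL <-].
  case E : (riesz_energy beta L mu) => [I||] //; last first.
    by have := energy_ge0 mu; rewrite E.
  by have := main mu I muL E; rewrite M0 mulr0 ler10.
have Mp : 0 < M by rewrite lt_neqAle eq_sym Mn0.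
have KMp : 0 < K * M := mulr_gt0 K0 Mp.
have infge : (((K * M)^-1)%:E <= ereal_inf [set riesz_energy beta L mu | mu in
    [set mu : probability (borel_space R d) R | mu L = 1%E]])%E.
  apply: le_ereal_inf_tmp => _ [mu muL <-].
  case E : (riesz_energy beta L mu) => [I||].
  - rewrite lee_fin -div1r ler_pdivrMr //.
    by have := main mu I muL E; rewrite mulrAC mulrC.
  - by rewrite leey.
  - by have := energy_ge0 mu; rewrite E.
have KM0 : 0 < (K * M)^-1 by rewrite invr_gt0.
have -> : (K * M)%:E = (((K * M)^-1)%:E^-1)%E.
  by rewrite inver gt_eqF // invrK.
rewrite /capacity lee_pV2 ?inE ?lee_fin ?(ltW KM0) //.
by apply: le_trans infge; rewrite lee_fin ltW.
Qed.

End ModelBounds.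

(** * The sum and the single percolation *)

Section SureKeep.
Context {disp : measure_display} {T : measurableType disp} {R : realType}
  (P : probability T R) (d : nat).

Let keep_all (c : nat * 'rV[int]_d) : set T := setT.

Let keep_all_measurable c : measurable (keep_all c).
Proof. exact: measurableT. Qed.

Let keep_all_prob c : P (keep_all c) = 1%:E.
Proof. exact: probability_setT. Qed.

Let keep_all_independent : mutually_independent P keep_all.
Proof.
move=> s us; rewrite big1; last by move=> i _; exact: keep_all_prob.
rewrite (_ : \bigcap_(i in _) _ = setT) ?probability_setT //.
by apply/seteqP; split=> w.
Qed.

(** The second term of the sum when a single percolation is viewed as a sum. *)
Definition sure_percolation : percolation P d 1 :=
  Percolation keep_all_measurable keep_all_prob keep_all_independent.

Lemma sure_percolation_independent (I : Type) (E : I -> set T) :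
  (forall i, measurable (E i)) -> independent_families P E (keep sure_percolation).
Proof.
move=> mE A F sA sF.
have [->|->] : F = set0 \/ F = setT.
- apply: (sF (fun F => F = set0 \/ F = setT)); split; last first.
    by move=> _ [c _ <-]; right.
  split; first by left.
    by move=> G [->|->]; rewrite ?setD0 ?setDv; [right|left].
  move=> G hG; have [[k Gk]|no] := pselect (exists k, G k = setT).
    by right; apply/seteqP; split=> // w _; exists k => //; rewrite Gk.
  left; rewrite -subset0 => w [k _]; case: (hG k) => Gk; first by rewrite Gk.
  by exfalso; apply: no; exists k.
- by rewrite setI0 measure0 mule0.
- by rewrite setIT probability_setT mule1.
Qed.

End SureKeep.

Section Instances.
Context {disp : measure_display} {T : measurableType disp} {R : realType}
  {P : probability T R} {d : nat}.

Definition everywhere k : pred (leaf d k) := predT.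
Definition at_center k : pred (leaf d k) := pred1 (center k).

Lemma at_center_anc n k (b : leaf d n) : (k <= n)%N -> at_center b -> at_center (anc k b).
Proof. by move=> kn /eqP ->; rewrite /at_center /= anc_center. Qed.

Definition target n (A : set 'rV[int]_d) : pred (leaf d n) :=
  fun z => `[< A (vertex n.-1 (fun i => z i)) >].

Section Sum.
Context {p q : R} (X : percolation P d p) (Y : percolation P d q).

Lemma discrete_sum_hitE n (A : set 'rV[int]_d) : (0 < n)%N ->
  A `<=` [set x | forall i, - 2 ^+ n.-1 <= x ord0 i < 2 ^+ n.-1] ->
  [set w | sumset (discrete_percolation X n w) (discrete_percolation Y n w) `&` A !=set0] =
  discrete_hit X Y everywhere (@target n A).
Proof.
move=> n0 Abox; apply/seteqP; split=> w.
  move=> [a [[_ /(discrete_percolationE X w _ n0)[u -> uw]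
    [_ /(discrete_percolationE Y w _ n0)[v -> vw] aE]] Aa]].
  have zP i : exists z : nat, a ord0 i = z%:Z - 2 ^+ n.-1 /\ (z < 2 ^ n)%N.
    have := Abox _ Aa i; have pe : (2 : int) ^+ n.-1 = (2 ^ n.-1)%N%:Z by rewrite -natrX natz.
    have nE : (2 ^ n = 2 ^ n.-1 + 2 ^ n.-1)%N by rewrite -[in LHS](prednK n0) expnS mul2n addnn.
    rewrite pe nE; move: (2 ^ n.-1)%N (a ord0 i : int) => K ai /andP[h1 h2].
    by exists (absz (ai + K%:Z)); split; lia.
  have [z hz] := choice zP.
  pose zl : leaf d n := [ffun i => Ordinal (hz i).2].
  have azl : a = vertex n.-1 (fun i => zl i).
    by apply/rowP => i; rewrite mxE ffunE /= (hz i).1.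
  exists (u, v), zl; split=> //; first by apply/asboolP; rewrite -azl.
  apply/forallP => i; rewrite /= -(eqr_nat int) !natrD.
  have /rowP/(_ i) := aE; rewrite azl !mxE !natz.
  have pe : ((2 ^ n.-1)%N%:Z = 2 ^+ n.-1 :> int) by rewrite -natrX natz.
  by rewrite pe => e; apply/eqP; move: (2 ^+ n.-1) e => K e; lia.
move=> [[u v] [z [/asboolP Az _ sz [uw vw]]]].
exists (vertex n.-1 (fun i => z i)); split=> //.
exists (vertex n.-1 (fun i => u i)); first by apply/discrete_percolationE => //; exists u.
exists (vertex n.-1 (fun i => v i)); first by apply/discrete_percolationE => //; exists v.
apply/rowP => i; rewrite !mxE; have /eqP := forallP sz i.
have pe : ((2 ^ n.-1)%N%:Z = 2 ^+ n.-1 :> int) by rewrite -natrX natz.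
move=> /= /(congr1 Posz); rewrite !PoszD pe; move: (2 ^+ n.-1 : int) => K e; lia.
Qed.

Lemma continuous_sum_hitE (L : set 'rV[R]_d) : closed L ->
  [set w | sumset (continuous_percolation X w) (continuous_percolation Y w) `&` L !=set0] =
  continuous_hit X Y everywhere L.
Proof.
move=> cL.
have hitE w := @continuous_hitE _ _ _ _ _ _ _ X Y everywhere (fun _ _ _ _ _ => isT) L cL w.
apply/seteqP; split=> w.
  move=> [_ [[x /continuous_percolationE hx [y /continuous_percolationE hy <-]] Lxy]].
  apply/hitE; exists x, y; split=> // n n0.
  by have [b yb bw] := hy n n0; exists b.
move=> /hitE [x [y [Lxy hx hy]]].
exists (x + y); split=> //; exists x; first exact/continuous_percolationE.
exists y => //; apply/continuous_percolationE => n n0.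
by have [b [yb _ bw]] := hy n n0; exists b.
Qed.

End Sum.

Section Single.
Context {r : R} (Z : percolation P d r).

Lemma discrete_single_hitE n (A : set 'rV[int]_d) : (0 < n)%N ->
  [set w | discrete_percolation Z n w `&` A !=set0] =
  discrete_hit Z (sure_percolation P d) at_center (@target n A).
Proof.
move=> n0; apply/seteqP; split=> w.
  move=> [_ [/(discrete_percolationE Z w _ n0)[u -> uw] Aa]].
  exists (u, center n), u; split=> //; first exact/asboolP.
    by rewrite /at_center /= eqxx.
  by apply/forallP => i /=; rewrite centerE.
move=> [[u v] [z [/asboolP Az /eqP /= vE sz [uw _]]]].
exists (vertex n.-1 (fun i => z i)); split=> //; apply/discrete_percolationE => //.
exists u => //; apply/rowP => i; rewrite !mxE.
have := forallP sz i; rewrite /= vE centerE // eqn_add2r => /eqP ->.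
by [].
Qed.

Lemma zero_in_center n : (0 < n)%N -> closed_cell (center n) (0 : 'rV[R]_d).
Proof.
move=> n0 i; rewrite mxE centerE //.
have N0 : 0 < 2 ^+ n :> R by rewrite exprn_gt0.
have half : (2 ^ n.-1)%:R / 2 ^+ n = 2^-1 :> R.
  by rewrite natrX -[X in _ / 2 ^+ X](prednK n0) exprS invfM mulrCA divff ?mulr1 // gt_eqF ?exprn_gt0.
have -> : (2 ^ n.-1).+1%:R = (2 ^ n.-1)%:R + 1 :> R by rewrite -natr1.
rewrite mulrDl mul1r half subrr lexx /= addrAC subrr add0r.
by rewrite invr_ge0 ltW.
Qed.

(** The closed cubes chosen around the origin shrink to it, so the second summand
    is the origin. *)
Lemma continuous_single_hitE (L : set 'rV[R]_d) : closed L ->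
  [set w | continuous_percolation Z w `&` L !=set0] =
  continuous_hit Z (sure_percolation P d) at_center L.
Proof.
move=> cL.
have hitE w := @continuous_hitE _ _ _ _ _ _ _ Z (sure_percolation P d) at_center
  (@at_center_anc) L cL w.
apply/seteqP; split=> w.
  move=> [x [/continuous_percolationE hx Lx]].
  apply/hitE; exists x, 0; split=> //; first by rewrite addr0.
  move=> n n0; exists (center n); split=> //; first exact: zero_in_center.
  by rewrite /at_center /= eqxx.
move=> /hitE [x [y [Lxy hx hy]]].
exists x; split; first exact/continuous_percolationE.
apply: (closed_approx (C := 1) cL) => k; exists (x + y) => // i.
have [b [yb /eqP bE _]] := hy k.+1 isT; rewrite bE in yb.
have := closed_cell_dist i yb (zero_in_center (ltn0Sn k)).
rewrite !mxE subr0 => yk; rewrite opprD addrA subrr add0r normrN mul1r.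
apply: le_trans yk _; rewrite lef_pV2 ?posrE ?exprn_gt0 //.
by rewrite ler_weXn2l // ler1n.
Qed.

End Single.
End Instances.

(** * Comparison of the two percolations *)

(** [M1] and [M2] are the hitting probabilities of two models and [E] is the
    energy of the charge that the first one provides and the second one uses. *)
Lemma charge_comparison (R : realFieldType) (E M1 M2 C K : R) :
  0 <= M1 -> 0 <= M2 -> 0 <= K -> 0 <= C -> E <= C * M1 -> M1 ^+ 2 <= K * E * M2 ->
  M1 <= K * C * M2.
Proof.
move=> M10 M20 K0 C0 EM h; have [->|n0] := eqVneq M1 0; first by rewrite !mulr_ge0.
have Mp : 0 < M1 by rewrite lt_neqAle eq_sym n0.
rewrite -(ler_pM2r Mp) -expr2; apply: le_trans h _.
rewrite [leRHS](_ : _ = K * (C * M1) * M2); last by ring.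
by apply: ler_wpM2r => //; apply: ler_wpM2l.
Qed.

Lemma lifting_sum (R : realFieldType) (d : nat) (p q : R) (n : nat) (nu : leaf d n -> R) :
  0 < p -> 0 < q -> 1 < p * 2 ^+ d -> 1 < q * 2 ^+ d -> (0 < n)%N ->
  (forall z, 0 <= nu z) -> exists m : leaf d n * leaf d n -> R,
  [/\ forall s, 0 <= m s,
      forall s, m s != 0 -> everywhere s.2 /\ exists2 z, nu z != 0 & adds_to s z,
      (2 ^+ d)^-1 * \sum_z nu z <= \sum_s m s &
      pair_energy p q m <= 36 ^+ d * ((1 - (p * 2 ^+ d)^-1)^-1 + (1 - (q * 2 ^+ d)^-1)^-1) *
        dyadic_energy (p * q * 2 ^+ d) nu].
Proof.
move=> p0 q0 pD qD n0 nu0; exists (lift_sum nu); split.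
- by move=> s; exact: lift_sum_ge0.
- by move=> s /lift_sum_supp.
- exact: sum_lift_sum.
- exact: lift_sum_energy.
Qed.

Lemma lifting_point (R : realFieldType) (d : nat) (r : R) (n : nat) (nu : leaf d n -> R) :
  0 < r -> (0 < n)%N ->
  (forall z, 0 <= nu z) -> exists m : leaf d n * leaf d n -> R,
  [/\ forall s, 0 <= m s,
      forall s, m s != 0 -> at_center s.2 /\ exists2 z, nu z != 0 & adds_to s z,
      1 * \sum_z nu z <= \sum_s m s &
      pair_energy r 1 m <= 1 * dyadic_energy r nu].
Proof.
move=> r0 n0 nu0; exists (lift_point nu); split.
- by move=> s; rewrite /lift_point; case: ifP.
- move=> s; rewrite /lift_point; case: ifP => [/eqP sE|_]; last by rewrite eqxx.
  move=> h; split; first by rewrite /at_center /= sE.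
  by exists s.1 => //; apply/forallP => i; rewrite sE centerE.
- by rewrite mul1r; have := sum_lift_point nu predT => /= ->.
- by rewrite mul1r; exact: lift_point_energy.
Qed.

Theorem corollary1p7 (R : realType) (d : nat) (p q : R) (beta : R)
    (hd : (1 <= d)%N) (hp01 : 0 < p < 1) (hq01 : 0 < q < 1)
    (hbeta : beta = - (ln (2 ^+ d * p * q) / ln 2)) (beta_gt0 : 0 < beta)
    (hp : (2 ^+ d)^-1 < p) (hq : (2 ^+ d)^-1 < q) :
  exists c C : R, 0 < c /\ c <= C /\
    forall (disp disp' : measure_display)
      (T : measurableType disp) (T' : measurableType disp')
      (P : probability T R) (P' : probability T' R)
      (X : percolation P d p) (Y : percolation P d q)
      (Z : percolation P' d (2 ^+ d * p * q)),
    independent_families P (keep X) (keep Y) ->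
    (forall (n : nat) (A : set 'rV[int]_d),
        (1 <= n)%N ->
        A `<=` [set x : 'rV[int]_d | forall i, - 2 ^+ n.-1 <= x ord0 i < 2 ^+ n.-1] ->
        let prob_single := P' [set w | discrete_percolation Z n w `&` A !=set0] in
        let prob_sum := P [set w | sumset (discrete_percolation X n w)
                                     (discrete_percolation Y n w)
                              `&` A !=set0] in
        (c%:E * prob_single <= prob_sum)%E /\ (prob_sum <= C%:E * prob_single)%E)
    /\
    (forall L : set 'rV[R]_d,
        closed L ->
        L `<=` [set x : 'rV[R]_d | forall i, - 2^-1 <= x ord0 i <= 2^-1] ->
        let prob_single := P' [set w | continuous_percolation Z w `&` L !=set0] in
        let prob_sum := P [set w | sumset (continuous_percolation X w)
                                     (continuous_percolation Y w)
                              `&` L !=set0] in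
        ((c%:E * capacity beta L <= prob_sum)%E /\
         (prob_sum <= C%:E * capacity beta L)%E) /\
        ((c%:E * capacity beta L <= prob_single)%E /\
         (prob_single <= C%:E * capacity beta L)%E)).
Proof.
have [p0 p1] := andP hp01; have [q0 q1] := andP hq01.
set r := 2 ^+ d * p * q; set D : R := 2 ^+ d.
have D0 : 0 < D by rewrite exprn_gt0.
have pD : 1 < p * D by rewrite -ltr_pdivrMr // div1r.
have qD : 1 < q * D by rewrite -ltr_pdivrMr // div1r.
have r0 : 0 < r by rewrite !mulr_gt0.
have ln2 : 0 < ln 2 :> R by rewrite ln_gt0 // ltr1n.
have rE : 2 `^ (- beta) = r.
  by rewrite hbeta opprK /powR pnatr_eq0 /= divfK ?gt_eqF // lnK.
have r1 : r < 1 by exact: r_lt1 beta_gt0 rE.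
have pq1 : p * q < 1 by rewrite (lt_trans _ p1) // gtr_pMr.
have r_sum : r = p * q * (2 ^ d)%N%:R by rewrite natrX /r; ring.
have r_point : r = r * 1 * 1%N%:R by rewrite !mulr1.
have p01 : 0 < p <= 1 by rewrite p0 ltW.
have q01 : 0 < q <= 1 by rewrite q0 ltW.
have r01 : 0 < r <= 1 by rewrite r0 ltW.
have one01 : 0 < (1 : R) <= 1 by rewrite ltr01 lexx.
have r1' : r * 1 < 1 by rewrite mulr1.
have card_all k : (#|[pred b | @everywhere d k b]| <= (2 ^ d) ^ k)%N.
  by rewrite -card_leaf; exact: max_card.
have card_center k : (#|[pred b | @at_center d k b]| <= 1 ^ k)%N.
  rewrite exp1n; apply: leq_trans (eq_leq (card1 (center k : leaf d k))).
  by apply/subset_leq_card/fintype.subsetP => b.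
have pow_pos : (0 < 2 ^ d)%N by rewrite expn_gt0.
pose Cs : R := 36 ^+ d * 256 / (1 - p * q).
pose Cz : R := 36 ^+ d * 256 / (1 - r * 1).
pose Ks : R := 36 ^+ d * ((1 - (p * D)^-1)^-1 + (1 - (q * D)^-1)^-1).
pose ks : R := Ks / D^-1 ^+ 2.
pose kz : R := 1 / 1 ^+ 2.
have Ks0 : 0 < Ks.
  have gap (x : R) : 1 < x -> 0 < (1 - x^-1)^-1.
    by move=> x1; rewrite invr_gt0 subr_gt0 invf_lt1 // (lt_trans _ x1).
  apply: mulr_gt0; first exact: exprn_gt0.
  by apply: addr_gt0; exact: gap.
have ks0 : 0 < ks by rewrite divr_gt0 // exprn_gt0 // invr_gt0.
have kz0 : 0 < kz by rewrite /kz expr1n divr1.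
have Cs0 : 0 < Cs by rewrite divr_gt0 ?subr_gt0 // mulr_gt0 // exprn_gt0.
have Cz0 : 0 < Cz by rewrite divr_gt0 ?subr_gt0 // mulr_gt0 // exprn_gt0.
pose u : R := d%:R `^ beta / (1 - r).
have u0 : 0 < u by rewrite divr_gt0 ?subr_gt0 // powR_gt0 ?ltr0n.
pose v : R := r^-1 * 6 ^+ d.
have v0 : 0 < v by rewrite mulr_gt0 ?invr_gt0 // exprn_gt0.
pose K : R := 1 + ks * Cz + kz * Cs + ks * u + kz * u + v * Cs + v * Cz.
have t1 : 0 < ks * Cz by exact: mulr_gt0.
have t2 : 0 < kz * Cs by exact: mulr_gt0.
have t3 : 0 < ks * u by exact: mulr_gt0.
have t4 : 0 < kz * u by exact: mulr_gt0.
have t5 : 0 < v * Cs by exact: mulr_gt0.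
have t6 : 0 < v * Cz by exact: mulr_gt0.
have K1 : 1 <= K by rewrite /K; lra.
have Kp : 0 < K by lra.
have KV (x y : \bar R) (k : R) : (0 <= y)%E -> k <= K -> (x <= k%:E * y)%E ->
    ((K^-1)%:E * x <= y)%E /\ (x <= K%:E * y)%E.
  move=> y0 kK xy; have xKy : (x <= K%:E * y)%E.
    by apply: le_trans xy _; apply: lee_wpmul2r; rewrite ?lee_fin.
  split=> //; rewrite -[leRHS]mul1e (_ : 1%E = (K^-1)%:E * K%:E)%E; last by rewrite -EFinM mulVf // gt_eqF.
  rewrite -muleA.
  apply: lee_wpmul2l; last exact: xKy. 
  by rewrite lee_fin invr_ge0 ltW.
exists K^-1, K; split; first by rewrite invr_gt0.
have KV1 : K^-1 <= 1 by rewrite invf_le1.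
split; first exact: le_trans KV1 K1.
move=> disp disp' T T' P P' X Y Z indXY.
have indZ : independent_families P' (keep Z) (keep (sure_percolation P' d)).
  by apply: sure_percolation_independent => c; exact: keep_measurable.
have liftS n nu n0 nu0 := @lifting_sum R d p q n nu p0 q0 pD qD n0 nu0.
have rD : p * q * D = r by rewrite r_sum natrX.
rewrite rD in liftS.
have liftZ n nu n0 nu0 := @lifting_point R d r n nu r0 n0 nu0.
have D'0 : 0 < D^-1 by rewrite invr_gt0.
split.
  move=> n A n0 Abox; rewrite (discrete_sum_hitE X Y n0 Abox) discrete_single_hitE //.
  set A' := target A.
  have mS := measurable_discrete_hit X Y (@everywhere d) A'.
  have mZ := measurable_discrete_hit Z (sure_percolation P' d) (@at_center d) A'.
  rewrite /= (prE P mS) (prE P' mZ).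
  have lowS := @discrete_hit_lower _ _ _ _ _ _ _ X Y indXY p01 q01 (@everywhere d)
    (2 ^ d)%N r D^-1 Ks r_sum D'0 liftS n A'.
  have lowZ := @discrete_hit_lower _ _ _ _ _ _ _ Z (sure_percolation P' d) indZ r01 one01
    (@at_center d) 1%N r 1 1 r_point ltr01 liftZ n A'.
  have [nS [nS0 nSA sumS enS]] := @discrete_hit_charge _ _ _ _ _ _ _ X Y indXY p01 q01 pq1
    (@everywhere d) (2 ^ d)%N card_all pow_pos (fun _ _ _ _ _ => isT) n A' n0.
  have [nZ [nZ0 nZA sumZ enZ]] := @discrete_hit_charge _ _ _ _ _ _ _ Z (sure_percolation P' d)
    indZ r01 one01 r1' (@at_center d) 1%N card_center (ltn0Sn 0) (@at_center_anc d) n A' n0.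
  rewrite -r_sum in enS; rewrite -r_point in enZ.
  have hS := lowZ nS n0 nS0 nSA; rewrite sumS in hS.
  have hZ := lowS nZ n0 nZ0 nZA; rewrite sumZ in hZ.
  have cmpS := charge_comparison (pr_ge0 _ _) (pr_ge0 _ _) (ltW kz0) (ltW Cs0) enS hS.
  have cmpZ := charge_comparison (pr_ge0 _ _) (pr_ge0 _ _) (ltW ks0) (ltW Cz0) enZ hZ.
  have k1 : kz * Cs <= K by rewrite /K; lra.
  have k2 : ks * Cz <= K by rewrite /K; lra.
  split.
    by apply: (KV _ _ (ks * Cz) _ k2 _).1; rewrite -?EFinM lee_fin // pr_ge0.
  by apply: (KV _ _ (kz * Cs) _ k1 _).2; rewrite -?EFinM lee_fin // pr_ge0.
move=> L cL Lbox; rewrite (continuous_sum_hitE X Y cL) (continuous_single_hitE Z cL).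
have mS : measurable (continuous_hit X Y (@everywhere d) L).
  by apply: measurable_infinite_branch; exact: measurable_cell_hit.
have mZ : measurable (continuous_hit Z (sure_percolation P' d) (@at_center d) L).
  by apply: measurable_infinite_branch; exact: measurable_cell_hit.
rewrite /= (prE P mS) (prE P' mZ).
have cap0 : (0 <= capacity beta L)%E by exact: capacity_ge0.
have upS := @hit_le_capacity _ _ _ _ _ _ _ X Y indXY p01 q01 pq1 (@everywhere d)
  (2 ^ d)%N card_all pow_pos (fun _ _ _ _ _ => isT) r r_sum beta L beta_gt0 rE cL Lbox.
have upZ := @hit_le_capacity _ _ _ _ _ _ _ Z (sure_percolation P' d) indZ r01 one01 r1'
  (@at_center d) 1%N card_center (ltn0Sn 0) (@at_center_anc d) r r_point beta L beta_gt0 rE cL Lbox.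
have loS := @capacity_le_hit _ _ _ _ _ _ _ X Y indXY p01 q01 (@everywhere d)
  (2 ^ d)%N (fun _ _ _ _ _ => isT) r D^-1 Ks r_sum D'0 Ks0 liftS beta L beta_gt0 rE hd cL Lbox.
have loZ := @capacity_le_hit _ _ _ _ _ _ _ Z (sure_percolation P' d) indZ r01 one01
  (@at_center d) 1%N (@at_center_anc d) r 1 1 r_point ltr01 ltr01 liftZ beta L beta_gt0 rE hd cL Lbox.
have k3 : ks * u <= K by rewrite /K; lra.
have k4 : kz * u <= K by rewrite /K; lra.
have k5 : v * Cs <= K by rewrite /K; lra.
have k6 : v * Cz <= K by rewrite /K; lra.
split; split.
- by apply: (KV _ _ (ks * u) _ k3 _).1; rewrite ?lee_fin ?pr_ge0 // -EFinM.
- exact: (KV _ _ (v * Cs) _ k5 _).2.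
- by apply: (KV _ _ (kz * u) _ k4 _).1; rewrite ?lee_fin ?pr_ge0 // -EFinM.
- exact: (KV _ _ (v * Cz) _ k6 _).2.
Qed.
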